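(* Let $0<\alpha<1$, $l,T>0$, $k(t)\ge c_1>0$ and $q(t)\ge0$ continuous on $[0,T]$, $f$ continuous on $[0,l]\times[0,T]$. Assume $u$, which has continuous partial derivatives up to order $6$ in $x$ and up to order $3$ in $t$ on $[0,l]\times[0,T]$, solves $$\partial_{0t}^\alpha u=k(t)\frac{\partial^2u}{\partial x^2}-q(t)u+f(x,t),\ 0<x<l,\ 0<t\le T;\quad u(0,t)=u(l,t)=0;\quad u(x,0)=u_0(x).$$ Let $\{y_i^j\}$ be the solution of the difference scheme $$\Delta^\alpha_{0t_{j+\sigma}}\mathcal H_hy_i=a^{j+1}y^{(\sigma)}_{\bar xx,i}-d^{j+1}\mathcal H_hy_i^{(\sigma)}+\mathcal H_h\varphi_i^{j+1}\ (1\le i\le N-1,\ 0\le j\le M-1),\quad y_0^j=y_N^j=0,\quad y_i^0=u_0(x_i),$$ with $\sigma=1-\alpha/2$, $h=l/N$, $x_i=ih$, $\tau=T/M$, $t_j=j\tau$, $t_{j+\sigma}=(j+\sigma)\tau$, $a^{j+1}=k(t_{j+\sigma})$, $d^{j+1}=q(t_{j+\sigma})$, $\varphi_i^{j+1}=f(x_i,t_{j+\sigma})$. Then there is a constant $C_R>0$ independent of $\tau$ and $h$ such that $$\|u(\cdot,t_j)-y^j\|_0\le C_R(\tau^2+h^4),\qquad 1\le j\le M .$$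
   Context: Caputo derivative: $\partial_{0t}^\alpha u(x,t)=\frac{1}{\Gamma(1-\alpha)}\int_0^t\partial_\eta u(x,\eta)(t-\eta)^{-\alpha}d\eta$. Mesh notation: $(y,v)=\sum_{i=1}^{N-1}y_iv_ih$, $\|y\|_0^2=(y,y)$; $v_{\bar xx,i}=(v_{i+1}-2v_i+v_{i-1})/h^2$; $\mathcal H_hv_i=v_i+\frac{h^2}{12}v_{\bar xx,i}$; $y^{(\sigma)}=\sigma y^{j+1}+(1-\sigma)y^j$. Discrete fractional derivative: $\Delta^\alpha_{0t_{j+\sigma}}w=\frac{\tau^{1-\alpha}}{\Gamma(2-\alpha)}\sum_{s=0}^{j}c_{j-s}\frac{w^{s+1}-w^s}{\tau}$, with $a_0=\sigma^{1-\alpha}$, $a_m=(m+\sigma)^{1-\alpha}-(m-1+\sigma)^{1-\alpha}$ ($m\ge1$), $b_m=\frac{1}{2-\alpha}[(m+\sigma)^{2-\alpha}-(m-1+\sigma)^{2-\alpha}]-\frac12[(m+\sigma)^{1-\alpha}+(m-1+\sigma)^{1-\alpha}]$ ($m\ge1$); for $j=0$, $c_0=a_0$; for $j\ge1$, $c_0=a_0+b_1$, $c_s=a_s+b_{s+1}-b_s$ ($1\le s\le j-1$), $c_j=a_j-b_j$. *)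

(* Defs.v *)
From Stdlib Require Import Reals.
From Coquelicot Require Import Coquelicot.
Open Scope R_scope.

Definition Gamma (z : R) : R :=
  RInt_gen (fun x => Rpower x (z - 1) * exp (- x)) (at_right 0) (Rbar_locally p_infty).

(* Caputo derivative of order alpha in t of u(x,.) at time t:
   1/Gamma(1-alpha) * int_0^t d_eta u(x,eta) (t-eta)^(-alpha) d eta
   (improper at eta = t, where the kernel is singular). *)
Definition caputo (alpha : R) (u : R -> R -> R) (x t : R) : R :=
  / Gamma (1 - alpha) *
  RInt_gen (fun eta => Derive (fun s => u x s) eta * Rpower (t - eta) (- alpha))
           (at_point 0) (at_left t).

Definition has_deriv_within (a b : R) (g g' : R -> R) : Prop :=
  forall x, a <= x <= b -> forall eps, 0 < eps -> exists delta, 0 < delta /\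
    forall y, a <= y <= b -> y <> x -> Rabs (y - x) < delta ->
      Rabs ((g y - g x) / (y - x) - g' x) < eps.

Definition cont_on (a b : R) (g : R -> R) : Prop :=
  forall x, a <= x <= b -> forall eps, 0 < eps -> exists delta, 0 < delta /\
    forall y, a <= y <= b -> Rabs (y - x) < delta -> Rabs (g y - g x) < eps.

Definition cont_rect (l T : R) (g : R -> R -> R) : Prop :=
  forall x t, 0 <= x <= l -> 0 <= t <= T -> forall eps, 0 < eps ->
    exists delta, 0 < delta /\
    forall x' t', 0 <= x' <= l -> 0 <= t' <= T ->
      Rabs (x' - x) < delta -> Rabs (t' - t) < delta ->
      Rabs (g x' t' - g x t) < eps.

Definition smooth_xt (px pt : nat) (l T : R) (u : R -> R -> R) : Prop :=
  (exists Dx : nat -> R -> R -> R,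
     Dx O = u /\
     (forall k, (k < px)%nat -> forall t, 0 <= t <= T ->
        has_deriv_within 0 l (fun x => Dx k x t) (fun x => Dx (S k) x t)) /\
     (forall k, (k <= px)%nat -> cont_rect l T (Dx k))) /\
  (exists Dt : nat -> R -> R -> R,
     Dt O = u /\
     (forall k, (k < pt)%nat -> forall x, 0 <= x <= l ->
        has_deriv_within 0 T (fun t => Dt k x t) (fun t => Dt (S k) x t)) /\
     (forall k, (k <= pt)%nat -> cont_rect l T (Dt k))).

Definition dxx (h : R) (v : nat -> R) (i : nat) : R :=
  (v (S i) - 2 * v i + v (i - 1)%nat) / (h ^ 2).

Definition Hh (h : R) (v : nat -> R) (i : nat) : R :=
  v i + h ^ 2 / 12 * dxx h v i.

(* y^(sigma) at level j: sigma y^{j+1} + (1 - sigma) y^j ; y j i = y_i^j *)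
Definition ysig (sigma : R) (y : nat -> nat -> R) (j : nat) : nat -> R :=
  fun i => sigma * y (S j) i + (1 - sigma) * y j i.

Definition norm0 (N : nat) (h : R) (v : nat -> R) : R :=
  sqrt (sum_f_R0 (fun i => if Nat.eqb i 0 then 0 else v i ^ 2 * h) (N - 1)).

(* coefficients of the L2-1_sigma formula *)
Definition acoef (alpha sigma : R) (m : nat) : R :=
  match m with
  | O => Rpower sigma (1 - alpha)
  | S m' => Rpower (INR m + sigma) (1 - alpha) - Rpower (INR m' + sigma) (1 - alpha)
  end.

Definition bcoef (alpha sigma : R) (m : nat) : R :=
  match m with
  | O => 0 (* unused *)
  | S m' =>
      / (2 - alpha) * (Rpower (INR m + sigma) (2 - alpha) - Rpower (INR m' + sigma) (2 - alpha))
      - / 2 * (Rpower (INR m + sigma) (1 - alpha) + Rpower (INR m' + sigma) (1 - alpha))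
  end.

Definition ccoef (alpha sigma : R) (j s : nat) : R :=
  match j with
  | O => acoef alpha sigma 0
  | S _ =>
      match s with
      | O => acoef alpha sigma 0 + bcoef alpha sigma 1
      | S _ =>
          if Nat.ltb s j
          then acoef alpha sigma s + bcoef alpha sigma (S s) - bcoef alpha sigma s
          else acoef alpha sigma j - bcoef alpha sigma j
      end
  end.

Definition frac_diff (alpha sigma tau : R) (w : nat -> R) (j : nat) : R :=
  Rpower tau (1 - alpha) / Gamma (2 - alpha) *
  sum_f_R0 (fun s => ccoef alpha sigma j (j - s) * ((w (S s) - w s) / tau)) j.

(* Main.v *)
(* The error z = u - y solves the scheme with a source consisting of the truncation errors.
   Testing with H z^(sigma), the monotonicity of the coefficients c_s gives
   2 w^(sigma) Delta^alpha w >= Delta^alpha (w^2), while H is absorbed by the discrete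
   Laplacian; the resulting inequality for |H z|^2 is closed by induction on the level,
   using c_j >= (1 - alpha) (j + sigma)^(-alpha).

   The Caputo derivative is compared with Delta^alpha by replacing u_t, to within O(tau^2),
   by the piecewise linear function which Delta^alpha integrates exactly against the kernel.

   Only pure derivatives of u are controlled, so the second difference in x of the defect
   r = u^(sigma) - u(t_(j+sigma)) need not be O(tau^2).  It enters the energy identity through
   its first difference only, and r_x = O(tau^2) follows from the pure derivatives: since
   r_tau - r_(2 tau) / 4 is O(tau^3) with bounded sixth x-derivative, its x-derivative is
   O(tau^(5/2)) by interpolation, which is summable over dyadic steps. *)
Require Import Defs.
From Stdlib Require Import Reals Lra Lia Psatz Arith ClassicalEpsilon.
From Coquelicot Require Import Coquelicot.
Open Scope R_scope.

(** * Convolution coefficients *)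

(** The value [sigma = 1 - alpha / 2] enters twice. It annihilates the first moment of the kernel on
    the last, incomplete cell, which yields second order without a node beyond [t_(j+1)]. It also
    makes [sigma^2 - (1 - alpha)] equal to [(1 - sigma)^2], so that the gap between [c_0] and [c_1]
    pays for the negative square in the energy inequality; monotonicity of the [c_s] alone only
    makes the weights of the old levels nonnegative.

    The first difference of the defect is the quantity that can be bounded. Interpolating between
    size [tau^3] and a bounded sixth derivative at spatial scale [delta] costs
    [tau^3 / delta + delta^5] for a first derivative and [tau^3 / delta^2 + delta^4] for a second
    one. At [delta = sqrt tau] these are [tau^(5/2)] and [tau^2]; the latter contributes a full
    [tau^2] on every dyadic level and would lose a logarithm of [tau]. Summation by parts therefore
    moves one difference from the defect to the test function. *)

Lemma Rpower_gt0 (x y : R) : 0 < Rpower x y.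
Proof. apply exp_pos. Qed.

Lemma Rpower_succ (x y z : R) : 0 < x -> z = y + 1 -> Rpower x z = x * Rpower x y.
Proof.
  intros Hx ->. rewrite Rpower_plus, Rpower_1 by exact Hx. ring.
Qed.

Lemma Rpower_decr (x y z : R) : z <= 0 -> 0 < x -> x <= y -> Rpower y z <= Rpower x z.
Proof.
  intros Hz Hx Hxy. unfold Rpower.
  destruct (Req_dec x y) as [->|Hn]; [lra|].
  assert (ln x < ln y) by (apply ln_increasing; lra).
  destruct (Req_dec z 0) as [->|Hz0]; [rewrite !Rmult_0_l; lra|].
  left. apply exp_increasing. nra.
Qed.

Lemma Rpower_incr (x y z : R) : 0 <= z -> 0 < x -> x <= y -> Rpower x z <= Rpower y z.
Proof. intros Hz Hx Hxy. apply Rle_Rpower_l; lra. Qed.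

Lemma is_derive_Rpower (x y : R) :
  0 < x -> is_derive (fun z => Rpower z y) x (y * Rpower x (y - 1)).
Proof. intros Hx. apply is_derive_Reals, derivable_pt_lim_power, Hx. Qed.

Lemma continuous_Rpower (x y : R) : 0 < x -> continuous (fun z => Rpower z y) x.
Proof.
  intros Hx. apply (ex_derive_continuous (fun z => Rpower z y)).
  eexists. now apply is_derive_Rpower.
Qed.

Lemma is_derive_Rpower_shift (x th y : R) :
  0 < x + th -> is_derive (fun t => Rpower (x + t) y) th (y * Rpower (x + th) (y - 1)).
Proof.
  intros H. evar_last.
  - apply (is_derive_comp (fun z => Rpower z y) (fun t => x + t)).
    + now apply is_derive_Rpower.
    + auto_derive; [exact I|reflexivity].
  - unfold scal; simpl; unfold mult; simpl. ring.
Qed.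

Lemma continuous_Rpower_shift (x th y : R) :
  0 < x + th -> continuous (fun t => Rpower (x + t) y) th.
Proof.
  intros H. apply (ex_derive_continuous (fun t => Rpower (x + t) y)).
  eexists. now apply is_derive_Rpower_shift.
Qed.

(* Up to the factor [1 - alpha], the integrals over the cell [x, x + 1] of the kernel
   [y^(-alpha)] against [1] and against the signed distance to the midpoint. *)
Definition Aint (alpha x : R) : R := Rpower (x + 1) (1 - alpha) - Rpower x (1 - alpha).

Definition Bint (alpha x : R) : R :=
  / (2 - alpha) * (Rpower (x + 1) (2 - alpha) - Rpower x (2 - alpha))
  - / 2 * (Rpower (x + 1) (1 - alpha) + Rpower x (1 - alpha)).

Lemma acoef_S (alpha sigma : R) (m : nat) :
  acoef alpha sigma (S m) = Aint alpha (INR m + sigma).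
Proof.
  unfold acoef, Aint. rewrite S_INR.
  replace (INR m + 1 + sigma) with (INR m + sigma + 1) by ring. reflexivity.
Qed.

Lemma bcoef_S (alpha sigma : R) (m : nat) :
  bcoef alpha sigma (S m) = Bint alpha (INR m + sigma).
Proof.
  unfold bcoef, Bint. rewrite S_INR.
  replace (INR m + 1 + sigma) with (INR m + sigma + 1) by ring. reflexivity.
Qed.

Lemma is_RInt_Aint (alpha x : R) : 0 < x ->
  is_RInt (fun t => (1 - alpha) * Rpower (x + t) (- alpha)) 0 1 (Aint alpha x).
Proof.
  intros Hx. evar_last.
  - apply (is_RInt_derive (fun t => Rpower (x + t) (1 - alpha))).
    + intros t. rewrite Rmin_left, Rmax_right by lra. intros Ht.
      replace (- alpha) with (1 - alpha - 1) by ring.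
      apply is_derive_Rpower_shift. lra.
    + intros t. rewrite Rmin_left, Rmax_right by lra. intros Ht.
      apply (continuous_mult (fun _ => 1 - alpha) (fun t => Rpower (x + t) (- alpha))).
      * apply continuous_const.
      * apply continuous_Rpower_shift. lra.
  - unfold Aint, minus, plus, opp; simpl. rewrite Rplus_0_r. reflexivity.
Qed.

Lemma is_RInt_Bint (alpha x : R) : 0 < alpha < 1 -> 0 < x ->
  is_RInt (fun t => (/ 2 - t) * ((1 - alpha) * Rpower (x + t) (- alpha))) 0 1 (Bint alpha x).
Proof.
  intros Ha Hx. evar_last.
  (* Writing [/ 2 - t] as [(/ 2 + x) - (x + t)] leaves only two pure powers of [x + t] to
     integrate. *)
  - apply (is_RInt_derive (fun t => (/ 2 + x) * Rpower (x + t) (1 - alpha)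
              - (1 - alpha) / (2 - alpha) * Rpower (x + t) (2 - alpha))).
    + intros t. rewrite Rmin_left, Rmax_right by lra. intros Ht.
      evar_last.
      * apply (is_derive_minus (fun t => (/ 2 + x) * Rpower (x + t) (1 - alpha))
                 (fun t => (1 - alpha) / (2 - alpha) * Rpower (x + t) (2 - alpha))).
        -- apply is_derive_scal, is_derive_Rpower_shift. lra.
        -- apply is_derive_scal, is_derive_Rpower_shift. lra.
      * unfold minus, plus, opp; simpl.
        rewrite (Rpower_succ (x + t) (- alpha) (2 - alpha - 1)) by lra.
        replace (1 - alpha - 1) with (- alpha) by ring. field. lra.
    + intros t. rewrite Rmin_left, Rmax_right by lra. intros Ht.
      apply (continuous_mult (fun t => / 2 - t)
               (fun t => (1 - alpha) * Rpower (x + t) (- alpha))).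
      * apply (ex_derive_continuous (fun t => / 2 - t)). auto_derive. exact I.
      * apply (continuous_mult (fun _ => 1 - alpha) (fun t => Rpower (x + t) (- alpha))).
        -- apply continuous_const.
        -- apply continuous_Rpower_shift. lra.
  - unfold Bint, minus, plus, opp; simpl. rewrite Rplus_0_r.
    rewrite (Rpower_succ (x + 1) (1 - alpha) (2 - alpha)) by lra.
    rewrite (Rpower_succ x (1 - alpha) (2 - alpha)) by lra. field. lra.
Qed.

(* Chebyshev: [1/2 - t] has mean zero, so subtracting [psi (1/2)] makes the integrand
   pointwise nonnegative. *)
Lemma is_RInt_centred_nonneg (psi : R -> R) (L : R) :
  (forall s t, 0 <= s -> s <= t -> t <= 1 -> psi t <= psi s) ->
  is_RInt (fun t => (/ 2 - t) * psi t) 0 1 L -> 0 <= L.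
Proof.
  intros Hpsi HL.
  assert (H0 : is_RInt (fun t => (/ 2 - t) * psi (/ 2)) 0 1 0).
  { evar_last.
    - apply (is_RInt_derive (fun t => (t / 2 - t * t / 2) * psi (/ 2))).
      + intros t _. auto_derive; [exact I|field].
      + intros t _. apply (ex_derive_continuous (fun t => (/ 2 - t) * psi (/ 2))).
        auto_derive. exact I.
    - unfold minus, plus, opp; simpl. field. }
  refine (is_RInt_le _ _ 0 1 _ _ _ H0 HL _); [lra|].
  intros t Ht. destruct (Rle_dec t (/ 2)) as [H|H].
  - assert (psi (/ 2) <= psi t) by (apply Hpsi; lra). nra.
  - assert (psi t <= psi (/ 2)) by (apply Hpsi; lra). nra.
Qed.

Lemma Bint_nonneg (alpha x : R) : 0 < alpha < 1 -> 0 < x -> 0 <= Bint alpha x.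
Proof.
  intros Ha Hx.
  apply (is_RInt_centred_nonneg (fun t => (1 - alpha) * Rpower (x + t) (- alpha))).
  - intros s t Hs Hst Ht. apply Rmult_le_compat_l; [lra|]. apply Rpower_decr; lra.
  - apply is_RInt_Bint; assumption.
Qed.

(** Convexity of [y^(-alpha)], read off the sign of the derivative of the gap. It supplies the
    decreasing factor for the Chebyshev argument in [Bint_decr]. *)
Lemma Rpower_gap_decr (alpha x y : R) : 0 < alpha -> 0 < x -> x <= y ->
  Rpower y (- alpha) - Rpower (y + 1) (- alpha) <=
  Rpower x (- alpha) - Rpower (x + 1) (- alpha).
Proof.
  intros Ha Hx Hxy.
  set (df := fun z => - alpha * Rpower z (- alpha - 1) - - alpha * Rpower (1 + z) (- alpha - 1)).
  destruct (MVT_gen (fun z => Rpower z (- alpha) - Rpower (1 + z) (- alpha)) x y df)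
    as [c [Hc Hm]].
  - intros z. rewrite Rmin_left, Rmax_right by lra. intros Hz.
    apply (is_derive_minus (fun z => Rpower z (- alpha)) (fun z => Rpower (1 + z) (- alpha))).
    + apply is_derive_Rpower. lra.
    + apply is_derive_Rpower_shift. lra.
  - intros z. rewrite Rmin_left, Rmax_right by lra. intros Hz.
    apply continuity_pt_filterlim.
    apply (continuous_minus (fun z => Rpower z (- alpha)) (fun z => Rpower (1 + z) (- alpha))).
    + apply continuous_Rpower. lra.
    + apply continuous_Rpower_shift. lra.
  - rewrite Rmin_left, Rmax_right in Hc by lra.
    assert (df c <= 0).
    { unfold df. assert (Rpower (1 + c) (- alpha - 1) <= Rpower c (- alpha - 1))
        by (apply Rpower_decr; lra). nra. }
    rewrite !(Rplus_comm 1) in Hm. nra.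
Qed.

Lemma Bint_decr (alpha x : R) : 0 < alpha < 1 -> 0 < x -> Bint alpha (x + 1) <= Bint alpha x.
Proof.
  intros Ha Hx.
  enough (0 <= Bint alpha x - Bint alpha (x + 1)) by lra.
  apply (is_RInt_centred_nonneg (fun t => (1 - alpha) *
           (Rpower (x + t) (- alpha) - Rpower (x + t + 1) (- alpha)))).
  - intros s t Hs Hst Ht. apply Rmult_le_compat_l; [lra|]. apply Rpower_gap_decr; lra.
  - eapply is_RInt_ext; [|apply (is_RInt_minus _ _ _ _ _ _ (is_RInt_Bint alpha x Ha Hx)
                         (is_RInt_Bint alpha (x + 1) Ha ltac:(lra)))].
    intros t _. unfold minus, plus, opp; simpl.
    replace (x + 1 + t) with (x + t + 1) by ring. ring.
Qed.

(** The weight [1 - (/ 2 - t) = / 2 + t] is positive on the cell, unlike the one in [Bint], so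
    pointwise bounds on the kernel pass directly to the difference. *)
Lemma is_RInt_Aint_minus_Bint (alpha x : R) : 0 < alpha < 1 -> 0 < x ->
  is_RInt (fun t => (/ 2 + t) * ((1 - alpha) * Rpower (x + t) (- alpha))) 0 1
    (Aint alpha x - Bint alpha x).
Proof.
  intros Ha Hx.
  eapply is_RInt_ext; [|apply (is_RInt_minus _ _ _ _ _ _ (is_RInt_Aint alpha x Hx)
                         (is_RInt_Bint alpha x Ha Hx))].
  intros t _. unfold minus, plus, opp; simpl. field.
Qed.

Lemma Aint_minus_Bint_decr (alpha x : R) : 0 < alpha < 1 -> 0 < x ->
  Aint alpha (x + 1) - Bint alpha (x + 1) <= Aint alpha x - Bint alpha x.
Proof.
  intros Ha Hx.
  refine (is_RInt_le _ _ 0 1 _ _ _ (is_RInt_Aint_minus_Bint alpha (x + 1) Ha _)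
            (is_RInt_Aint_minus_Bint alpha x Ha Hx) _); [lra|lra|].
  intros t Ht. apply Rmult_le_compat_l; [lra|].
  apply Rmult_le_compat_l; [lra|]. apply Rpower_decr; lra.
Qed.

(** The weight [/ 2 + t] has integral one, and the kernel is at least its value at the right end of
    the cell. *)
Lemma Aint_minus_Bint_ge (alpha x : R) : 0 < alpha < 1 -> 0 < x ->
  (1 - alpha) * Rpower (x + 1) (- alpha) <= Aint alpha x - Bint alpha x.
Proof.
  intros Ha Hx.
  assert (H0 : is_RInt (fun t => (/ 2 + t) * ((1 - alpha) * Rpower (x + 1) (- alpha))) 0 1
                 ((1 - alpha) * Rpower (x + 1) (- alpha))).
  { evar_last.
    - apply (is_RInt_derive
        (fun t => (t / 2 + t * t / 2) * ((1 - alpha) * Rpower (x + 1) (- alpha)))).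
      + intros t _. auto_derive; [exact I|field].
      + intros t _. apply (ex_derive_continuous
          (fun t => (/ 2 + t) * ((1 - alpha) * Rpower (x + 1) (- alpha)))).
        auto_derive. exact I.
    - unfold minus, plus, opp; simpl. field. }
  refine (is_RInt_le _ _ 0 1 _ _ _ H0 (is_RInt_Aint_minus_Bint alpha x Ha Hx) _); [lra|].
  intros t Ht. apply Rmult_le_compat_l; [lra|].
  apply Rmult_le_compat_l; [lra|]. apply Rpower_decr; lra.
Qed.

Lemma Aint_le (alpha x : R) : 0 < alpha < 1 -> 0 < x ->
  Aint alpha x <= (1 - alpha) * Rpower x (- alpha).
Proof.
  intros Ha Hx.
  assert (H0 : is_RInt (fun _ : R => (1 - alpha) * Rpower x (- alpha)) 0 1
                 ((1 - alpha) * Rpower x (- alpha))).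
  { evar_last; [apply @is_RInt_const|]. unfold scal; simpl; unfold mult; simpl. ring. }
  refine (is_RInt_le _ _ 0 1 _ _ _ (is_RInt_Aint alpha x Hx) H0 _); [lra|].
  intros t Ht. apply Rmult_le_compat_l; [lra|]. apply Rpower_decr; lra.
Qed.

Lemma sum_f_R0_nonneg (f : nat -> R) (n : nat) :
  (forall s, (s <= n)%nat -> 0 <= f s) -> 0 <= sum_f_R0 f n.
Proof.
  intros Hf. induction n as [|n IH]; simpl; [apply Hf; lia|].
  apply Rplus_le_le_0_compat; [apply IH; intros; apply Hf; lia|apply Hf; lia].
Qed.

Section Coefficients.

Variables (alpha sigma : R).
Hypothesis Halpha : 0 < alpha < 1.
Hypothesis Hsigma : sigma = 1 - alpha / 2.

Local Notation c := (ccoef alpha sigma).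

Lemma ccoef_last (j : nat) : c (S j) (S j) = acoef alpha sigma (S j) - bcoef alpha sigma (S j).
Proof. unfold ccoef. now rewrite Nat.ltb_irrefl. Qed.

Lemma ccoef_mid (j s : nat) : (s < j)%nat ->
  c (S j) (S s) = acoef alpha sigma (S s) + bcoef alpha sigma (S (S s)) - bcoef alpha sigma (S s).
Proof.
  intros H. unfold ccoef. replace (S s <? S j)%nat with true; [reflexivity|].
  symmetry. apply Nat.ltb_lt. lia.
Qed.

Lemma ccoef_0_S (j : nat) : c (S j) 0 = Rpower sigma (1 - alpha) + bcoef alpha sigma 1.
Proof. reflexivity. Qed.

Lemma bcoef_pos (m : nat) : 0 <= bcoef alpha sigma (S m).
Proof. rewrite bcoef_S. apply Bint_nonneg; [easy|]. pose proof (pos_INR m). lra. Qed.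

Lemma bcoef_decr (m : nat) : bcoef alpha sigma (S (S m)) <= bcoef alpha sigma (S m).
Proof.
  rewrite !bcoef_S, S_INR. pose proof (pos_INR m).
  replace (INR m + 1 + sigma) with (INR m + sigma + 1) by ring. apply Bint_decr; lra.
Qed.

Lemma acoef_minus_bcoef_decr (m : nat) :
  acoef alpha sigma (S (S m)) - bcoef alpha sigma (S (S m)) <=
  acoef alpha sigma (S m) - bcoef alpha sigma (S m).
Proof.
  rewrite !bcoef_S, !acoef_S, S_INR. pose proof (pos_INR m).
  replace (INR m + 1 + sigma) with (INR m + sigma + 1) by ring.
  apply Aint_minus_Bint_decr; lra.
Qed.

Lemma ccoef_1_le (j : nat) : c (S j) 1 <= acoef alpha sigma 1.
Proof.
  pose proof (bcoef_pos 0). pose proof (bcoef_decr 0). destruct j as [|j].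
  - rewrite ccoef_last. lra.
  - rewrite ccoef_mid by lia. lra.
Qed.

(** Here [c_1 <= a_1 <= (1 - alpha) sigma^(-alpha)] while [c_0 >= sigma * sigma^(-alpha)], and
    [sigma^2 <= sigma]. Since [sigma^2 - (1 - alpha) = (1 - sigma)^2], this is the form
    [(1 - sigma)^2 c_0 <= sigma^2 (c_0 - c_1)] needed in [cweight_top]; it also gives
    [c_1 <= c_0]. *)
Lemma ccoef_gap (j : nat) :
  sigma ^ 2 * c (S j) 1 <= (1 - alpha) * c (S j) 0.
Proof.
  pose proof (ccoef_1_le j) as H1. rewrite acoef_S in H1.
  replace (INR 0 + sigma) with sigma in H1 by (simpl; ring).
  pose proof (Aint_le alpha sigma Halpha ltac:(lra)) as H2.
  rewrite ccoef_0_S. pose proof (bcoef_pos 0).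
  pose proof (Rpower_gt0 sigma (- alpha)).
  rewrite (Rpower_succ sigma (- alpha) (1 - alpha)) by lra.
  assert (sigma ^ 2 * c (S j) 1 <= sigma ^ 2 * ((1 - alpha) * Rpower sigma (- alpha))).
  { apply Rmult_le_compat_l; [nra|lra]. }
  assert (sigma * sigma * ((1 - alpha) * Rpower sigma (- alpha)) <=
          sigma * 1 * ((1 - alpha) * Rpower sigma (- alpha))).
  { apply Rmult_le_compat_r; [nra|nra]. }
  nra.
Qed.

Lemma ccoef_last_ge (j : nat) : (1 - alpha) * Rpower (INR j + sigma) (- alpha) <= c j j.
Proof.
  destruct j as [|j].
  - simpl. rewrite Rplus_0_l, (Rpower_succ sigma (- alpha) (1 - alpha)) by lra.
    apply Rmult_le_compat_r; [apply Rlt_le, Rpower_gt0|lra].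
  - rewrite ccoef_last, acoef_S, bcoef_S, S_INR. pose proof (pos_INR j).
    replace (INR j + 1 + sigma) with (INR j + sigma + 1) by ring.
    apply Aint_minus_Bint_ge; lra.
Qed.

Lemma ccoef_last_pos (j : nat) : 0 < c j j.
Proof.
  eapply Rlt_le_trans; [|apply ccoef_last_ge].
  apply Rmult_lt_0_compat; [lra|apply Rpower_gt0].
Qed.

(** For [s >= 1] the decrement is [(a_s - b_s) - (a_(s+1) - b_(s+1))] plus [b_(s+1) - b_(s+2)], or
    plus [b_(s+1)] when [s + 1 = j]; each part has a sign. The drop from [c_0] to [c_1] comes from
    [ccoef_gap]. *)
Lemma ccoef_decr (j s : nat) : (s < j)%nat -> c j (S s) <= c j s.
Proof.
  intros H. destruct j as [|j]; [lia|]. destruct s as [|s].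
  - pose proof (ccoef_gap j).
    assert (Hc1 : 0 <= c (S j) 1).
    { destruct j as [|j].
      - apply Rlt_le, ccoef_last_pos.
      - rewrite ccoef_mid by lia. pose proof (bcoef_pos 1).
        pose proof (ccoef_last_pos 1) as Hl. rewrite ccoef_last in Hl. lra. }
    assert (1 - alpha <= sigma ^ 2) by nra. nra.
  - pose proof (acoef_minus_bcoef_decr s). pose proof (bcoef_pos (S s)).
    pose proof (bcoef_decr (S s)). rewrite (ccoef_mid j s) by lia.
    destruct (Nat.eq_dec (S s) j) as [<-|Hn].
    + rewrite ccoef_last. lra.
    + rewrite ccoef_mid by lia. lra.
Qed.

Lemma abel_convolution (g v : nat -> R) (j n : nat) : (n <= j)%nat ->
  sum_f_R0 (fun s => g (j - s)%nat * (v (S s) - v s)) n =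
  g (j - n)%nat * v (S n)
  - sum_f_R0 (fun s => (if Nat.eqb s 0 then g j else g (j - s)%nat - g (S (j - s))) * v s) n.
Proof.
  induction n as [|n IH]; intros Hn.
  - simpl. rewrite Nat.sub_0_r. ring.
  - rewrite !tech5, IH by lia.
    replace (j - n)%nat with (S (j - S n)) by lia. simpl Nat.eqb. cbv iota. ring.
Qed.

(** Weights of the old levels after Abel summation. They are nonnegative with total [c j 0], so the
    discrete derivative compares the newest value with an average of the earlier ones. *)
Definition cweight (j s : nat) : R := if Nat.eqb s 0 then c j j else c j (j - s) - c j (S (j - s)).

Lemma cweight_nonneg (j s : nat) : (s <= j)%nat -> 0 <= cweight j s.
Proof.
  intros H. unfold cweight. destruct (Nat.eqb_spec s 0) as [->|Hs].
  - apply Rlt_le, ccoef_last_pos.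
  - pose proof (ccoef_decr j (j - s) ltac:(lia)). lra.
Qed.

Lemma ccoef_convolution (j : nat) (v : nat -> R) :
  sum_f_R0 (fun s => c j (j - s) * (v (S s) - v s)) j =
  c j 0 * v (S j) - sum_f_R0 (fun s => cweight j s * v s) j.
Proof. rewrite (abel_convolution (c j) v j j) by lia. now rewrite Nat.sub_diag. Qed.

Lemma sum_cweight (j : nat) : sum_f_R0 (cweight j) j = c j 0.
Proof.
  pose proof (ccoef_convolution j (fun _ => 1)) as H.
  rewrite (sum_eq _ (fun _ => 0)) in H by (intros; ring).
  rewrite sum_cte in H.
  rewrite (sum_eq (fun s => cweight j s * 1) (cweight j)) in H by (intros; ring). lra.
Qed.

Lemma cweight_top (j : nat) : (1 - sigma) ^ 2 * c j 0 <= sigma ^ 2 * cweight j j.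
Proof.
  unfold cweight. destruct j as [|j].
  - simpl Nat.eqb. cbv iota. pose proof (ccoef_last_pos 0). nra.
  - simpl Nat.eqb. cbv iota. rewrite Nat.sub_diag. pose proof (ccoef_gap j) as H.
    replace ((1 - sigma) ^ 2) with (sigma ^ 2 - (1 - alpha)) by (rewrite Hsigma; field).
    nra.
Qed.

(* With p = sigma v_{j+1} + (1-sigma) v_j one has
   2 p (v_{j+1} - v_s) = v_{j+1}^2 - v_s^2 - (v_{j+1} - p)^2 + (v_s - p)^2;
   after weighting, the term s = j alone pays for the negative squares. *)
Lemma ccoef_convolution_energy (j : nat) (v : nat -> R) :
  sum_f_R0 (fun s => c j (j - s) * (v (S s) ^ 2 - v s ^ 2)) j <=
  2 * (sigma * v (S j) + (1 - sigma) * v j) *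
  sum_f_R0 (fun s => c j (j - s) * (v (S s) - v s)) j.
Proof.
  rewrite (ccoef_convolution j v), (ccoef_convolution j (fun s => v s ^ 2)).
  set (p := sigma * v (S j) + (1 - sigma) * v j).
  assert (Hid : 2 * p * (c j 0 * v (S j) - sum_f_R0 (fun s => cweight j s * v s) j)
     - (c j 0 * v (S j) ^ 2 - sum_f_R0 (fun s => cweight j s * v s ^ 2) j)
     = sum_f_R0 (fun s => cweight j s * (v s - p) ^ 2) j - c j 0 * (v (S j) - p) ^ 2).
  { rewrite (sum_eq (fun s => cweight j s * (v s - p) ^ 2)
      (fun s => (cweight j s * v s ^ 2 - cweight j s * v s * (2 * p)) + cweight j s * p ^ 2))
      by (intros; ring).
    rewrite sum_plus, minus_sum, <- !scal_sum.
    change (sum_f_R0 (fun l => cweight j l) j) with (sum_f_R0 (cweight j) j).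
    rewrite sum_cweight.
    ring. }
  assert (Htop : cweight j j * (v j - p) ^ 2 <=
                 sum_f_R0 (fun s => cweight j s * (v s - p) ^ 2) j).
  { destruct j as [|j]; [simpl sum_f_R0; lra|]. rewrite tech5.
    enough (0 <= sum_f_R0 (fun s => cweight (S j) s * (v s - p) ^ 2) j) by lra.

    apply sum_f_R0_nonneg. intros s Hs.
    apply Rmult_le_pos; [apply cweight_nonneg; lia|apply pow2_ge_0]. }
  assert (Hlast : c j 0 * (v (S j) - p) ^ 2 <= cweight j j * (v j - p) ^ 2).
  { pose proof (cweight_top j) as H.
    replace (v (S j) - p) with ((1 - sigma) * (v (S j) - v j)) by (unfold p; ring).
    replace (v j - p) with (- sigma * (v (S j) - v j)) by (unfold p; ring).
    pose proof (pow2_ge_0 (v (S j) - v j)).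
    replace (c j 0 * ((1 - sigma) * (v (S j) - v j)) ^ 2)
      with ((1 - sigma) ^ 2 * c j 0 * (v (S j) - v j) ^ 2) by ring.
    replace (cweight j j * (- sigma * (v (S j) - v j)) ^ 2)
      with (sigma ^ 2 * cweight j j * (v (S j) - v j) ^ 2) by ring.
    now apply Rmult_le_compat_r. }
  lra.
Qed.

(** The weight of level 0 is exactly [c j j], and [E O = 0] leaves it unspent: the source takes that
    share of [G] and the later levels take the rest, which adds up to [c j 0 * G]. No constant grows
    with [j]. *)
Lemma ccoef_stability (M : nat) (E : nat -> R) (G : R) : 0 <= G -> E O = 0 ->
  (forall j, (j < M)%nat ->
     sum_f_R0 (fun s => c j (j - s) * (E (S s) - E s)) j <= c j j * G) ->
  forall j, (j <= M)%nat -> E j <= G.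
Proof.
  intros HG HE0 HE.
  induction j as [j IH] using lt_wf_ind. intros HjM.
  destruct j as [|j]; [lra|].
  specialize (HE j ltac:(lia)). rewrite ccoef_convolution in HE.
  assert (Hc0 : 0 < c j 0).
  { rewrite <- sum_cweight. pose proof (ccoef_last_pos j).
    assert (Hg : forall n, (n <= j)%nat -> c j j <= sum_f_R0 (cweight j) n).
    { induction n as [|n IHn]; intros Hn; simpl sum_f_R0.
      - unfold cweight; simpl. lra.
      - pose proof (cweight_nonneg j (S n) Hn). specialize (IHn ltac:(lia)). lra. }
    specialize (Hg j ltac:(lia)). lra. }
  assert (Hs : forall n, (n <= j)%nat -> sum_f_R0 (fun s => cweight j s * E s) n <=
                 (sum_f_R0 (cweight j) n - c j j) * G).
  { induction n as [|n IHn]; intros Hn; simpl sum_f_R0.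
    - rewrite HE0. unfold cweight; simpl. lra.
    - specialize (IHn ltac:(lia)). pose proof (cweight_nonneg j (S n) Hn).
      pose proof (IH (S n) ltac:(lia) ltac:(lia)).
      assert (cweight j (S n) * E (S n) <= cweight j (S n) * G)
        by (apply Rmult_le_compat_l; assumption). lra. }
  specialize (Hs j ltac:(lia)). rewrite sum_cweight in Hs.
  apply (Rmult_le_reg_l (c j 0)); [exact Hc0|lra].
Qed.

End Coefficients.

(** * Energy estimate on the space grid *)

(** Half-open and possibly empty: for [N = 1] the grid has no interior node. *)
Fixpoint bsum (f : nat -> R) (n : nat) : R :=
  match n with O => 0 | S n' => bsum f n' + f n' end.

Lemma bsum_le (f g : nat -> R) (n : nat) :
  (forall i, (i < n)%nat -> f i <= g i) -> bsum f n <= bsum g n.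
Proof.
  induction n as [|n IH]; intros H; simpl; [lra|].
  apply Rplus_le_compat; [apply IH; intros; apply H; lia|apply H; lia].
Qed.

Lemma bsum_ext (f g : nat -> R) (n : nat) :
  (forall i, (i < n)%nat -> f i = g i) -> bsum f n = bsum g n.
Proof.
  induction n as [|n IH]; intros H; simpl; [reflexivity|].
  rewrite IH, H; [reflexivity|lia|intros; apply H; lia].
Qed.

Lemma bsum_plus (f g : nat -> R) (n : nat) :
  bsum (fun i => f i + g i) n = bsum f n + bsum g n.
Proof. induction n as [|n IH]; simpl; [ring|rewrite IH; ring]. Qed.

Lemma bsum_scal (a : R) (f : nat -> R) (n : nat) :
  bsum (fun i => a * f i) n = a * bsum f n.
Proof. induction n as [|n IH]; simpl; [ring|rewrite IH; ring]. Qed.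

Lemma bsum_const (a : R) (n : nat) : bsum (fun _ => a) n = INR n * a.
Proof. induction n as [|n IH]; [simpl; ring|]. rewrite S_INR. simpl bsum. rewrite IH. ring. Qed.

Lemma bsum_nonneg (f : nat -> R) (n : nat) :
  (forall i, (i < n)%nat -> 0 <= f i) -> 0 <= bsum f n.
Proof.
  intros H. apply Rle_trans with (bsum (fun _ => 0) n).
  - rewrite bsum_const. lra.
  - apply bsum_le, H.
Qed.

Lemma bsum_incr (f : nat -> R) (m n : nat) :
  (m <= n)%nat -> (forall i, 0 <= f i) -> bsum f m <= bsum f n.
Proof.
  intros Hmn Hf. induction Hmn as [|n Hmn IH]; simpl; [lra|].
  specialize (Hf n). lra.
Qed.

Lemma bsum_shift (f : nat -> R) (n : nat) :
  bsum (fun i => f (S i)) n = bsum f n + f n - f O.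
Proof. induction n as [|n IH]; simpl; [ring|rewrite IH; ring]. Qed.

Lemma bsum_sum_swap (f : nat -> nat -> R) (n j : nat) :
  bsum (fun i => sum_f_R0 (f i) j) n = sum_f_R0 (fun s => bsum (fun i => f i s) n) j.
Proof.
  induction j as [|j IH]; simpl; [reflexivity|].
  now rewrite bsum_plus, IH.
Qed.

Lemma summation_by_parts (e w : nat -> R) (n : nat) :
  bsum (fun i => (e (S i) - e i) * w (S i)) n =
  e n * w (S n) - e O * w O - bsum (fun i => e i * (w (S i) - w i)) (S n).
Proof. induction n as [|n IH]; simpl in *; [ring|rewrite IH; ring]. Qed.

(** From [(a - b)^2 = 2 a^2 + 2 b^2 - (a + b)^2]: an inner value occurs in two differences, hence
    the 4, but the last one in a single difference. The term [- 2 * e n ^ 2] records this and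
    carries the induction. *)
Lemma bsum_diff_sq (e : nat -> R) (n : nat) :
  bsum (fun i => (e (S i) - e i) ^ 2) n <= 4 * bsum (fun i => e i ^ 2) (S n) - 2 * e n ^ 2.
Proof.
  induction n as [|n IH].
  - simpl. nra.
  - simpl bsum in *. pose proof (pow2_ge_0 (e (S n) + e n)). nra.
Qed.

Lemma dxx_S (h : R) (v : nat -> R) (i : nat) : h <> 0 ->
  h ^ 2 * dxx h v (S i) = (v (S (S i)) - v (S i)) - (v (S i) - v i).
Proof.
  intros Hh. unfold dxx. replace (S i - 1)%nat with i by lia. field. exact Hh.
Qed.

Lemma Hh_S (h : R) (v : nat -> R) (i : nat) : h <> 0 ->
  Hh h v (S i) = (v i + 10 * v (S i) + v (S (S i))) / 12.
Proof.
  intros Hh0. unfold Hh.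
  replace (h ^ 2 / 12 * dxx h v (S i)) with (h ^ 2 * dxx h v (S i) / 12) by field.
  rewrite dxx_S by exact Hh0. field.
Qed.

Lemma Hh_S' (h : R) (v : nat -> R) (i : nat) : h <> 0 ->
  Hh h v (S i) = v (S i) + ((v (S (S i)) - v (S i)) - (v (S i) - v i)) / 12.
Proof. intros Hh0. rewrite Hh_S by exact Hh0. field. Qed.

(** Cauchy-Schwarz for the telescoping sum; the inductive step is Young's inequality
    [2 w d <= w^2 / m + m d^2] with [w^2 <= m Q]. *)
Lemma sq_le_bsum_diff (w : nat -> R) (m : nat) : w O = 0 ->
  w m ^ 2 <= INR m * bsum (fun i => (w (S i) - w i) ^ 2) m.
Proof.
  intros H0. induction m as [|m IH].
  - rewrite H0. simpl. lra.
  - rewrite S_INR. simpl bsum. set (Q := bsum _ m) in *.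
    set (d := w (S m) - w m). replace (w (S m)) with (w m + d) by (unfold d; ring).
    destruct m as [|m].
    + rewrite H0. simpl. unfold Q. simpl. nra.
    + assert (Hm : 0 < INR (S m)) by (apply lt_0_INR; lia). set (p := INR (S m)) in *.
      assert (H2 : 2 * w (S m) * d * p <= w (S m) ^ 2 + p ^ 2 * d ^ 2)
        by (pose proof (pow2_ge_0 (w (S m) - p * d)); nra).
      assert (H3 : 2 * w (S m) * d <= Q + p * d ^ 2)
        by (apply (Rmult_le_reg_r p); [exact Hm|nra]).
      nra.
Qed.

Section Space.

Variables (n : nat) (h : R) (w : nat -> R).
Hypothesis Hh0 : 0 < h.
Hypothesis Hw0 : w O = 0.
Hypothesis HwN : w (S n) = 0.

Local Notation D := (bsum (fun i => (w (S i) - w i) ^ 2) (S n)).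

(** As [Hh] is the identity plus a twelfth of the second difference, the sum is [- D] plus a twelfth
    of the squared second differences, and the latter are at most [4 * D]: whence [- 1 + 4 / 12]. *)
Lemma diffusion_dissipates :
  bsum (fun i => h ^ 2 * dxx h w (S i) * Hh h w (S i)) n <= - (2 / 3) * D.
Proof.
  rewrite (bsum_ext _ (fun i => ((w (S (S i)) - w (S i)) - (w (S i) - w i)) * w (S i)
     + / 12 * ((w (S (S i)) - w (S i)) - (w (S i) - w i)) ^ 2)).
  2:{ intros i _. rewrite dxx_S, Hh_S' by lra. field. }
  rewrite bsum_plus, bsum_scal.
  rewrite (summation_by_parts (fun i => w (S i) - w i) w n), Hw0, HwN.
  pose proof (bsum_diff_sq (fun i => w (S i) - w i) n) as H. simpl in H |- *.
  rewrite (bsum_ext (fun i => (w (S i) - w i) * (w (S i) - w i))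
             (fun i => (w (S i) - w i) * ((w (S i) - w i) * 1))) by (intros; ring).
  nra.
Qed.

(** Summation by parts uses the zero boundary values of [w] only, so [rho] is free at the ends.
    Young's inequality costs [/ 4] of the differences of [w] in the main term and
    [/ 12 * / 2 * 4 = 1 / 6] in the correction, in total [5 / 12]; for [rho] the sum is
    [1 + 1 / 6]. *)
Lemma diffusion_of_perturbation (rho : nat -> R) :
  bsum (fun i => h ^ 2 * dxx h rho (S i) * Hh h w (S i)) n <=
  5 / 12 * D + 7 / 6 * bsum (fun i => (rho (S i) - rho i) ^ 2) (S n).
Proof.
  set (e := fun i => rho (S i) - rho i). set (d := fun i => w (S i) - w i).
  change (bsum (fun i => (rho (S i) - rho i) ^ 2) (S n)) with (bsum (fun i => e i ^ 2) (S n)).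
  change D with (bsum (fun i => d i ^ 2) (S n)).
  rewrite (bsum_ext _ (fun i => (e (S i) - e i) * w (S i)
     + / 12 * ((e (S i) - e i) * (d (S i) - d i)))).
  2:{ intros i _. rewrite dxx_S, Hh_S' by lra. unfold e, d. field. }
  rewrite bsum_plus, bsum_scal, (summation_by_parts e w n), Hw0, HwN.
  assert (H1 : - bsum (fun i => e i * (w (S i) - w i)) (S n) <=
     / 4 * bsum (fun i => d i ^ 2) (S n) + bsum (fun i => e i ^ 2) (S n)).
  { rewrite <- (bsum_scal (/ 4)), <- bsum_plus.
    replace (- bsum (fun i => e i * (w (S i) - w i)) (S n))
      with (bsum (fun i => -1 * (e i * (w (S i) - w i))) (S n)) by (rewrite bsum_scal; ring).
    apply bsum_le. intros i _. fold (d i). pose proof (pow2_ge_0 (/ 2 * d i + e i)). nra. }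
  assert (H2 : bsum (fun i => (e (S i) - e i) * (d (S i) - d i)) n <=
     / 2 * bsum (fun i => (e (S i) - e i) ^ 2) n + / 2 * bsum (fun i => (d (S i) - d i) ^ 2) n).
  { rewrite <- !(bsum_scal (/ 2)), <- bsum_plus.
    apply bsum_le. intros i _.
    pose proof (pow2_ge_0 ((e (S i) - e i) - (d (S i) - d i))). nra. }
  pose proof (bsum_diff_sq e n). pose proof (bsum_diff_sq d n).
  pose proof (pow2_ge_0 (e n)). pose proof (pow2_ge_0 (d n)). lra.
Qed.

Lemma sq_le_dirichlet (m : nat) : (m <= S n)%nat -> w m ^ 2 <= INR (S n) * D.
Proof.
  intros Hm. eapply Rle_trans; [apply sq_le_bsum_diff, Hw0|].
  apply Rmult_le_compat.
  - apply pos_INR.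
  - apply bsum_nonneg. intros; apply pow2_ge_0.
  - apply le_INR, Hm.
  - apply bsum_incr; [exact Hm|]. intros i. apply pow2_ge_0.
Qed.

(** Discrete Poincare inequality. [Hh] averages three neighbours with weights 1, 10, 1 over 12, so
    by convexity it keeps the pointwise bound on [w^2]. *)
Lemma bsum_Hh_sq_le : bsum (fun i => Hh h w (S i) ^ 2) n <= INR (S n) ^ 2 * D.
Proof.
  apply Rle_trans with (bsum (fun _ => INR (S n) * D) n).
  - apply bsum_le. intros i Hi. rewrite Hh_S by lra.
    pose proof (sq_le_dirichlet i ltac:(lia)). pose proof (sq_le_dirichlet (S i) ltac:(lia)).
    pose proof (sq_le_dirichlet (S (S i)) ltac:(lia)).
    generalize dependent (INR (S n) * D). intros B. intros.
    generalize dependent (w i). generalize dependent (w (S i)).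
    generalize dependent (w (S (S i))). intros a Ha b Hb c Hc.
    pose proof (pow2_ge_0 (a - b)). pose proof (pow2_ge_0 (a - c)).
    pose proof (pow2_ge_0 (b - c)). nra.
  - rewrite bsum_const.
    assert (0 <= D) by (apply bsum_nonneg; intros; apply pow2_ge_0).
    assert (INR n <= INR (S n)) by (rewrite S_INR; lra). pose proof (pos_INR (S n)).
    replace (INR (S n) ^ 2 * D) with (INR (S n) * (INR (S n) * D)) by ring.
    apply Rmult_le_compat_r; [apply Rmult_le_pos; assumption|assumption].
Qed.

(** With neighbours [a, b, c], [144 (Hh w)^2 - (60 b^2 - 3 a^2 - 3 c^2)] is
    [5/2 (4 b + a + c)^2 + 3/2 (a - c)^2]. Summing leaves the coefficient [60 - 6 = 54], and
    [144 / 54 = 8 / 3]. *)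
Lemma bsum_sq_le_Hh :
  bsum (fun i => w (S i) ^ 2) n <= 8 / 3 * bsum (fun i => Hh h w (S i) ^ 2) n.
Proof.
  assert (H : bsum (fun i => 60 * w (S i) ^ 2 + (-3 * w i ^ 2 + -3 * w (S (S i)) ^ 2)) n
              <= bsum (fun i => 144 * Hh h w (S i) ^ 2) n).
  { apply bsum_le. intros i _. rewrite Hh_S by lra.
    generalize (w i) (w (S i)) (w (S (S i))). intros a b c.
    pose proof (pow2_ge_0 (4 * b + a + c)). pose proof (pow2_ge_0 (2 * b + a + c)).
    pose proof (pow2_ge_0 (a - c)). nra. }
  rewrite !bsum_plus, !bsum_scal in H.
  rewrite (bsum_shift (fun i => w (S i) ^ 2) n), HwN in H.
  pose proof (bsum_shift (fun i => w i ^ 2) n) as H1. simpl in H1. rewrite Hw0 in H1.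
  pose proof (pow2_ge_0 (w n)). pose proof (pow2_ge_0 (w 1%nat)).
  simpl in *. nra.
Qed.

(** The dissipation [2 / 3] is spent as [5 / 12] on the perturbation [rho] and [1 / 4] on the
    source. The Young weight [c1 / (4 * L ^ 2)] is chosen so that the Poincare inequality turns the
    source's share into [c1 / h ^ 2 * (D / 4)]; the reaction term has the favourable sign. *)
Lemma scheme_energy (k q c1 : R) (rho psi : nat -> R) : 0 < c1 -> c1 <= k -> 0 <= q ->
  bsum (fun i => Hh h w (S i) *
     (k * dxx h w (S i) + k * dxx h rho (S i) - q * Hh h w (S i) + psi (S i))) n <=
  7 / 6 * (k / h ^ 2) * bsum (fun i => (rho (S i) - rho i) ^ 2) (S n)
  + (h * INR (S n)) ^ 2 / c1 * bsum (fun i => psi (S i) ^ 2) n.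
Proof.
  intros Hc1 Hk Hq. set (L := h * INR (S n)).
  assert (HN : 0 < INR (S n)) by (apply lt_0_INR; lia).
  assert (HL : 0 < L) by (apply Rmult_lt_0_compat; assumption).
  set (V := bsum (fun i => Hh h w (S i) ^ 2) n).
  set (E := bsum (fun i => (rho (S i) - rho i) ^ 2) (S n)).
  set (P := bsum (fun i => psi (S i) ^ 2) n).
  assert (Hle : bsum (fun i => Hh h w (S i) *
     (k * dxx h w (S i) + k * dxx h rho (S i) - q * Hh h w (S i) + psi (S i))) n <=
     k / h ^ 2 * bsum (fun i => h ^ 2 * dxx h w (S i) * Hh h w (S i)) n
     + (k / h ^ 2 * bsum (fun i => h ^ 2 * dxx h rho (S i) * Hh h w (S i)) n
     + (c1 / (4 * L ^ 2) * V + L ^ 2 / c1 * P))).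
  { unfold V, P. rewrite <- !bsum_scal, <- !bsum_plus. apply bsum_le. intros i _.
    set (v := Hh h w (S i)). set (p := psi (S i)).
    assert (Hy : v * p <= c1 / (4 * L ^ 2) * v ^ 2 + L ^ 2 / c1 * p ^ 2).
    { enough (0 <= c1 / (4 * L ^ 2) * v ^ 2 + L ^ 2 / c1 * p ^ 2 - v * p) by lra.
      replace (c1 / (4 * L ^ 2) * v ^ 2 + L ^ 2 / c1 * p ^ 2 - v * p)
        with (c1 / (4 * L ^ 2) * (v - 2 * L ^ 2 / c1 * p) ^ 2) by (field; lra).
      apply Rmult_le_pos; [|apply pow2_ge_0].
      apply Rlt_le, Rdiv_lt_0_compat; nra. }
    assert (0 <= q * v ^ 2) by (apply Rmult_le_pos; [exact Hq|apply pow2_ge_0]).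
    replace (k / h ^ 2 * (h ^ 2 * dxx h w (S i) * v)) with (k * dxx h w (S i) * v)
      by (field; lra).
    replace (k / h ^ 2 * (h ^ 2 * dxx h rho (S i) * v)) with (k * dxx h rho (S i) * v)
      by (field; lra).
    nra. }
  eapply Rle_trans; [exact Hle|].
  assert (HV : c1 / (4 * L ^ 2) * V <= c1 / (4 * L ^ 2) * (INR (S n) ^ 2 * D)).
  { apply Rmult_le_compat_l; [|apply bsum_Hh_sq_le].
    apply Rlt_le, Rdiv_lt_0_compat; nra. }
  replace (c1 / (4 * L ^ 2) * (INR (S n) ^ 2 * D)) with (c1 / h ^ 2 * (D / 4)) in HV
    by (unfold L; field; lra).
  assert (HD : 0 <= D) by (apply bsum_nonneg; intros; apply pow2_ge_0).
  assert (Hkh : 0 < k / h ^ 2) by (apply Rdiv_lt_0_compat; nra).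
  assert (Hck : c1 / h ^ 2 * (D / 4) <= k / h ^ 2 * (D / 4)).
  { apply Rmult_le_compat_r; [lra|]. apply Rmult_le_compat_r; [|exact Hk].
    apply Rlt_le, Rinv_0_lt_compat. nra. }
  pose proof (Rmult_le_compat_l _ _ _ (Rlt_le _ _ Hkh) diffusion_dissipates) as H1.
  pose proof (Rmult_le_compat_l _ _ _ (Rlt_le _ _ Hkh) (diffusion_of_perturbation rho)) as H2.
  fold E in H2. fold P. nra.
Qed.

End Space.

(** * One-sided derivatives and Taylor's formula *)

Lemma cont_on_lin (a b p q : R) (f g : R -> R) :
  cont_on a b f -> cont_on a b g -> cont_on a b (fun x => p * f x + q * g x).
Proof.
  intros Hf Hg x Hx eps Heps.
  assert (Hp : 0 < 2 * (Rabs p + 1)) by (pose proof (Rabs_pos p); lra).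
  assert (Hq : 0 < 2 * (Rabs q + 1)) by (pose proof (Rabs_pos q); lra).
  destruct (Hf x Hx (eps / (2 * (Rabs p + 1)))) as [d1 [Hd1 H1]];
    [now apply Rdiv_lt_0_compat|].
  destruct (Hg x Hx (eps / (2 * (Rabs q + 1)))) as [d2 [Hd2 H2]];
    [now apply Rdiv_lt_0_compat|].
  exists (Rmin d1 d2). split; [now apply Rmin_pos|]. intros y Hy Hyx.
  specialize (H1 y Hy ltac:(pose proof (Rmin_l d1 d2); lra)).
  specialize (H2 y Hy ltac:(pose proof (Rmin_r d1 d2); lra)).
  replace (p * f y + q * g y - (p * f x + q * g x))
    with (p * (f y - f x) + q * (g y - g x)) by ring.
  eapply Rle_lt_trans; [apply Rabs_triang|]. rewrite !Rabs_mult.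
  assert (Rabs p * Rabs (f y - f x) <= Rabs p * (eps / (2 * (Rabs p + 1))))
    by (apply Rmult_le_compat_l; [apply Rabs_pos|lra]).
  assert (Rabs q * Rabs (g y - g x) <= Rabs q * (eps / (2 * (Rabs q + 1))))
    by (apply Rmult_le_compat_l; [apply Rabs_pos|lra]).
  assert (Hlt : forall c, Rabs c * (eps / (2 * (Rabs c + 1))) < eps / 2).
  { intros c. pose proof (Rabs_pos c).
    apply (Rmult_lt_reg_r (2 * (Rabs c + 1))); [lra|].
    replace (Rabs c * (eps / (2 * (Rabs c + 1))) * (2 * (Rabs c + 1)))
      with (Rabs c * eps) by (field; lra). nra. }
  pose proof (Hlt p). pose proof (Hlt q). lra.
Qed.

Lemma cont_on_const (a b c : R) : cont_on a b (fun _ => c).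
Proof.
  intros x _ eps Heps. exists 1. split; [lra|]. intros y _ _.
  rewrite Rminus_diag, Rabs_R0. exact Heps.
Qed.

Lemma cont_on_sum (a b : R) (f : nat -> R -> R) (n : nat) :
  (forall s, (s <= n)%nat -> cont_on a b (f s)) ->
  cont_on a b (fun x => sum_f_R0 (fun s => f s x) n).
Proof.
  induction n as [|n IH]; intros Hf; simpl.
  - apply (Hf O). lia.
  - intros x Hx eps Heps.
    destruct (cont_on_lin a b 1 1 _ _ (IH (fun s Hs => Hf s ltac:(lia)))
                (Hf (S n) ltac:(lia)) x Hx eps Heps) as [d [Hd H]].
    exists d. split; [exact Hd|]. intros y Hy Hyx. specialize (H y Hy Hyx).
    rewrite !Rmult_1_l in H. exact H.
Qed.

Lemma cont_rect_slice_x (l T t : R) (g : R -> R -> R) :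
  cont_rect l T g -> 0 <= t <= T -> cont_on 0 l (fun x => g x t).
Proof.
  intros Hg Ht x Hx eps Heps. destruct (Hg x t Hx Ht eps Heps) as [d [Hd H]].
  exists d. split; [exact Hd|]. intros y Hy Hyx. apply H; try assumption.
  rewrite Rminus_diag, Rabs_R0. exact Hd.
Qed.

Lemma cont_rect_slice_t (l T x : R) (g : R -> R -> R) :
  cont_rect l T g -> 0 <= x <= l -> cont_on 0 T (fun t => g x t).
Proof.
  intros Hg Hx t Ht eps Heps. destruct (Hg x t Hx Ht eps Heps) as [d [Hd H]].
  exists d. split; [exact Hd|]. intros s Hs Hst. apply H; try assumption.
  rewrite Rminus_diag, Rabs_R0. exact Hd.
Qed.

Lemma cont_on_closure_bound (a b B : R) (g : R -> R) : a < b ->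
  cont_on a b g -> (forall x, a < x < b -> Rabs (g x) <= B) ->
  forall x, a <= x <= b -> Rabs (g x) <= B.
Proof.
  intros Hab Hg Hin x Hx.
  destruct (Rle_dec (Rabs (g x)) B) as [H|H]; [exact H|exfalso].
  destruct (Hg x Hx (Rabs (g x) - B) ltac:(lra)) as [d [Hd Hc]].
  assert (Hy : exists y, a < y < b /\ Rabs (y - x) < d).
  (* Moving [x] a small fraction [e] of the way to the midpoint enters the open interval from either
     end. *)
  { set (m := (a + b) / 2).
    set (e := Rmin (1 / 2) (d / (2 * (b - a)))).
    assert (He0 : 0 < e).
    { apply Rmin_pos; [lra|]. apply Rdiv_lt_0_compat; lra. }
    assert (He1 : e <= 1 / 2) by apply Rmin_l.
    assert (He2 : e * (b - a) <= d / 2).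
    { assert (e <= d / (2 * (b - a))) by apply Rmin_r.
      apply Rle_trans with (d / (2 * (b - a)) * (b - a)).
      - apply Rmult_le_compat_r; lra.
      - right. field. lra. }
    exists (x + e * (m - x)).
    assert (Hm : a < m < b) by (unfold m; lra).
    split; [split; nra|].
    replace (x + e * (m - x) - x) with (e * (m - x)) by ring.
    apply Rabs_def1; unfold m in *; nra. }
  destruct Hy as [y [Hy Hyx]].
  specialize (Hc y ltac:(lra) Hyx). specialize (Hin y Hy).
  pose proof (Rabs_triang_inv (g x) (g y)) as Ht. rewrite <- Rabs_Ropp in Hc.
  replace (- (g y - g x)) with (g x - g y) in Hc by ring. lra.
Qed.

(** The gauge encodes the value as well as the modulus: [d * (1 + Rabs (g x t)) <= 1]. A uniform
    lower bound [d] of the gauge over a finite cover then bounds [g] at the chosen points by [/ d],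
    and elsewhere by [/ d + 1]. The compactness statement is doubly negated, hence the classical
    step. *)
Lemma cont_rect_bounded (l T : R) (g : R -> R -> R) : cont_rect l T g ->
  exists B, 0 < B /\ forall x t, 0 <= x <= l -> 0 <= t <= T -> Rabs (g x t) <= B.
Proof.
  intros Hg.
  assert (Hex : forall x t, exists d : posreal, 0 <= x <= l -> 0 <= t <= T ->
     d * (1 + Rabs (g x t)) <= 1 /\
     forall x' t', 0 <= x' <= l -> 0 <= t' <= T -> Rabs (x' - x) < d -> Rabs (t' - t) < d ->
       Rabs (g x' t' - g x t) < 1).
  { intros x t.
    destruct (classic (0 <= x <= l /\ 0 <= t <= T)) as [[Hx Ht]|Hn].
    2:{ exists (mkposreal 1 Rlt_0_1). intros Hx Ht. exfalso. tauto. }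
    destruct (Hg x t Hx Ht 1 Rlt_0_1) as [d [Hd H]].
    pose proof (Rabs_pos (g x t)).
    assert (Hm : 0 < Rmin d (/ (1 + Rabs (g x t)))).
    { apply Rmin_pos; [exact Hd|]. apply Rinv_0_lt_compat. lra. }
    exists (mkposreal _ Hm). intros _ _. simpl. split.
    - apply Rle_trans with (/ (1 + Rabs (g x t)) * (1 + Rabs (g x t))).
      + apply Rmult_le_compat_r; [lra|apply Rmin_r].
      + right. field. lra.
    - intros x' t' Hx' Ht' H1 H2. pose proof (Rmin_l d (/ (1 + Rabs (g x t)))).
      apply H; try assumption; lra. }
  set (delta := fun x t => proj1_sig (constructive_indefinite_description _ (Hex x t))).
  destruct (compactness_value_2d 0 l 0 T delta) as [d Hd].
  pose proof (cond_pos d) as Hdp.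
  exists (/ d + 1). split; [pose proof (Rinv_0_lt_compat _ Hdp); lra|].
  intros x t Hx Ht.
  apply NNPP. intros Hcon. apply (Hd x t Hx Ht). intros [a [b [Ha [Hb [H1 [H2 H3]]]]]].
  apply Hcon. unfold delta in H1, H2, H3.
  destruct (constructive_indefinite_description _ (Hex a b)) as [e He]. simpl in *.
  destruct (He Ha Hb) as [He1 He2]. specialize (He2 x t Hx Ht H1 H2).
  pose proof (Rabs_triang_inv (g x t) (g a b)). pose proof (Rabs_pos (g a b)).
  assert (Rabs (g a b) <= / d).
  { apply (Rmult_le_reg_l d); [exact Hdp|]. rewrite Rinv_r by lra.
    apply Rle_trans with (d * (1 + Rabs (g a b))); [nra|].
    eapply Rle_trans; [|exact He1]. apply Rmult_le_compat_r; lra. }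
  lra.
Qed.

Lemma cont_on_bounded (T : R) (g : R -> R) : cont_on 0 T g ->
  exists B, 0 < B /\ forall t, 0 <= t <= T -> Rabs (g t) <= B.
Proof.
  intros Hg. destruct (cont_rect_bounded 0 T (fun _ t => g t)) as [B [HB H]].
  - intros x t _ Ht eps Heps. destruct (Hg t Ht eps Heps) as [d [Hd Hc]].
    exists d. split; [exact Hd|]. intros. now apply Hc.
  - exists B. split; [exact HB|]. intros t Ht. apply (H 0 t); lra.
Qed.

Lemma has_deriv_within_lin (a b p q : R) (f f' g g' : R -> R) :
  has_deriv_within a b f f' -> has_deriv_within a b g g' ->
  has_deriv_within a b (fun x => p * f x + q * g x) (fun x => p * f' x + q * g' x).
Proof.
  intros Hf Hg x Hx eps Heps.
  pose proof (Rabs_pos p). pose proof (Rabs_pos q).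
  destruct (Hf x Hx (eps / (2 * (Rabs p + 1)))) as [d1 [Hd1 H1]];
    [apply Rdiv_lt_0_compat; lra|].
  destruct (Hg x Hx (eps / (2 * (Rabs q + 1)))) as [d2 [Hd2 H2]];
    [apply Rdiv_lt_0_compat; lra|].
  exists (Rmin d1 d2). split; [now apply Rmin_pos|]. intros y Hy Hn Hyx.
  specialize (H1 y Hy Hn ltac:(pose proof (Rmin_l d1 d2); lra)).
  specialize (H2 y Hy Hn ltac:(pose proof (Rmin_r d1 d2); lra)).
  replace ((p * f y + q * g y - (p * f x + q * g x)) / (y - x) - (p * f' x + q * g' x))
    with (p * ((f y - f x) / (y - x) - f' x) + q * ((g y - g x) / (y - x) - g' x))
    by (field; lra).
  eapply Rle_lt_trans; [apply Rabs_triang|]. rewrite !Rabs_mult.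
  assert (Rabs p * Rabs ((f y - f x) / (y - x) - f' x) <= Rabs p * (eps / (2 * (Rabs p + 1))))
    by (apply Rmult_le_compat_l; lra).
  assert (Rabs q * Rabs ((g y - g x) / (y - x) - g' x) <= Rabs q * (eps / (2 * (Rabs q + 1))))
    by (apply Rmult_le_compat_l; lra).
  assert (Hlt : forall c, Rabs c * (eps / (2 * (Rabs c + 1))) < eps / 2).
  { intros c. pose proof (Rabs_pos c).
    apply (Rmult_lt_reg_r (2 * (Rabs c + 1))); [lra|].
    replace (Rabs c * (eps / (2 * (Rabs c + 1))) * (2 * (Rabs c + 1)))
      with (Rabs c * eps) by (field; lra). nra. }
  pose proof (Hlt p). pose proof (Hlt q). lra.
Qed.

Lemma has_deriv_within_of_is_derive (a b : R) (f f' : R -> R) :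
  (forall x, is_derive f x (f' x)) -> has_deriv_within a b f f'.
Proof.
  intros Hf x _ eps Heps. specialize (Hf x). apply is_derive_Reals in Hf.
  destruct (Hf eps Heps) as [d Hd]. exists d. split; [apply cond_pos|].
  intros y _ Hn Hy. specialize (Hd (y - x) ltac:(lra) Hy).
  replace (x + (y - x)) with y in Hd by ring. exact Hd.
Qed.

Lemma is_derive_of_within (a b x : R) (f f' : R -> R) :
  has_deriv_within a b f f' -> a < x < b -> is_derive f x (f' x).
Proof.
  intros Hf Hx. apply is_derive_Reals. intros eps Heps.
  destruct (Hf x ltac:(lra) eps Heps) as [d [Hd H]].
  assert (Hm : 0 < Rmin d (Rmin (x - a) (b - x))) by (repeat apply Rmin_pos; lra).
  exists (mkposreal _ Hm). simpl. intros k Hk0 Hk.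
  pose proof (Rmin_l d (Rmin (x - a) (b - x))).
  pose proof (Rmin_r d (Rmin (x - a) (b - x))).
  pose proof (Rmin_l (x - a) (b - x)). pose proof (Rmin_r (x - a) (b - x)).
  pose proof (Rabs_def2 _ _ Hk).
  specialize (H (x + k) ltac:(lra) ltac:(lra)).
  replace (x + k - x) with k in H by ring. apply H. lra.
Qed.

Lemma cont_on_of_deriv (a b : R) (f f' : R -> R) :
  has_deriv_within a b f f' -> cont_on a b f.
Proof.
  intros Hf x Hx eps Heps. destruct (Hf x Hx 1 Rlt_0_1) as [d [Hd H]].
  pose proof (Rabs_pos (f' x)).
  exists (Rmin d (eps / (Rabs (f' x) + 2))). split.
  { apply Rmin_pos; [exact Hd|]. apply Rdiv_lt_0_compat; lra. }
  intros y Hy Hyx. destruct (Req_dec y x) as [->|Hn].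
  { rewrite Rminus_diag, Rabs_R0. exact Heps. }
  pose proof (Rmin_l d (eps / (Rabs (f' x) + 2))).
  pose proof (Rmin_r d (eps / (Rabs (f' x) + 2))).
  specialize (H y Hy Hn ltac:(lra)).
  pose proof (Rabs_triang_inv ((f y - f x) / (y - x)) (f' x)).
  assert (Hq : Rabs ((f y - f x) / (y - x)) <= Rabs (f' x) + 1) by lra.
  replace (f y - f x) with ((f y - f x) / (y - x) * (y - x)) by (field; lra).
  rewrite Rabs_mult.
  apply Rle_lt_trans with ((Rabs (f' x) + 1) * Rabs (y - x)).
  { apply Rmult_le_compat_r; [apply Rabs_pos|exact Hq]. }
  apply Rle_lt_trans with ((Rabs (f' x) + 1) * (eps / (Rabs (f' x) + 2))).
  { apply Rmult_le_compat_l; lra. }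
  apply (Rmult_lt_reg_r (Rabs (f' x) + 2)); [lra|].
  replace ((Rabs (f' x) + 1) * (eps / (Rabs (f' x) + 2)) * (Rabs (f' x) + 2))
    with ((Rabs (f' x) + 1) * eps) by (field; lra). nra.
Qed.

(** Retraction onto [[a, b]]: composing with it extends a function continuous within the interval to
    one continuous on the line, as two-sided notions of continuity demand. *)
Definition clamp (a b x : R) : R := Rmax a (Rmin b x).

Lemma clamp_id (a b x : R) : a <= x <= b -> clamp a b x = x.
Proof. intros H. unfold clamp. rewrite Rmin_right, Rmax_right; lra. Qed.

Lemma clamp_in (a b x : R) : a <= b -> a <= clamp a b x <= b.
Proof.
  intros H. unfold clamp. split; [apply Rmax_l|]. apply Rmax_lub; [exact H|apply Rmin_l].
Qed.

Lemma clamp_contract (a b x y : R) : Rabs (clamp a b y - clamp a b x) <= Rabs (y - x).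
Proof.
  unfold clamp, Rmax, Rmin. repeat destruct Rle_dec; unfold Rabs; repeat destruct Rcase_abs; lra.
Qed.

Lemma cont_on_continuous (a b x : R) (g : R -> R) : a <= b ->
  cont_on a b g -> continuous (fun y => g (clamp a b y)) x.
Proof.
  intros Hab Hg. apply continuity_pt_filterlim. intros eps Heps.
  destruct (Hg (clamp a b x) (clamp_in a b x Hab) eps Heps) as [d [Hd H]].
  exists d. split; [exact Hd|]. intros y [_ Hy]. simpl in *. unfold Rdist in *.
  apply H; [now apply clamp_in|]. eapply Rle_lt_trans; [apply clamp_contract|exact Hy].
Qed.

Lemma mean_value_within (a b x y : R) (f f' : R -> R) : has_deriv_within a b f f' ->
  a <= x <= b -> a <= y <= b ->
  exists c, Rmin x y <= c <= Rmax x y /\ f y - f x = f' c * (y - x).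
Proof.
  intros Hf Hx Hy.
  destruct (MVT_gen (fun z => f (clamp a b z)) x y f') as [c [Hc H]].
  - intros z Hz.
    assert (Hab : a < z < b).
    { unfold Rmin, Rmax in Hz. destruct Rle_dec; lra. }
    apply is_derive_ext_loc with f; [|now apply (is_derive_of_within a b)].
    assert (Hm : 0 < Rmin (z - a) (b - z)) by (apply Rmin_pos; lra).
    exists (mkposreal _ Hm). intros w Hw. symmetry. f_equal. apply clamp_id.
    unfold ball in Hw; simpl in Hw; unfold AbsRing_ball, abs, minus, plus, opp in Hw;
    simpl in Hw.
    pose proof (Rabs_def2 _ _ Hw). pose proof (Rmin_l (z - a) (b - z)).
    pose proof (Rmin_r (z - a) (b - z)). lra.
  - intros z _. apply continuity_pt_filterlim, cont_on_continuous; [lra|].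
    now apply cont_on_of_deriv with f'.
  - exists c. split; [exact Hc|]. now rewrite !clamp_id in H by assumption.
Qed.

Definition taylor (g : nat -> R -> R) (n : nat) (x0 x : R) : R :=
  bsum (fun k => g k x0 * (x - x0) ^ k / INR (fact k)) n.

Lemma taylor_centre (g : nat -> R -> R) (n : nat) (x0 : R) :
  taylor g (S n) x0 x0 = g O x0.
Proof.
  unfold taylor. induction n as [|n IH]; [simpl; field|].
  replace (g O x0) with (g O x0 + 0) by ring. rewrite <- IH at 1.
  simpl bsum. f_equal. rewrite Rminus_diag. simpl pow. unfold Rdiv. ring.
Qed.

Lemma is_derive_taylor (g : nat -> R -> R) (n : nat) (x0 x : R) :
  is_derive (taylor g (S n) x0) x (taylor (fun k => g (S k)) n x0 x).
Proof.
  induction n as [|n IH].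
  - unfold taylor; simpl. apply is_derive_ext with (fun _ => g O x0).
    + intros t. change (g O x0 = 0 + g O x0 * 1 / 1). field.
    + apply @is_derive_const.
  - change (is_derive (fun x => plus (taylor g (S n) x0 x)
              (g (S n) x0 * (x - x0) ^ S n / INR (fact (S n)))) x
              (plus (taylor (fun k => g (S k)) n x0 x)
                 (g (S n) x0 * (x - x0) ^ n / INR (fact n)))).
    apply @is_derive_plus; [exact IH|].
    rewrite fact_simpl, mult_INR.
    pose proof (not_0_INR (S n) ltac:(lia)). pose proof (INR_fact_neq_0 n).
    generalize dependent (INR (fact n)). intros F HF.
    auto_derive; [exact I|]. change (Init.Nat.pred (S n)) with n.
    change (x + - x0) with (x - x0). generalize ((x - x0) ^ n). intros P.
    field. tauto.
Qed.

(* The Lagrange factor [1/n!] is dropped. *)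
Lemma taylor_bound (a b K : R) (n : nat) : forall g : nat -> R -> R,
  (forall k, (k < n)%nat -> has_deriv_within a b (g k) (g (S k))) ->
  (forall x, a <= x <= b -> Rabs (g n x) <= K) ->
  forall x0 x, a <= x0 <= b -> a <= x <= b ->
  Rabs (g O x - taylor g n x0 x) <= K * Rabs (x - x0) ^ n.
Proof.
  induction n as [|n IH]; intros g Hg HK x0 x Hx0 Hx.
  - unfold taylor; simpl. rewrite Rminus_0_r, Rmult_1_r. now apply HK.
  - set (f := fun y => 1 * g O y + - 1 * taylor g (S n) x0 y).
    set (f' := fun y => 1 * g 1%nat y + - 1 * taylor (fun k => g (S k)) n x0 y).
    assert (Hf : has_deriv_within a b f f').
    { apply has_deriv_within_lin; [apply Hg; lia|].
      apply has_deriv_within_of_is_derive. intros y. apply is_derive_taylor. }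
    destruct (mean_value_within a b x0 x f f' Hf Hx0 Hx) as [c [Hc H]].
    assert (H0 : f x0 = 0) by (unfold f; rewrite taylor_centre; ring).
    replace (g O x - taylor g (S n) x0 x) with (f' c * (x - x0))
      by (rewrite <- H, H0; unfold f; ring).
    rewrite Rabs_mult.
    assert (Hcab : a <= c <= b /\ Rabs (c - x0) <= Rabs (x - x0)).
    { unfold Rmin, Rmax in Hc. destruct Rle_dec; unfold Rabs; repeat destruct Rcase_abs; lra. }
    pose proof (IH (fun k => g (S k)) (fun k Hk => Hg (S k) ltac:(lia)) HK x0 c Hx0 (proj1 Hcab))
      as Hc'.
    replace (f' c) with (g 1%nat c - taylor (fun k => g (S k)) n x0 c) by (unfold f'; ring).
    assert (HK0 : 0 <= K).
    { pose proof (HK x Hx). pose proof (Rabs_pos (g (S n) x)). lra. }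
    assert (Rabs (c - x0) ^ n <= Rabs (x - x0) ^ n)
      by (apply pow_incr; split; [apply Rabs_pos|apply Hcab]).
    replace (K * Rabs (x - x0) ^ S n) with (K * Rabs (x - x0) ^ n * Rabs (x - x0))
      by (simpl; ring).
    apply Rmult_le_compat_r; [apply Rabs_pos|].
    eapply Rle_trans; [exact Hc'|]. now apply Rmult_le_compat_l.
Qed.

(** * Spatial regularity of the time interpolation defect *)

Lemma taylor3 (g : nat -> R -> R) (x0 e : R) :
  taylor g 3 x0 (x0 + e) = g 0%nat x0 + g 1%nat x0 * e + g 2%nat x0 * e ^ 2 / 2.
Proof.
  unfold taylor. replace (x0 + e - x0) with e by ring. cbn. field.
Qed.

Lemma taylor4 (g : nat -> R -> R) (x0 e : R) :
  taylor g 4 x0 (x0 + e) = g 0%nat x0 + g 1%nat x0 * e + g 2%nat x0 * e ^ 2 / 2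
    + g 3%nat x0 * e ^ 3 / 6.
Proof.
  unfold taylor. replace (x0 + e - x0) with e by ring. cbn. field.
Qed.

Lemma taylor6 (g : nat -> R -> R) (x0 e : R) :
  taylor g 6 x0 (x0 + e) = g 0%nat x0 + g 1%nat x0 * e + g 2%nat x0 * e ^ 2 / 2
    + g 3%nat x0 * e ^ 3 / 6 + g 4%nat x0 * e ^ 4 / 24 + g 5%nat x0 * e ^ 5 / 120.
Proof.
  unfold taylor. replace (x0 + e - x0) with e by ring. cbn. field.
Qed.

Section Landau.

Variables (l K : R) (g : nat -> R -> R).
Hypothesis Hl : 0 < l.
Hypothesis Hg : forall k, (k < 6)%nat -> has_deriv_within 0 l (g k) (g (S k)).
Hypothesis HK : forall x, 0 <= x <= l -> Rabs (g 6%nat x) <= K.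

(* The weights are those of the one-sided six-point formula for the first derivative,
   exact on polynomials of degree five. *)
Lemma landau_first_derivative (A delta : R) : 0 < delta -> 10 * delta <= l ->
  (forall x, 0 <= x <= l -> Rabs (g O x) <= A) ->
  forall x, 0 <= x <= l -> Rabs (g 1%nat x) <= 18 * A / delta + 281250 * K * delta ^ 5.
Proof.
  intros Hd Hdl HA x Hx.
  (* Stepping towards the farther end keeps all six nodes in [[0, l]], since
     [5 * delta <= l / 2]. *)
  assert (Hdir : exists d, Rabs d = delta /\ forall k, 0 <= k <= 5 -> 0 <= x + k * d <= l).
  { destruct (Rle_dec x (l / 2)) as [H|H].
    - exists delta. split; [apply Rabs_pos_eq; lra|]. intros k Hk. nra.
    - exists (- delta). split; [rewrite Rabs_Ropp; apply Rabs_pos_eq; lra|].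
      intros k Hk. nra. }
  destruct Hdir as [d [Hdd Hin]].
  assert (HK0 : 0 <= K).
  { pose proof (HK x Hx). pose proof (Rabs_pos (g 6%nat x)). lra. }
  set (Rm := fun k => g O (x + k * d) - taylor g 6 x (x + k * d)).
  (* [15625 = 5 ^ 6], the farthest node being at distance [5 * delta]. The absolute weights of the
     six-point formula add up to less than 18, and [281250 = 18 * 15625]. *)
  set (E := 15625 * K * delta ^ 6).
  assert (HR : forall k, 0 <= k <= 5 -> Rabs (Rm k) <= E).
  { intros k Hk. unfold Rm.
    eapply Rle_trans; [apply (taylor_bound 0 l K 6 g Hg HK x (x + k * d) Hx (Hin k Hk))|].
    replace (x + k * d - x) with (k * d) by ring. rewrite Rabs_mult, Hdd, Rabs_pos_eq by lra.
    rewrite Rpow_mult_distr. unfold E.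
    assert (k ^ 6 <= 5 ^ 6) by (apply pow_incr; lra).
    assert (0 <= delta ^ 6) by (apply pow_le; lra).
    replace (15625 * K * delta ^ 6) with (K * (5 ^ 6 * delta ^ 6)) by ring.
    apply Rmult_le_compat_l; [exact HK0|]. now apply Rmult_le_compat_r. }
  assert (Hf : forall k, 0 <= k <= 5 -> Rabs (g O (x + k * d)) <= A)
    by (intros k Hk; apply HA, Hin, Hk).
  assert (Hid : d * g 1%nat x =
     - (137 / 60) * (g O (x + 0 * d) - Rm 0) + 5 * (g O (x + 1 * d) - Rm 1)
     - 5 * (g O (x + 2 * d) - Rm 2) + 10 / 3 * (g O (x + 3 * d) - Rm 3)
     - 5 / 4 * (g O (x + 4 * d) - Rm 4) + 1 / 5 * (g O (x + 5 * d) - Rm 5)).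
  { unfold Rm. rewrite !taylor6. field. }
  assert (Hb : forall k, 0 <= k <= 5 -> - (A + E) <= g O (x + k * d) - Rm k <= A + E).
  { intros k Hk. apply Rabs_le_between.
    eapply Rle_trans; [apply Rabs_triang|]. rewrite Rabs_Ropp.
    apply Rplus_le_compat; [now apply Hf|now apply HR]. }
  pose proof (Hb 0 ltac:(lra)). pose proof (Hb 1 ltac:(lra)). pose proof (Hb 2 ltac:(lra)).
  pose proof (Hb 3 ltac:(lra)). pose proof (Hb 4 ltac:(lra)). pose proof (Hb 5 ltac:(lra)).
  assert (HdA : delta * Rabs (g 1%nat x) <= 18 * (A + E)).
  { rewrite <- Hdd, <- Rabs_mult, Hid. apply Rabs_le_between. lra. }
  apply (Rmult_le_reg_l delta); [exact Hd|].
  replace (delta * (18 * A / delta + 281250 * K * delta ^ 5)) with (18 * (A + E))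
    by (unfold E; field; lra).
  exact HdA.
Qed.

End Landau.

Section TaylorTime.

Variables (T K : R) (g : nat -> R -> R).
Hypothesis Hg : forall k, (k < 3)%nat -> has_deriv_within 0 T (g k) (g (S k)).
Hypothesis HK : forall t, 0 <= t <= T -> Rabs (g 3%nat t) <= K.

Lemma taylor_time (t0 e : R) : 0 <= t0 <= T -> 0 <= t0 + e <= T ->
  Rabs (g O (t0 + e) - (g O t0 + g 1%nat t0 * e + g 2%nat t0 * e ^ 2 / 2)) <= K * Rabs e ^ 3.
Proof.
  intros Ht0 Hte. pose proof (taylor_bound 0 T K 3 g Hg HK t0 (t0 + e) Ht0 Hte) as H.
  rewrite taylor3 in H. now replace (t0 + e - t0) with e in H by ring.
Qed.

Lemma taylor_time_deriv (t0 e : R) : 0 <= t0 <= T -> 0 <= t0 + e <= T ->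
  Rabs (g 1%nat (t0 + e) - (g 1%nat t0 + g 2%nat t0 * e)) <= K * Rabs e ^ 2.
Proof.
  intros Ht0 Hte.
  pose proof (taylor_bound 0 T K 2 (fun k => g (S k)) (fun k Hk => Hg (S k) ltac:(lia))
    HK t0 (t0 + e) Ht0 Hte) as H.
  replace (taylor (fun k => g (S k)) 2 t0 (t0 + e)) with (g 1%nat t0 + g 2%nat t0 * e) in H
    by (unfold taylor; replace (t0 + e - t0) with e by ring; cbn; field).
  now replace (t0 + e - t0) with e in H by ring.
Qed.

Lemma second_deriv_lipschitz (t0 t1 : R) : 0 <= t0 <= T -> 0 <= t1 <= T ->
  Rabs (g 2%nat t1 - g 2%nat t0) <= K * Rabs (t1 - t0).
Proof.
  intros Ht0 Ht1.
  pose proof (taylor_bound 0 T K 1 (fun k => g (S (S k))) (fun k Hk => Hg (S (S k)) ltac:(lia))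
    HK t0 t1 Ht0 Ht1) as H.
  replace (taylor (fun k => g (S (S k))) 1 t0 t1) with (g 2%nat t0) in H
    by (unfold taylor; cbn; field).
  now rewrite pow_1 in H.
Qed.

End TaylorTime.

Section Smooth.

Variables (l T : R) (Dx Dt : nat -> R -> R -> R) (K : R).
Hypothesis Hl : 0 < l.
Hypothesis HT : 0 < T.
Hypothesis HK : 0 < K.
Hypothesis HDxt : Dx O = Dt O.
Hypothesis HDx : forall k, (k < 6)%nat -> forall t, 0 <= t <= T ->
  has_deriv_within 0 l (fun x => Dx k x t) (fun x => Dx (S k) x t).
Hypothesis HDt : forall k, (k < 3)%nat -> forall x, 0 <= x <= l ->
  has_deriv_within 0 T (fun t => Dt k x t) (fun t => Dt (S k) x t).
Hypothesis HKx1 : forall x t, 0 <= x <= l -> 0 <= t <= T -> Rabs (Dx 1 x t) <= K.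
Hypothesis HKx6 : forall x t, 0 <= x <= l -> 0 <= t <= T -> Rabs (Dx 6 x t) <= K.
Hypothesis HKt3 : forall x t, 0 <= x <= l -> 0 <= t <= T -> Rabs (Dt 3 x t) <= K.

(** Both expressions equal [u_xx + h^2 / 12 * u_xxxx] up to remainders controlled by the sixth
    derivative, the odd terms cancelling by symmetry. Two remainders of size [K h^4] and two of a
    twelfth of it stay below [3 K h^4]. *)
Lemma numerov_error (x h t : R) : 0 < h -> 0 <= x - h -> x + h <= l -> 0 <= t <= T ->
  Rabs ((Dx 2 (x - h) t + 10 * Dx 2 x t + Dx 2 (x + h) t) / 12
        - (Dx 0 (x + h) t - 2 * Dx 0 x t + Dx 0 (x - h) t) / h ^ 2) <= 3 * K * h ^ 4.
Proof.
  intros Hh Hx1 Hx2 Ht.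
  pose proof (taylor_bound 0 l K 6 (fun k x => Dx k x t) (fun k Hk => HDx k Hk t Ht)
    (fun x Hx => HKx6 x t Hx Ht) x) as H6.
  pose proof (taylor_bound 0 l K 4 (fun k x => Dx (S (S k)) x t)
    (fun k Hk => HDx (S (S k)) ltac:(lia) t Ht) (fun x Hx => HKx6 x t Hx Ht) x) as H4.
  assert (Hp : Rabs (x + h - x) = h) by (rewrite Rabs_pos_eq; lra).
  assert (Hm : Rabs (x - h - x) = h).
  { replace (x - h - x) with (- h) by ring. rewrite Rabs_Ropp. apply Rabs_pos_eq; lra. }
  pose proof (H6 (x + h) ltac:(lra) ltac:(lra)) as H6p.
  pose proof (H6 (x - h) ltac:(lra) ltac:(lra)) as H6m.
  pose proof (H4 (x + h) ltac:(lra) ltac:(lra)) as H4p.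
  pose proof (H4 (x - h) ltac:(lra) ltac:(lra)) as H4m.
  rewrite Hp in H6p, H4p. rewrite Hm in H6m, H4m.
  replace (x - h) with (x + - h) in * by ring.
  rewrite taylor6 in H6p, H6m. rewrite taylor4 in H4p, H4m.
  set (up := Dx 0%nat (x + h) t) in *. set (um := Dx 0%nat (x + - h) t) in *.
  set (wp := Dx 2%nat (x + h) t) in *. set (wm := Dx 2%nat (x + - h) t) in *.
  set (e1 := up - _) in H6p. set (e2 := um - _) in H6m.
  set (e3 := wp - _) in H4p. set (e4 := wm - _) in H4m.
  replace ((wm + 10 * Dx 2%nat x t + wp) / 12 - (up - 2 * Dx 0%nat x t + um) / h ^ 2)
    with (e3 / 12 + e4 / 12 - (e1 / h ^ 2 + e2 / h ^ 2)).
  2:{ unfold e1, e2, e3, e4. field. lra. }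
  assert (Hdiv : forall e, Rabs e <= K * h ^ 6 -> - (K * h ^ 4) <= e / h ^ 2 <= K * h ^ 4).
  { intros e He. apply Rabs_le_between. unfold Rdiv. rewrite Rabs_mult.
    rewrite (Rabs_pos_eq (/ h ^ 2)) by (apply Rlt_le, Rinv_0_lt_compat; nra).
    replace (K * h ^ 4) with (K * h ^ 6 * / h ^ 2) by (field; lra).
    apply Rmult_le_compat_r; [apply Rlt_le, Rinv_0_lt_compat; nra|exact He]. }
  pose proof (Hdiv e1 H6p). pose proof (Hdiv e2 H6m).
  apply Rabs_le_between in H4p. apply Rabs_le_between in H4m.
  assert (0 <= K * h ^ 4) by (apply Rmult_le_pos; [lra|apply pow_le; lra]).
  apply Rabs_le_between. lra.
Qed.

Variable sigma : R.
Hypothesis Hs : 0 < sigma < 1.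

Lemma sigma_step (tau : R) : 0 < tau -> 0 < sigma * tau < tau.
Proof. intros H. split; nra. Qed.

Definition interp_defect (k : nat) (t0 tau x : R) : R :=
  sigma * Dx k x (t0 + tau) + (1 - sigma) * Dx k x t0 - Dx k x (t0 + sigma * tau).

(** Linear terms cancel because [t0 + sigma * tau] is the barycentre of the two levels; the
    quadratic ones leave [(sigma - sigma^2) / 2]. *)
Lemma interp_defect_expansion (t0 tau x : R) : 0 < tau -> 0 <= t0 -> t0 + tau <= T ->
  0 <= x <= l ->
  Rabs (interp_defect 0 t0 tau x - sigma * (1 - sigma) / 2 * tau ^ 2 * Dt 2 x t0)
  <= 2 * K * tau ^ 3.
Proof.
  intros Htau Ht0 Ht1 Hx.
  pose proof (sigma_step tau Htau) as Hst.
  pose proof (taylor_time T K (fun k t => Dt k x t) (fun k Hk => HDt k Hk x Hx)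
    (fun t Ht => HKt3 x t Hx Ht) t0 tau ltac:(lra) ltac:(lra)) as H1.
  pose proof (taylor_time T K (fun k t => Dt k x t) (fun k Hk => HDt k Hk x Hx)
    (fun t Ht => HKt3 x t Hx Ht) t0 (sigma * tau) ltac:(lra) ltac:(lra)) as H2.
  unfold interp_defect. rewrite HDxt.
  rewrite (Rabs_pos_eq tau) in H1 by lra. rewrite (Rabs_pos_eq (sigma * tau)) in H2 by lra.
  set (e1 := Dt 0%nat x (t0 + tau) - _) in H1.
  set (e2 := Dt 0%nat x (t0 + sigma * tau) - _) in H2.
  replace (_ - _) with (sigma * e1 - e2) by (unfold e1, e2; field).
  assert (Ht3 : 0 <= K * tau ^ 3) by (apply Rmult_le_pos; [lra|apply pow_le; lra]).
  assert (sigma ^ 3 <= 1) by (rewrite <- (pow1 3); apply pow_incr; lra).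
  assert (K * (sigma * tau) ^ 3 <= K * tau ^ 3).
  { replace (K * (sigma * tau) ^ 3) with (sigma ^ 3 * (K * tau ^ 3)) by ring. nra. }
  apply Rabs_le_between in H1. apply Rabs_le_between in H2.
  apply Rabs_le_between. nra.
Qed.

Lemma interp_defect_bound (t0 tau x : R) : 0 < tau -> 0 <= t0 -> t0 + tau <= T ->
  0 <= x <= l ->
  Rabs (interp_defect 0 t0 tau x) <= (Rabs (Dt 2 x t0) + 2 * K * T) * tau ^ 2.
Proof.
  intros Htau Ht0 Ht1 Hx.
  pose proof (interp_defect_expansion t0 tau x Htau Ht0 Ht1 Hx) as H.
  pose proof (Rabs_pos (Dt 2 x t0)) as Hp.
  assert (Hsq : 0 <= tau ^ 2) by apply pow2_ge_0.
  replace (interp_defect 0 t0 tau x) with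
    ((interp_defect 0 t0 tau x - sigma * (1 - sigma) / 2 * tau ^ 2 * Dt 2 x t0)
     + sigma * (1 - sigma) / 2 * tau ^ 2 * Dt 2 x t0) by ring.
  eapply Rle_trans; [apply Rabs_triang|]. rewrite Rmult_plus_distr_r, Rplus_comm.
  apply Rplus_le_compat.
  - rewrite Rabs_mult, Rabs_pos_eq.
    2:{ apply Rmult_le_pos; [nra|exact Hsq]. }
    rewrite (Rmult_comm (Rabs _)). apply Rmult_le_compat_r; [exact Hp|].
    rewrite <- (Rmult_1_l (tau ^ 2)) at 2. apply Rmult_le_compat_r; nra.
  - eapply Rle_trans; [exact H|]. replace (2 * K * tau ^ 3) with (2 * K * tau * tau ^ 2) by ring.
    apply Rmult_le_compat_r; [exact Hsq|]. apply Rmult_le_compat_l; lra.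
Qed.

Lemma interp_defect_deriv (k : nat) (t0 tau : R) : (k < 6)%nat -> 0 < tau -> 0 <= t0 ->
  t0 + tau <= T ->
  has_deriv_within 0 l (interp_defect k t0 tau) (interp_defect (S k) t0 tau).
Proof.
  intros Hk Htau Ht0 Ht1. pose proof (sigma_step tau Htau) as Hst.
  pose proof (has_deriv_within_lin 0 l 1 (-1) _ _ _ _
    (has_deriv_within_lin 0 l sigma (1 - sigma) _ _ _ _
       (HDx k Hk (t0 + tau) ltac:(lra)) (HDx k Hk t0 ltac:(lra)))
    (HDx k Hk (t0 + sigma * tau) ltac:(lra))) as H.
  intros x Hx eps Heps. destruct (H x Hx eps Heps) as [d [Hd Hy]].
  exists d. split; [exact Hd|]. intros y Hy1 Hy2 Hy3. specialize (Hy y Hy1 Hy2 Hy3).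
  unfold interp_defect.
  match goal with H0 : Rabs ?a < _ |- Rabs ?b < _ => replace b with a; [exact H0|] end.
  field. lra.
Qed.

Lemma interp_defect_crude (k : nat) (t0 tau x : R) : 0 < tau -> 0 <= t0 -> t0 + tau <= T ->
  0 <= x <= l -> (forall t, 0 <= t <= T -> Rabs (Dx k x t) <= K) ->
  Rabs (interp_defect k t0 tau x) <= 2 * K.
Proof.
  intros Htau Ht0 Ht1 Hx Hk. unfold interp_defect. pose proof (sigma_step tau Htau) as Hst.
  pose proof (Hk (t0 + tau) ltac:(lra)) as H1. pose proof (Hk t0 ltac:(lra)) as H2.
  pose proof (Hk (t0 + sigma * tau) ltac:(lra)) as H3.
  apply Rabs_le_between in H1, H2, H3. apply Rabs_le_between. nra.
Qed.

(* Passing from step tau to step 2 tau cancels the leading tau^2 term, so that the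
   difference is O(tau^3) with bounded sixth x-derivative; interpolation then makes its
   x-derivative O(tau^(5/2)). *)
Lemma interp_defect_dyadic (t0 tau x : R) : 0 < tau -> 2 * tau <= T -> 0 <= t0 ->
  t0 + tau <= T -> 0 <= x <= l ->
  exists t1, 0 <= t1 /\ t1 + 2 * tau <= T /\
    Rabs (interp_defect 1 t0 tau x - / 4 * interp_defect 1 t1 (2 * tau) x)
    <= (126 * K / (l / (10 * sqrt T)) + 843750 * K * (l / (10 * sqrt T)) ^ 5) * sqrt tau ^ 5.
Proof.
  intros Htau Htau2 Ht0 Ht1 Hx.
  (* The window of length [2 * tau] must fit into [[0, T]]. Its start moves by at most [tau], which
     changes the second time derivative by at most [K * tau], again an [O(tau^3)] effect. *)
  set (t1 := Rmin t0 (T - 2 * tau)).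
  assert (Ht1' : 0 <= t1 /\ t1 + 2 * tau <= T /\ Rabs (t1 - t0) <= tau).
  { unfold t1, Rmin. destruct Rle_dec; unfold Rabs; destruct Rcase_abs; lra. }
  destruct Ht1' as [Hta [Htb Htc]]. exists t1. split; [exact Hta|]. split; [exact Htb|].
  set (c := l / (10 * sqrt T)). set (r := sqrt tau).
  assert (HsT : 0 < sqrt T) by now apply sqrt_lt_R0.
  assert (Hc : 0 < c) by (apply Rdiv_lt_0_compat; lra).
  assert (Hr : 0 < r) by now apply sqrt_lt_R0.
  assert (Hrr : tau = r ^ 2) by (unfold r; rewrite pow2_sqrt; lra).
  assert (HrT : r <= sqrt T) by (apply sqrt_le_1; lra).
  pose (g := fun k y => 1 * interp_defect k t0 tau y + - / 4 * interp_defect k t1 (2 * tau) y).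
  assert (Hg : forall k, (k < 6)%nat -> has_deriv_within 0 l (g k) (g (S k))).
  { intros k Hk. apply has_deriv_within_lin; apply interp_defect_deriv; (assumption || lra). }
  assert (Hg6 : forall y, 0 <= y <= l -> Rabs (g 6%nat y) <= 3 * K).
  { intros y Hy. unfold g.
    pose proof (interp_defect_crude 6 t0 tau y Htau Ht0 Ht1 Hy
      (fun t Ht => HKx6 y t Hy Ht)) as H1.
    pose proof (interp_defect_crude 6 t1 (2 * tau) y ltac:(lra) Hta Htb Hy
      (fun t Ht => HKx6 y t Hy Ht)) as H2.
    apply Rabs_le_between in H1, H2. apply Rabs_le_between. lra. }
  (* The 7 collects 2 from step [tau], [2 * 8 / 4] from step [2 * tau], and 1 from the shift of the
     window. *)
  assert (Hg0 : forall y, 0 <= y <= l -> Rabs (g O y) <= 7 * K * tau ^ 3).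
  { intros y Hy. unfold g.
    pose proof (interp_defect_expansion t0 tau y Htau Ht0 Ht1 Hy) as H1.
    pose proof (interp_defect_expansion t1 (2 * tau) y ltac:(lra) Hta Htb Hy) as H2.
    pose proof (second_deriv_lipschitz T K (fun k t => Dt k y t) (fun k Hk => HDt k Hk y Hy)
      (fun t Ht => HKt3 y t Hy Ht) t0 t1 ltac:(lra) ltac:(lra)) as H3.
    assert (H4 : Rabs (Dt 2 y t1 - Dt 2 y t0) <= K * tau).
    { eapply Rle_trans; [exact H3|]. apply Rmult_le_compat_l; lra. }
    assert (H5 : Rabs (sigma * (1 - sigma) / 2 * tau ^ 2 * (Dt 2 y t1 - Dt 2 y t0))
                 <= 1 * tau ^ 2 * (K * tau)).
    { rewrite Rabs_mult. pose proof (pow2_ge_0 tau).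
      rewrite (Rabs_pos_eq (sigma * _ / 2 * _)) by (apply Rmult_le_pos; nra).
      apply Rmult_le_compat; [apply Rmult_le_pos; nra|apply Rabs_pos| |exact H4].
      apply Rmult_le_compat_r; nra. }
    apply Rabs_le_between in H1, H2, H5. apply Rabs_le_between. lra. }
  (* The scale [c * sqrt tau] makes [tau^3 / delta] and [delta^5] both of order [tau^(5/2)]; [c] is
     such that [10 * c * sqrt T = l], so the width condition holds for every admissible [tau]. *)
  pose proof (landau_first_derivative l (3 * K) g Hl Hg Hg6 (7 * K * tau ^ 3) (c * r)
    ltac:(now apply Rmult_lt_0_compat)) as HL.
  specialize (HL ltac:(apply Rle_trans with (10 * (c * sqrt T));
    [apply Rmult_le_compat_l; [lra|apply Rmult_le_compat_l; lra]
    |right; unfold c; field; lra]) Hg0 x Hx).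
  unfold g in HL. rewrite Hrr in HL at 3.
  replace (interp_defect 1 t0 tau x - / 4 * interp_defect 1 t1 (2 * tau) x)
    with (1 * interp_defect 1 t0 tau x + - / 4 * interp_defect 1 t1 (2 * tau) x) by ring.
  eapply Rle_trans; [exact HL|]. right. field. lra.
Qed.

Lemma interp_defect_dx_bound : exists A, 0 < A /\ forall t0 tau x,
  0 < tau -> 0 <= t0 -> t0 + tau <= T -> 0 <= x <= l ->
  Rabs (interp_defect 1 t0 tau x) <= A * tau ^ 2.
Proof.
  assert (HsT : 0 < sqrt T) by now apply sqrt_lt_R0.
  set (c := l / (10 * sqrt T)).
  assert (Hc : 0 < c) by (apply Rdiv_lt_0_compat; lra).
  set (C := 126 * K / c + 843750 * K * c ^ 5).
  assert (HC : 0 < C).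
  { apply Rplus_lt_0_compat; [apply Rdiv_lt_0_compat; lra|].
    apply Rmult_lt_0_compat; [lra|now apply pow_lt]. }
  (* Made for the coarsest step, [2 * tau > T]: there the second summand dominates the crude bound
     [2 * K], and the first pays for the subtracted [3 * C * sqrt tau ^ 5]. *)
  set (A := 3 * C * sqrt T + 8 * K / T ^ 2).
  assert (HT2 : 0 < T ^ 2) by (apply pow_lt, HT).
  assert (HA : 0 < A).
  { apply Rplus_lt_0_compat; [nra|]. apply Rdiv_lt_0_compat; lra. }
  (* Induction on the number of doublings that carry [tau] beyond [T]. The subtracted term absorbs
     the dyadic errors: a quarter of it at [2 * tau] is [3 * sqrt 2 * C * r ^ 5], and
     [3 * sqrt 2 - 1 >= 3], for which [7 / 5 <= sqrt 2] suffices. *)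
  assert (Hmain : forall n t0 tau x, 0 < tau -> T < 2 ^ n * tau -> 0 <= t0 -> t0 + tau <= T ->
    0 <= x <= l -> Rabs (interp_defect 1 t0 tau x) <= A * tau ^ 2 - 3 * C * sqrt tau ^ 5).
  { induction n as [|n IH]; intros t0 tau x Htau Hn Ht0 Ht1 Hx.
    { simpl in Hn. lra. }
    set (r := sqrt tau).
    assert (Hr : 0 < r) by now apply sqrt_lt_R0.
    assert (Hrr : tau = r ^ 2) by (unfold r; rewrite pow2_sqrt; lra).
    assert (HrT : r <= sqrt T) by (apply sqrt_le_1; lra).
    destruct (Rle_dec (2 * tau) T) as [H2|H2].
    - destruct (interp_defect_dyadic t0 tau x Htau H2 Ht0 Ht1 Hx) as [t1 [Ha [Hb Hd]]].
      fold c C r in Hd.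
      specialize (IH t1 (2 * tau) x ltac:(lra) ltac:(simpl in Hn; lra) Ha Hb Hx).
      rewrite sqrt_mult in IH by lra. fold r in IH.
      assert (Hs2 : 7 / 5 <= sqrt 2).
      { apply Rsqr_incr_0_var; [|apply sqrt_pos]. rewrite Rsqr_sqrt by lra. unfold Rsqr. lra. }
      assert (Hs5 : (sqrt 2 * r) ^ 5 = 4 * sqrt 2 * r ^ 5).
      { replace ((sqrt 2 * r) ^ 5) with ((sqrt 2) ^ 2 * (sqrt 2) ^ 2 * sqrt 2 * r ^ 5) by ring.
        rewrite !pow2_sqrt by lra. ring. }
      rewrite Hs5 in IH.
      assert (Hr5 : 0 < r ^ 5) by now apply pow_lt.
      assert (H75 : 7 / 5 * (C * r ^ 5) <= sqrt 2 * (C * r ^ 5)).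
      { apply Rmult_le_compat_r; [nra|exact Hs2]. }
      apply Rabs_le_between in IH, Hd. apply Rabs_le_between. lra.
    - pose proof (interp_defect_crude 1 t0 tau x Htau Ht0 Ht1 Hx
        (fun t Ht => HKx1 x t Hx Ht)) as H.
      eapply Rle_trans; [exact H|]. unfold A.
      assert (3 * C * r ^ 5 <= 3 * C * sqrt T * tau ^ 2).
      { rewrite Hrr. replace (3 * C * sqrt T * (r ^ 2) ^ 2) with (3 * C * r ^ 4 * sqrt T) by ring.
        replace (3 * C * r ^ 5) with (3 * C * r ^ 4 * r) by ring.
        apply Rmult_le_compat_l; [|exact HrT].
        apply Rmult_le_pos; [lra|apply pow_le; lra]. }
      assert (2 * K <= 8 * K / T ^ 2 * tau ^ 2).
      { apply (Rmult_le_reg_r (T ^ 2)); [exact HT2|].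
        replace (8 * K / T ^ 2 * tau ^ 2 * T ^ 2) with (2 * K * (2 * tau) ^ 2) by (field; lra).
        apply Rmult_le_compat_l; [lra|]. apply pow_incr. lra. }
      lra. }
  exists A. split; [exact HA|]. intros t0 tau x Htau Ht0 Ht1 Hx.
  destruct (Pow_x_infinity 2 ltac:(rewrite Rabs_pos_eq; lra) (T / tau + 1)) as [n Hn].
  specialize (Hn n (Nat.le_refl n)). rewrite Rabs_pos_eq in Hn by (apply pow_le; lra).
  assert (H : T < 2 ^ n * tau).
  { apply Rge_le in Hn. apply Rlt_le_trans with ((T / tau + 1) * tau).
    - replace ((T / tau + 1) * tau) with (T + tau) by (field; lra). lra.
    - apply Rmult_le_compat_r; lra. }
  eapply Rle_trans; [apply (Hmain n t0 tau x Htau H Ht0 Ht1 Hx)|].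
  assert (0 <= 3 * C * sqrt tau ^ 5).
  { apply Rmult_le_pos; [lra|]. apply pow_le, sqrt_pos. }
  lra.
Qed.

End Smooth.

(** * The Gamma function *)

Lemma filterlim_Rabs {S : Type} (F : (S -> Prop) -> Prop) {FF : Filter F} (f : S -> R) (l : R) :
  filterlim f F (locally l) <-> forall eps, 0 < eps -> F (fun x => Rabs (f x - l) < eps).
Proof.
  rewrite filterlim_locally. split.
  - intros H eps Heps. exact (H (mkposreal eps Heps)).
  - intros H eps. exact (H eps (cond_pos eps)).
Qed.

Lemma filterlim_bound {S : Type} (F : (S -> Prop) -> Prop) {FF : ProperFilter F}
  (f : S -> R) (l c : R) :
  filterlim f F (locally l) -> F (fun x => Rabs (f x) <= c) -> Rabs l <= c.
Proof.
  intros Hl Hc. apply Rle_plus_epsilon. intros eps Heps.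
  apply (filterlim_Rabs F) with (eps := eps) in Hl; [|exact Heps].
  destruct (filter_ex _ (filter_and _ _ Hl Hc)) as [x [H1 H2]].
  pose proof (Rabs_triang_inv l (f x)) as H. rewrite Rabs_minus_sym in H. lra.
Qed.

(* One-sided: the junk value [Rpower 0 p] is [1]. *)
Lemma filterlim_Rpower_0 (p : R) : 0 < p ->
  filterlim (fun x => Rpower x p) (at_right 0) (locally 0).
Proof.
  intros Hp. apply (filterlim_Rabs (at_right 0)). intros eps Heps.
  exists (mkposreal _ (Rpower_gt0 eps (/ p))). intros x Hx Hx0.
  unfold ball in Hx; simpl in Hx; unfold AbsRing_ball, abs, minus, plus, opp in Hx; simpl in Hx.
  rewrite Ropp_0, Rplus_0_r, Rabs_pos_eq in Hx by lra.
  rewrite Rminus_0_r, Rabs_pos_eq by apply Rlt_le, Rpower_gt0.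
  apply Rlt_le_trans with (Rpower (Rpower eps (/ p)) p); [now apply Rlt_Rpower_l|].
  rewrite Rpower_mult, Rinv_l, Rpower_1 by lra. lra.
Qed.

Lemma filterlim_gap_left (t : R) : filterlim (fun b => t - b) (at_left t) (at_right 0).
Proof.
  intros P [d Hd]. exists d. intros b Hb Hbt. apply Hd; [|lra].
  unfold ball in *; simpl in *; unfold AbsRing_ball, abs, minus, plus, opp in *; simpl in *.
  replace (t - b + - 0) with (- (b + - t)) by ring. now rewrite Rabs_Ropp.
Qed.

(** * Improper integrals by domination *)

Section Improper.

Variables (F : (R -> Prop) -> Prop) (a : R) (D : R -> Prop) (f : R -> R).
Context {FF : ProperFilter F}.
Hypothesis HF : F D.
Hypothesis Ha : D a.
Hypothesis Hconv : forall u v x, D u -> D v -> Rmin u v <= x <= Rmax u v -> D x.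
Hypothesis Hf : forall x, D x -> continuous f x.

Lemma ex_RInt_on_D (u v : R) : D u -> D v -> ex_RInt f u v.
Proof.
  intros Hu Hv. apply (ex_RInt_continuous f). intros x Hx. apply Hf. now apply (Hconv u v).
Qed.

Lemma is_RInt_gen_of_limit (l : R) :
  filterlim (fun b => RInt f a b) F (locally l) -> is_RInt_gen f (at_point a) F l.
Proof.
  intros Hl. unfold is_RInt_gen.
  apply (filterlimi_lim_ext_loc (fun ab : R * R => RInt f a (snd ab))).
  - apply (Filter_prod _ _ _ (fun x => x = a) D); [reflexivity|exact HF|].
    intros x y -> Hy. apply (RInt_correct f a y). now apply ex_RInt_on_D.
  - apply (filterlim_comp _ _ _ snd (fun b => RInt f a b) _ F); [|exact Hl].
    apply filterlim_snd.
Qed.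

(** The primitive [G] of the dominating function has a limit, hence is Cauchy along [F]; domination
    bounds [RInt f u v] by [G v - G u] in absolute value, so the partial integrals of [f] are Cauchy
    too. The abstract [F] serves the ends [0+], [t-] and infinity alike. *)
Lemma ex_limit_RInt_dominated (g G : R -> R) (L : R) :
  (forall x, D x -> continuous g x) -> (forall x, D x -> is_derive G x (g x)) ->
  (forall x, D x -> Rabs (f x) <= g x) -> filterlim G F (locally L) ->
  exists l, filterlim (fun b => RInt f a b) F (locally l).
Proof.
  intros Hg HG Hfg HL.
  assert (Hle : forall u v, D u -> D v -> u <= v -> Rabs (RInt f u v) <= Rabs (G v - G u)).
  { intros u v Hu Hv Huv.
    assert (HI : is_RInt g u v (G v - G u)).
    { apply (is_RInt_derive G g); intros x Hx; [apply HG|apply Hg]; now apply (Hconv u v). }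
    pose proof (RInt_correct f u v (ex_RInt_on_D u v Hu Hv)) as HIf.
    assert (HD : forall x, u < x < v -> D x).
    { intros x Hx. apply (Hconv u v); [assumption|assumption|].
      rewrite Rmin_left, Rmax_right; lra. }
    apply Rle_trans with (G v - G u); [|apply Rle_abs].
    apply Rabs_le. split.
    - refine (is_RInt_le (fun x => - g x) f u v _ _ Huv _ HIf _).
      + apply (is_RInt_opp g). exact HI.
      + intros x Hx. pose proof (Hfg x (HD x Hx)) as H. apply Rabs_le_between in H. lra.
    - refine (is_RInt_le f g u v _ _ Huv HIf HI _).
      intros x Hx. pose proof (Hfg x (HD x Hx)) as H. apply Rabs_le_between in H. lra. }
  apply (filterlim_locally_cauchy (fun b => RInt f a b)). intros eps.
  assert (Hgc : exists y, filterlim G F (locally y)) by (exists L; exact HL).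
  apply (filterlim_locally_cauchy G) with (eps := eps) in Hgc.
  destruct Hgc as [P [HP HPG]].
  exists (fun x => P x /\ D x). split; [now apply filter_and|].
  intros u v [HPu HDu] [HPv HDv].
  assert (Hd : RInt f a v - RInt f a u = RInt f u v).
  { rewrite <- (RInt_Chasles f a u v (ex_RInt_on_D a u Ha HDu) (ex_RInt_on_D u v HDu HDv)).
    unfold plus; simpl. ring. }
  assert (Hb : Rabs (RInt f a v - RInt f a u) <= Rabs (G v - G u)).
  { rewrite Hd. destruct (Rle_dec u v) as [H|H].
    - now apply Hle.
    - rewrite <- (opp_RInt_swap f v u) by now apply ex_RInt_on_D.
      unfold opp; simpl. rewrite Rabs_Ropp, (Rabs_minus_sym (G v)). apply Hle; try assumption. lra. }
  eapply Rle_lt_trans; [exact Hb|]. exact (HPG u v HPu HPv).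
Qed.

End Improper.

Section GammaFunction.

Variable z : R.
Hypothesis Hz : 0 < z <= 1.

Local Notation gf := (fun x => Rpower x (z - 1) * exp (- x)).

Lemma continuous_gamma_integrand (y x : R) : 0 < x ->
  continuous (fun x => Rpower x y * exp (- x)) x.
Proof.
  intros Hx. apply (continuous_mult (fun x => Rpower x y) (fun x => exp (- x))).
  - now apply continuous_Rpower.
  - apply (ex_derive_continuous (fun x => exp (- x))). auto_derive. exact I.
Qed.

Lemma at_right_0_pos : at_right 0 (fun x => 0 < x).
Proof. exists (mkposreal 1 Rlt_0_1). intros x _ Hx. exact Hx. Qed.

Lemma p_infty_ge_1 : Rbar_locally p_infty (fun x => 1 <= x).
Proof. exists 1. intros x Hx. lra. Qed.

Lemma pos_convex (u v x : R) : 0 < u -> 0 < v -> Rmin u v <= x <= Rmax u v -> 0 < x.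
Proof. intros Hu Hv Hx. pose proof (Rmin_pos u v Hu Hv). lra. Qed.

Lemma ge_1_convex (u v x : R) : 1 <= u -> 1 <= v -> Rmin u v <= x <= Rmax u v -> 1 <= x.
Proof. intros Hu Hv Hx. pose proof (Rmin_glb u v 1 Hu Hv). lra. Qed.

Lemma exp_neg_le_1 (x : R) : 0 < x -> exp (- x) <= 1.
Proof. intros Hx. rewrite <- exp_0. left. apply exp_increasing. lra. Qed.

Lemma gamma_limit_0 : exists l, filterlim (fun b => RInt gf 1 b) (at_right 0) (locally l).
Proof.
  apply (ex_limit_RInt_dominated (at_right 0) 1 (fun x => 0 < x) gf at_right_0_pos Rlt_0_1
    pos_convex (continuous_gamma_integrand (z - 1))
    (fun x => Rpower x (z - 1)) (fun x => / z * Rpower x z) (/ z * 0)).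
  - intros x Hx. now apply continuous_Rpower.
  - intros x Hx. evar_last.
    + apply is_derive_scal. now apply is_derive_Rpower.
    + field. lra.
  - intros x Hx. pose proof (Rpower_gt0 x (z - 1)). pose proof (exp_neg_le_1 x Hx).
    pose proof (exp_pos (- x)). rewrite Rabs_pos_eq; nra.
  - apply (filterlim_comp _ _ _ (fun x => Rpower x z) (fun y => / z * y) _ (locally 0)).
    + apply filterlim_Rpower_0. lra.
    + apply (continuous_scal_r (/ z) (fun y : R => y) 0), continuous_id.
Qed.

Lemma Rpower_le_1 (x y : R) : 1 <= x -> y <= 0 -> Rpower x y <= 1.
Proof.
  intros Hx Hy. rewrite <- (Rpower_O x) by lra. apply Rle_Rpower; lra.
Qed.

(** [exp x] is the square of [exp (x / 2)], which exceeds [1 + x / 2]. The bound gives the decay at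
    infinity both of [exp (- x)] and, as [z <= 1], of [Rpower x z * exp (- x)]. *)
Lemma mul_exp_neg_le (x : R) : 0 < x -> x * exp (- x) <= 4 / x.
Proof.
  intros Hx. pose proof (exp_ineq1 (x / 2) ltac:(lra)) as H.
  assert (He : exp x = exp (x / 2) * exp (x / 2)) by (rewrite <- exp_plus; f_equal; lra).
  rewrite exp_Ropp. pose proof (exp_pos x).
  apply (Rmult_le_reg_r (exp x * x)); [now apply Rmult_lt_0_compat|].
  replace (x * / exp x * (exp x * x)) with (x * x) by (field; lra).
  replace (4 / x * (exp x * x)) with (4 * exp x) by (field; lra).
  rewrite He. nra.
Qed.

Lemma filterlim_0_of_le_inv (f : R -> R) :
  (forall x, 1 < x -> 0 <= f x <= 4 / x) -> filterlim f (Rbar_locally p_infty) (locally 0).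
Proof.
  intros Hf. apply (filterlim_Rabs (Rbar_locally p_infty)). intros eps Heps.
  exists (Rmax 1 (4 / eps)). intros x Hx.
  pose proof (Rmax_l 1 (4 / eps)). pose proof (Rmax_r 1 (4 / eps)).
  destruct (Hf x ltac:(lra)) as [H1 H2]. rewrite Rminus_0_r, Rabs_pos_eq by exact H1.
  eapply Rle_lt_trans; [exact H2|].
  apply (Rmult_lt_reg_r x); [lra|]. replace (4 / x * x) with 4 by (field; lra).
  assert (Hx' : 4 / eps < x) by lra.
  apply (Rmult_lt_compat_r eps) in Hx'; [|exact Heps].
  replace (4 / eps * eps) with 4 in Hx' by (field; lra). lra.
Qed.

Lemma gamma_limit_infty :
  exists l, filterlim (fun b => RInt gf 1 b) (Rbar_locally p_infty) (locally l).
Proof.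
  apply (ex_limit_RInt_dominated (Rbar_locally p_infty) 1 (fun x => 1 <= x) gf p_infty_ge_1
    (Rle_refl 1) ge_1_convex
    (fun x Hx => continuous_gamma_integrand (z - 1) x (Rlt_le_trans _ _ _ Rlt_0_1 Hx))
    (fun x => exp (- x)) (fun x => -1 * exp (- x)) (-1 * 0)).
  - intros x Hx. apply (ex_derive_continuous (fun x => exp (- x))). auto_derive. exact I.
  - intros x Hx. auto_derive; [exact I|ring].
  - intros x Hx. pose proof (Rpower_le_1 x (z - 1) Hx ltac:(lra)). pose proof (exp_pos (- x)).
    pose proof (Rpower_gt0 x (z - 1)). rewrite Rabs_pos_eq; nra.
  - apply (filterlim_comp _ _ _ (fun x => exp (- x)) (fun y => -1 * y) _ (locally 0)).
    + apply filterlim_0_of_le_inv. intros x Hx.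
      pose proof (mul_exp_neg_le x ltac:(lra)). pose proof (exp_pos (- x)). nra.
    + apply (continuous_scal_r (-1) (fun y : R => y) 0), continuous_id.
Qed.

Lemma is_RInt_gen_base_1 (f : R -> R) (l0 l1 : R) : (forall x, 0 < x -> continuous f x) ->
  filterlim (fun b => RInt f 1 b) (at_right 0) (locally l0) ->
  filterlim (fun b => RInt f 1 b) (Rbar_locally p_infty) (locally l1) ->
  is_RInt_gen f (at_right 0) (Rbar_locally p_infty) (l1 - l0).
Proof.
  intros Hf H0 H1. replace (l1 - l0) with (plus (opp l0) l1) by (unfold plus, opp; simpl; ring).
  apply (is_RInt_gen_Chasles f 1).
  - apply (is_RInt_gen_swap f).
    exact (is_RInt_gen_of_limit (at_right 0) 1 (fun x => 0 < x) f at_right_0_pos Rlt_0_1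
      pos_convex Hf l0 H0).
  - refine (is_RInt_gen_of_limit (Rbar_locally p_infty) 1 (fun x => 1 <= x) f p_infty_ge_1
      (Rle_refl 1) ge_1_convex _ l1 H1). intros x Hx. apply Hf. lra.
Qed.

(** Reconciles the normalisation [Gamma (1 - alpha)] of the Caputo derivative with
    [Gamma (2 - alpha)] of the discrete one. Integration by parts: [x^z exp(-x)] vanishes at both
    ends, so its derivative [dH] integrates to zero, and [z] times the integrand of [Gamma z] minus
    [dH] is the integrand of [Gamma (z + 1)]. *)
Lemma Gamma_recurrence : 0 < Gamma z /\ Gamma (z + 1) = z * Gamma z.
Proof.
  destruct gamma_limit_0 as [l0 H0]. destruct gamma_limit_infty as [l1 H1].
  pose proof (is_RInt_gen_base_1 gf l0 l1 (continuous_gamma_integrand (z - 1)) H0 H1) as HG.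
  assert (HGz : Gamma z = l1 - l0) by (unfold Gamma; now apply is_RInt_gen_unique).
  assert (Hex : forall u v, 0 < u -> 0 < v -> ex_RInt gf u v)
    by exact (ex_RInt_on_D (fun x => 0 < x) gf pos_convex (continuous_gamma_integrand (z - 1))).
  assert (Hpos : forall x, 0 < gf x).
  { intros x. apply Rmult_lt_0_compat; [apply Rpower_gt0|apply exp_pos]. }
  assert (Hge : forall u v, 0 < u -> u <= v -> 0 <= RInt gf u v).
  { intros u v Hu Huv. apply RInt_ge_0; [exact Huv|apply Hex; lra|].
    intros x _. apply Rlt_le, Hpos. }
  split.
  - rewrite HGz.
    (* [l0] is the integral from 1 down to 0, hence negatively oriented. *)
    assert (Hl0 : l0 <= 0).
    { apply (filterlim_le (F := at_right 0) (fun b => RInt gf 1 b) (fun _ => 0) l0 0);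
        [|exact H0|apply filterlim_const].
      exists (mkposreal 1 Rlt_0_1). intros x Hx Hx0.
      unfold ball in Hx; simpl in Hx; unfold AbsRing_ball, abs, minus, plus, opp in Hx;
      simpl in Hx. apply Rabs_def2 in Hx.
      rewrite <- (opp_RInt_swap gf x 1) by (apply Hex; lra). unfold opp; simpl.
      pose proof (Hge x 1 ltac:(lra) ltac:(lra)). lra. }
    assert (Hl1 : RInt gf 1 2 <= l1).
    { apply (filterlim_le (F := Rbar_locally p_infty) (fun _ => RInt gf 1 2)
        (fun b => RInt gf 1 b) (RInt gf 1 2) l1); [|apply filterlim_const|exact H1].
      exists 2. intros x Hx.
      rewrite <- (RInt_Chasles gf 1 2 x) by (apply Hex; lra). unfold plus; simpl.
      pose proof (Hge 2 x ltac:(lra) ltac:(lra)). lra. }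
    assert (0 < RInt gf 1 2).
    { apply RInt_gt_0; [lra|intros; apply Hpos|].
      intros x Hx. apply continuous_gamma_integrand. lra. }
    lra.
  - set (H := fun x => Rpower x z * exp (- x)).
    set (dH := fun x => z * (Rpower x (z - 1) * exp (- x)) - Rpower x z * exp (- x)).
    assert (HdH : forall x, 0 < x -> continuous dH x).
    { intros x Hx. apply (continuous_minus (fun x => z * (Rpower x (z - 1) * exp (- x)))
        (fun x => Rpower x z * exp (- x))).
      - apply (continuous_scal_r z gf). now apply continuous_gamma_integrand.
      - now apply continuous_gamma_integrand. }
    assert (HH : forall b, 0 < b -> RInt dH 1 b = H b - H 1).
    { intros b Hb. apply is_RInt_unique. apply (is_RInt_derive H dH).
      - intros x Hx. apply pos_convex in Hx; [|lra|exact Hb]. evar_last.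
        + apply (is_derive_mult (fun x => Rpower x z) (fun x => exp (- x))).
          * now apply is_derive_Rpower.
          * auto_derive; [exact I|reflexivity].
          * intros; apply Rmult_comm.
        + unfold plus, mult, dH; simpl. ring.
      - intros x Hx. apply HdH. now apply (pos_convex 1 b); [lra| |]. }
    assert (HH0 : filterlim H (at_right 0) (locally 0)).
    { apply (filterlim_Rabs (at_right 0)). intros eps Heps.
      pose proof (proj1 (filterlim_Rabs (at_right 0) _ 0)
        (filterlim_Rpower_0 z (proj1 Hz)) eps Heps) as HR.
      apply (filter_imp (fun x => 0 < x /\ Rabs (Rpower x z - 0) < eps)).
      - intros x [Hx Hr]. unfold H. pose proof (Rpower_gt0 x z). pose proof (exp_neg_le_1 x Hx).
        pose proof (exp_pos (- x)).
        rewrite Rminus_0_r, Rabs_pos_eq in Hr |- * by nra. nra.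
      - apply filter_and; [apply at_right_0_pos|exact HR]. }
    assert (HH1 : filterlim H (Rbar_locally p_infty) (locally 0)).
    { apply filterlim_0_of_le_inv. intros x Hx. unfold H.
      pose proof (mul_exp_neg_le x ltac:(lra)). pose proof (exp_pos (- x)).
      pose proof (Rpower_gt0 x z).
      assert (Rpower x z <= x) by (rewrite <- (Rpower_1 x) at 2 by lra; apply Rle_Rpower; lra).
      nra. }
    assert (Hlim : forall F (FF : Filter F), F (fun x => 0 < x) -> filterlim H F (locally 0) ->
      filterlim (fun b => RInt dH 1 b) F (locally (0 - H 1))).
    { intros F FF Hp HF. apply (filterlim_Rabs F). intros eps Heps.
      apply (filter_imp (fun x => 0 < x /\ Rabs (H x - 0) < eps)).
      - intros x [Hx Hr]. rewrite HH by exact Hx.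
        now replace (H x - H 1 - (0 - H 1)) with (H x - 0) by ring.
      - apply filter_and; [exact Hp|]. now apply (filterlim_Rabs F). }
    pose proof (is_RInt_gen_base_1 dH _ _ HdH (Hlim (at_right 0) _ at_right_0_pos HH0)
      (Hlim (Rbar_locally p_infty) _ (filter_imp _ _ (fun x Hx => Rlt_le_trans _ _ _ Rlt_0_1 Hx)
        p_infty_ge_1) HH1)) as HI.
    unfold Gamma. apply is_RInt_gen_unique. fold (Gamma z). rewrite HGz.
    pose proof (is_RInt_gen_minus _ _ _ _ (is_RInt_gen_scal _ z _ HG) HI) as Hfin.
    replace (z * (l1 - l0)) with (minus (scal z (l1 - l0)) (0 - H 1 - (0 - H 1)))
      by (unfold minus, plus, opp, scal; simpl; unfold mult; simpl; ring).
    eapply is_RInt_gen_ext; [|exact Hfin].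
    apply filter_forall. intros ab x _. unfold minus, plus, opp, scal, dH; simpl.
    unfold mult; simpl. replace (z + 1 - 1) with z by ring. ring.
Qed.

End GammaFunction.

(** * Truncation error of the discrete Caputo derivative *)

Lemma is_derive_Rpower_gap (t p eta : R) : eta < t ->
  is_derive (fun e => Rpower (t - e) p) eta (- p * Rpower (t - eta) (p - 1)).
Proof.
  intros H. evar_last.
  - apply (is_derive_comp (fun z => Rpower z p) (fun e => t - e)).
    + apply is_derive_Rpower. lra.
    + auto_derive; [exact I|reflexivity].
  - unfold scal; simpl; unfold mult; simpl. ring.
Qed.

Lemma continuous_Rpower_gap (t p eta : R) : eta < t ->
  continuous (fun e => Rpower (t - e) p) eta.
Proof.
  intros H. apply (ex_derive_continuous (fun e => Rpower (t - e) p)).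
  eexists. now apply is_derive_Rpower_gap.
Qed.

Lemma filterlim_Rpower_gap (t p : R) : 0 < p ->
  filterlim (fun b => Rpower (t - b) p) (at_left t) (locally 0).
Proof.
  intros Hp. apply (filterlim_comp _ _ _ (fun b => t - b) (fun x => Rpower x p) _ (at_right 0)).
  - apply filterlim_gap_left.
  - now apply filterlim_Rpower_0.
Qed.

Lemma filterlim_lin {S : Type} (F : (S -> Prop) -> Prop) {FF : Filter F} (p q : R)
  (f g : S -> R) (lf lg : R) :
  filterlim f F (locally lf) -> filterlim g F (locally lg) ->
  filterlim (fun x => p * f x + q * g x) F (locally (p * lf + q * lg)).
Proof.
  intros Hf Hg.
  apply (filterlim_comp_2 (G := locally (p * lf)) (H := locally (q * lg))
    (fun x => p * f x) (fun x => q * g x) Rplus).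
  - apply (filterlim_comp _ _ _ f (fun y => p * y) _ (locally lf) _ Hf).
    apply (continuous_scal_r p (fun y : R => y)), continuous_id.
  - apply (filterlim_comp _ _ _ g (fun y => q * y) _ (locally lg) _ Hg).
    apply (continuous_scal_r q (fun y : R => y)), continuous_id.
  - apply (filterlim_plus (V := R_NormedModule)).
Qed.

Section SingularKernel.

Variables (alpha t : R).
Hypothesis Halpha : 0 < alpha < 1.

Definition kernel_prim (eta : R) : R := - / (1 - alpha) * Rpower (t - eta) (1 - alpha).

Definition linear_prim (A B eta : R) : R :=
  - (A / (1 - alpha) * Rpower (t - eta) (1 - alpha)
     + B / (2 - alpha) * Rpower (t - eta) (2 - alpha)).

Lemma is_derive_kernel_prim (eta : R) : eta < t ->
  is_derive kernel_prim eta (Rpower (t - eta) (- alpha)).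
Proof.
  intros H. unfold kernel_prim. evar_last.
  - apply is_derive_scal, is_derive_Rpower_gap, H.
  - replace (1 - alpha - 1) with (- alpha) by ring. field. lra.
Qed.

Lemma is_derive_linear_prim (A B eta : R) : eta < t ->
  is_derive (linear_prim A B) eta ((A + B * (t - eta)) * Rpower (t - eta) (- alpha)).
Proof.
  intros H. unfold linear_prim. evar_last.
  - apply @is_derive_opp, @is_derive_plus; apply is_derive_scal, is_derive_Rpower_gap, H.
  - unfold opp, plus; simpl.
    rewrite (Rpower_succ (t - eta) (- alpha) (2 - alpha - 1)) by lra.
    replace (1 - alpha - 1) with (- alpha) by ring. field. lra.
Qed.

(** The kernel is positive, so a uniform error [eps] in [v] costs [eps] times the mass of the
    kernel: its singularity does not lower the order. The affine function is written in [t - eta] so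
    that its product with the kernel is a sum of two powers. *)
Lemma product_integration_error (v : R -> R) (A B eps p q : R) : p <= q -> q < t ->
  (forall x, continuous v x) ->
  (forall eta, p <= eta <= q -> Rabs (v eta - (A + B * (t - eta))) <= eps) ->
  Rabs (RInt (fun eta => v eta * Rpower (t - eta) (- alpha)) p q
        - (linear_prim A B q - linear_prim A B p))
  <= eps * (kernel_prim q - kernel_prim p).
Proof.
  intros Hpq Hqt Hv Happ.
  set (ker := fun eta => Rpower (t - eta) (- alpha)).
  assert (Hkc : forall eta, p <= eta <= q -> continuous ker eta)
    by (intros eta H; apply continuous_Rpower_gap; lra).
  assert (Hmm : forall x, Rmin p q <= x <= Rmax p q -> p <= x <= q)
    by (intros x; rewrite Rmin_left, Rmax_right by lra; tauto).
  assert (Hk : is_RInt ker p q (kernel_prim q - kernel_prim p)).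
  { apply (is_RInt_derive kernel_prim ker); intros x Hx; apply Hmm in Hx.
    - apply is_derive_kernel_prim. lra.
    - now apply Hkc. }
  assert (HL : is_RInt (fun eta => (A + B * (t - eta)) * ker eta) p q
                 (linear_prim A B q - linear_prim A B p)).
  { apply (is_RInt_derive (linear_prim A B)); intros x Hx; apply Hmm in Hx.
    - apply is_derive_linear_prim. lra.
    - apply (continuous_mult (fun eta => A + B * (t - eta)) ker); [|now apply Hkc].
      apply (ex_derive_continuous (fun eta => A + B * (t - eta))). auto_derive. exact I. }
  assert (HV : is_RInt (fun eta => v eta * ker eta) p q
                 (RInt (fun eta => v eta * ker eta) p q)).
  { apply (RInt_correct (fun eta => v eta * ker eta)).
    apply (ex_RInt_continuous (fun eta => v eta * ker eta)). intros x Hx. apply Hmm in Hx.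
    apply (continuous_mult v ker); [apply Hv|now apply Hkc]. }
  pose proof (is_RInt_minus _ _ _ _ _ _ HV HL) as HD.
  assert (Hb : forall x, p < x < q ->
    - eps * ker x <= v x * ker x - (A + B * (t - x)) * ker x <= eps * ker x).
  { intros x Hx. pose proof (Happ x ltac:(lra)) as H. apply Rabs_le_between in H.
    pose proof (Rpower_gt0 (t - x) (- alpha)) as Hp. fold (ker x) in Hp. nra. }
  apply Rabs_le. split.
  - rewrite <- Ropp_mult_distr_l_reverse.
    refine (is_RInt_le (fun x => - eps * ker x) _ p q _ _ Hpq _ HD _).
    + apply (is_RInt_scal ker p q (- eps) _ Hk).
    + intros x Hx. apply (Hb x Hx).
  - refine (is_RInt_le _ (fun x => eps * ker x) p q _ _ Hpq HD _ _).
    + apply (is_RInt_scal ker p q eps _ Hk).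
    + intros x Hx. apply (Hb x Hx).
Qed.

End SingularKernel.

(** Origin of the [ccoef]: inner cell [s] contributes [a d_s + b (d_(s+1) - d_s)], and collecting
    the coefficient of each difference quotient, which meets the [b] of two adjacent cells, gives
    [c]. A partial sum keeps one pending term in [d (S n)]. *)
Lemma frac_diff_regroup (alpha sigma : R) (d : nat -> R) (j : nat) :
  bsum (fun s => acoef alpha sigma (j - s) * d s
                 + bcoef alpha sigma (j - s) * (d (S s) - d s)) j
  + acoef alpha sigma 0 * d j =
  sum_f_R0 (fun s => ccoef alpha sigma j (j - s) * d s) j.
Proof.
  destruct j as [|j]; [simpl; ring|].
  assert (H : forall n, (n <= j)%nat ->
    bsum (fun s => acoef alpha sigma (S j - s) * d s
                   + bcoef alpha sigma (S j - s) * (d (S s) - d s)) (S n) =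
    sum_f_R0 (fun s => ccoef alpha sigma (S j) (S j - s) * d s) n
    + bcoef alpha sigma (S j - n) * d (S n)).
  { induction n as [|n IH]; intros Hn.
    - change (sum_f_R0 ?f 0) with (f O). change (bsum ?f 1) with (0 + f O). cbv beta.
      rewrite Nat.sub_0_r, ccoef_last. ring.
    - change (bsum ?f (S (S n))) with (bsum f (S n) + f (S n)). rewrite IH by lia.
      rewrite tech5.
      replace (S j - n)%nat with (S (S (j - S n))) by lia.
      replace (S j - S n)%nat with (S (j - S n)) by lia.
      rewrite ccoef_mid by lia. ring. }
  rewrite (H j (Nat.le_refl j)), tech5, Nat.sub_diag.
  replace (S j - j)%nat with 1%nat by lia. rewrite ccoef_0_S.
  change (acoef alpha sigma 0) with (Rpower sigma (1 - alpha)). ring.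
Qed.

Section CaputoTruncation.

Variables (alpha T K : R) (g : nat -> R -> R).
Hypothesis Halpha : 0 < alpha < 1.
Hypothesis HT : 0 < T.
Hypothesis Hg : forall k, (k < 3)%nat -> has_deriv_within 0 T (g k) (g (S k)).
Hypothesis HK : forall t, 0 <= t <= T -> Rabs (g 3%nat t) <= K.
Hypothesis Hc1 : cont_on 0 T (g 1%nat).

Variables (tau : R) (j : nat).
Hypothesis Htau : 0 < tau.
Hypothesis Hj : (INR j + 1) * tau <= T.

Local Notation sigma := (1 - alpha / 2).
Local Notation t := ((INR j + sigma) * tau).
Local Notation d := (fun s : nat => (g O (INR (S s) * tau) - g O (INR s * tau)) / tau).
Local Notation v := (fun eta => g 1%nat (clamp 0 T eta)).

Lemma K_nonneg : 0 <= K.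
Proof. pose proof (HK 0 ltac:(lra)). pose proof (Rabs_pos (g 3%nat 0)). lra. Qed.

Lemma t_bounds : INR j * tau < t < T.
Proof. split; nra. Qed.

Lemma node_in (s : nat) : (s <= S j)%nat -> 0 <= INR s * tau <= T.
Proof.
  intros Hs. pose proof (pos_INR s). apply le_INR in Hs. rewrite S_INR in Hs. split; nra.
Qed.

(* On an inner cell [u'] is replaced by the derivative of the quadratic interpolant. *)
Lemma quadratic_cell_error (s : nat) (eta : R) : (s < j)%nat ->
  INR s * tau <= eta <= INR (S s) * tau ->
  Rabs (g 1%nat eta - ((d s + (INR (j - s) + sigma - / 2) * (d (S s) - d s))
                       + - ((d (S s) - d s) / tau) * (t - eta))) <= 3 * K * tau ^ 2.
Proof.
  intros Hs Heta. pose proof K_nonneg as HK0.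
  rewrite minus_INR by lia. cbv beta. rewrite !S_INR in *.
  set (t1 := (INR s + 1) * tau) in *.
  assert (H0 : 0 <= t1 <= T) by (unfold t1; rewrite <- S_INR; apply node_in; lia).
  assert (Hm : 0 <= t1 + - tau <= T).
  { replace (t1 + - tau) with (INR s * tau) by (unfold t1; ring). apply node_in. lia. }
  assert (Hp : 0 <= t1 + tau <= T).
  { replace (t1 + tau) with (INR (S (S s)) * tau) by (unfold t1; rewrite !S_INR; ring).
    apply node_in. lia. }
  assert (He : - tau <= eta - t1 <= 0).
  { destruct Heta as [Ha Hb]. split; [unfold t1; lra|lra]. }
  pose proof (taylor_time T K g Hg HK t1 (- tau) H0 Hm) as HTm.
  pose proof (taylor_time T K g Hg HK t1 tau H0 Hp) as HTp.
  pose proof (taylor_time_deriv T K g Hg HK t1 (eta - t1) H0 ltac:(lra)) as HTd.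
  replace (t1 + (eta - t1)) with eta in HTd by ring.
  replace ((INR s + 1 + 1) * tau) with (t1 + tau) by (unfold t1; ring).
  replace (INR s * tau) with (t1 + - tau) by (unfold t1; ring).
  rewrite Rabs_Ropp, (Rabs_pos_eq tau) in HTm by lra. rewrite (Rabs_pos_eq tau) in HTp by lra.
  rewrite <- (Rabs_Ropp (eta - t1)), (Rabs_pos_eq (- (eta - t1))) in HTd by lra.
  set (e := eta - t1) in *.
  replace (t - eta) with ((INR j - INR s + sigma - 1) * tau - e) by (unfold e, t1; ring).
  set (a := (g O (t1 + - tau) - (g O t1 + g 1%nat t1 * - tau + g 2%nat t1 * (- tau) ^ 2 / 2))
            / tau ^ 3).
  set (b := (g O (t1 + tau) - (g O t1 + g 1%nat t1 * tau + g 2%nat t1 * tau ^ 2 / 2))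
            / tau ^ 3).
  set (r := g 1%nat eta - (g 1%nat t1 + g 2%nat t1 * e)) in *.
  assert (Ht3 : 0 < tau ^ 3) by now apply pow_lt.
  assert (Hdiv : forall z, Rabs z <= K * tau ^ 3 -> - K <= z / tau ^ 3 <= K).
  { intros z Hz. apply Rabs_le_between. unfold Rdiv.
    rewrite Rabs_mult, (Rabs_pos_eq (/ _)) by (apply Rlt_le, Rinv_0_lt_compat, Ht3).
    apply (Rmult_le_reg_r (tau ^ 3)); [exact Ht3|].
    replace (Rabs z * / tau ^ 3 * tau ^ 3) with (Rabs z) by (field; lra). exact Hz. }
  apply Hdiv in HTm. fold a in HTm. apply Hdiv in HTp. fold b in HTp.
  (* As [- tau <= e <= 0], [e + tau / 2] is at most [tau / 2] in absolute value; each of the three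
     terms then costs at most [K * tau ^ 2]. *)
  match goal with |- Rabs ?x <= _ =>
    replace x with (r + tau ^ 2 * a - (e + tau / 2) * tau * (a + b)) end.
  2:{ unfold r, a, b. field. lra. }
  assert (Hr : - (K * tau ^ 2) <= r <= K * tau ^ 2).
  { apply Rabs_le_between. eapply Rle_trans; [exact HTd|].
    apply Rmult_le_compat_l; [exact HK0|]. apply pow_incr. lra. }
  assert (Ha : Rabs (tau ^ 2 * a) <= K * tau ^ 2).
  { rewrite Rabs_mult, (Rabs_pos_eq (tau ^ 2)) by apply pow2_ge_0.
    rewrite Rmult_comm. apply Rmult_le_compat_r; [apply pow2_ge_0|]. apply Rabs_le. lra. }
  assert (Hb : Rabs ((e + tau / 2) * tau * (a + b)) <= tau / 2 * tau * (2 * K)).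
  { rewrite !Rabs_mult, (Rabs_pos_eq tau) by lra.
    apply Rmult_le_compat; [apply Rmult_le_pos; [apply Rabs_pos|lra]|apply Rabs_pos| |].
    - apply Rmult_le_compat_r; [lra|]. apply Rabs_le. lra.
    - apply Rabs_le. lra. }
  apply Rabs_le_between in Ha, Hb. apply Rabs_le. lra.
Qed.

(** The last cell has no next difference quotient, so the slope is the true second derivative at its
    left end. The discrete operator does not know this slope; it drops out in
    [linear_prim_last_value]. *)
Lemma linear_cell_error (eta : R) : INR j * tau <= eta < t ->
  Rabs (g 1%nat eta - ((d j + (sigma - / 2) * tau * g 2%nat (INR j * tau))
                       + - g 2%nat (INR j * tau) * (t - eta))) <= 3 * K * tau ^ 2.
Proof.
  intros Heta. pose proof K_nonneg as HK0. pose proof t_bounds as Htb.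
  cbv beta. rewrite S_INR. set (t1 := INR j * tau) in *.
  assert (H0 : 0 <= t1 <= T) by (apply node_in; lia).
  assert (Hp : 0 <= t1 + tau <= T).
  { replace (t1 + tau) with (INR (S j) * tau) by (unfold t1; rewrite !S_INR; ring).
    apply node_in. lia. }
  assert (He : 0 <= eta - t1 <= tau).
  { assert (t <= t1 + tau) by (unfold t1; nra). lra. }
  pose proof (taylor_time T K g Hg HK t1 tau H0 Hp) as HTp.
  pose proof (taylor_time_deriv T K g Hg HK t1 (eta - t1) H0 ltac:(lra)) as HTd.
  replace (t1 + (eta - t1)) with eta in HTd by ring.
  replace ((INR j + 1) * tau) with (t1 + tau) by (unfold t1; ring).
  rewrite (Rabs_pos_eq tau) in HTp by lra.
  rewrite (Rabs_pos_eq (eta - t1)) in HTd by lra.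
  set (e := eta - t1) in *.
  replace (t - eta) with (sigma * tau - e) by (unfold e, t1; ring).
  set (z := g O (t1 + tau) - (g O t1 + g 1%nat t1 * tau + g 2%nat t1 * tau ^ 2 / 2)) in *.
  set (r := g 1%nat eta - (g 1%nat t1 + g 2%nat t1 * e)) in *.
  match goal with |- Rabs ?x <= _ => replace x with (r - z / tau) end.
  2:{ unfold r, z. field. lra. }
  assert (Hr : - (K * tau ^ 2) <= r <= K * tau ^ 2).
  { apply Rabs_le_between. eapply Rle_trans; [exact HTd|].
    apply Rmult_le_compat_l; [exact HK0|]. apply pow_incr. lra. }
  assert (Hz : - (K * tau ^ 2) <= z / tau <= K * tau ^ 2).
  { apply Rabs_le_between. unfold Rdiv.
    rewrite Rabs_mult, (Rabs_pos_eq (/ _)) by (apply Rlt_le, Rinv_0_lt_compat, Htau).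
    apply (Rmult_le_reg_r tau); [exact Htau|].
    replace (Rabs z * / tau * tau) with (Rabs z) by (field; lra).
    replace (K * tau ^ 2 * tau) with (K * tau ^ 3) by ring. exact HTp. }
  assert (0 <= K * tau ^ 2) by (apply Rmult_le_pos; [exact HK0|apply pow2_ge_0]).
  apply Rabs_le. lra.
Qed.

(** Exact integration of the kernel against an affine function over one cell: the source of [acoef]
    and [bcoef]. The offset [INR (j - s) + sigma - / 2] is the distance from [t] to the midpoint of
    the cell, in units of [tau]. *)
Lemma linear_prim_cell (s : nat) : (s < j)%nat ->
  linear_prim alpha t (d s + (INR (j - s) + sigma - / 2) * (d (S s) - d s))
    (- ((d (S s) - d s) / tau)) (INR (S s) * tau)
  - linear_prim alpha t (d s + (INR (j - s) + sigma - / 2) * (d (S s) - d s))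
    (- ((d (S s) - d s) / tau)) (INR s * tau) =
  Rpower tau (1 - alpha) / (1 - alpha) *
  (acoef alpha sigma (j - s) * d s + bcoef alpha sigma (j - s) * (d (S s) - d s)).
Proof.
  intros Hs. generalize (d s) (d (S s)). intros d0 d1.
  unfold linear_prim.
  assert (HY : t - INR (S s) * tau = tau * (INR (j - S s) + sigma))
    by (rewrite minus_INR by lia; ring).
  assert (HX : t - INR s * tau = tau * (INR (j - S s) + sigma + 1))
    by (rewrite minus_INR, S_INR by lia; ring).
  rewrite HX, HY. replace (j - s)%nat with (S (j - S s)) by lia.
  rewrite acoef_S, bcoef_S, S_INR. unfold Aint, Bint.
  pose proof (pos_INR (j - S s)). set (Y := INR (j - S s) + sigma).
  assert (HY0 : 0 < Y) by (unfold Y; lra).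
  replace (INR (j - S s) + 1 + sigma - / 2) with (Y + / 2) by (unfold Y; field).
  rewrite <- !Rpower_mult_distr by lra.
  rewrite (Rpower_succ tau (1 - alpha) (2 - alpha)) by lra.
  rewrite (Rpower_succ Y (1 - alpha) (2 - alpha)) by lra.
  rewrite (Rpower_succ (Y + 1) (1 - alpha) (2 - alpha)) by lra.
  field. lra.
Qed.

(** A limit rather than the value at [t]: there the primitive would contain the junk value of
    [Rpower 0]. *)
Lemma linear_prim_last (A B : R) :
  filterlim (fun b => linear_prim alpha t A B b - linear_prim alpha t A B (INR j * tau))
    (at_left t)
    (locally (A / (1 - alpha) * Rpower (sigma * tau) (1 - alpha)
              + B / (2 - alpha) * Rpower (sigma * tau) (2 - alpha))).
Proof.
  set (C := linear_prim alpha t A B (INR j * tau)).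
  replace (A / (1 - alpha) * Rpower (sigma * tau) (1 - alpha)
              + B / (2 - alpha) * Rpower (sigma * tau) (2 - alpha))
    with (1 * (- (A / (1 - alpha)) * 0 + - (B / (2 - alpha)) * 0) + -1 * C).
  2:{ unfold C, linear_prim. replace (t - INR j * tau) with (sigma * tau) by ring. ring. }
  apply filterlim_ext with (fun b => 1 * (- (A / (1 - alpha)) * Rpower (t - b) (1 - alpha)
      + - (B / (2 - alpha)) * Rpower (t - b) (2 - alpha)) + -1 * C).
  { intros b. unfold linear_prim. ring. }
  apply (filterlim_lin (at_left t)); [apply (filterlim_lin (at_left t)); apply filterlim_Rpower_gap; lra|].
  apply filterlim_const.
Qed.

(* [sigma = 1 - alpha/2] makes the first moment of the kernel about the midpoint of
   the last cell vanish. *)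
Lemma linear_prim_last_value (A2 D0 : R) :
  (D0 + (sigma - / 2) * tau * A2) / (1 - alpha) * Rpower (sigma * tau) (1 - alpha)
  + - A2 / (2 - alpha) * Rpower (sigma * tau) (2 - alpha) =
  Rpower tau (1 - alpha) / (1 - alpha) * (acoef alpha sigma 0 * D0).
Proof.
  rewrite (Rpower_succ (sigma * tau) (1 - alpha) (2 - alpha)) by nra.
  change (acoef alpha sigma 0) with (Rpower sigma (1 - alpha)).
  rewrite <- Rpower_mult_distr by lra. field. lra.
Qed.

Lemma v_continuous (x : R) : continuous v x.
Proof. apply (cont_on_continuous 0 T x (g 1%nat)); [lra|exact Hc1]. Qed.

Lemma integrand_continuous (eta : R) : eta < t ->
  continuous (fun eta => v eta * Rpower (t - eta) (- alpha)) eta.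
Proof.
  intros H. apply (continuous_mult v (fun eta => Rpower (t - eta) (- alpha))).
  - apply v_continuous.
  - now apply continuous_Rpower_gap.
Qed.

Lemma integrand_ex_RInt (p q : R) : p < t -> q < t ->
  ex_RInt (fun eta => v eta * Rpower (t - eta) (- alpha)) p q.
Proof.
  intros Hp Hq. apply (ex_RInt_continuous (fun eta => v eta * Rpower (t - eta) (- alpha))).
  intros x Hx. apply integrand_continuous. pose proof (Rmax_lub_lt p q t Hp Hq). lra.
Qed.

(** The kernel masses of the cells telescope, so the cell errors do not accumulate with the number
    of cells. *)
Lemma partial_integral_error (n : nat) : (n <= j)%nat ->
  Rabs (RInt (fun eta => v eta * Rpower (t - eta) (- alpha)) 0 (INR n * tau)
    - Rpower tau (1 - alpha) / (1 - alpha) *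
      bsum (fun s => acoef alpha sigma (j - s) * d s
                     + bcoef alpha sigma (j - s) * (d (S s) - d s)) n)
  <= 3 * K * tau ^ 2 * (kernel_prim alpha t (INR n * tau) - kernel_prim alpha t 0).
Proof.
  pose proof t_bounds as Htb.
  induction n as [|n IH]; intros Hn.
  - simpl INR. rewrite Rmult_0_l, RInt_point. unfold zero; simpl.
    rewrite Rmult_0_r, !Rminus_diag, Rabs_R0. lra.
  - specialize (IH ltac:(lia)).
    assert (Hlt : forall m, (m <= j)%nat -> INR m * tau < t).
    { intros m Hm. apply le_INR in Hm. nra. }
    assert (Hstep : INR n * tau <= INR (S n) * tau) by (rewrite S_INR; nra).
    pose proof (product_integration_error alpha t Halpha v
      (d n + (INR (j - n) + sigma - / 2) * (d (S n) - d n)) (- ((d (S n) - d n) / tau))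
      (3 * K * tau ^ 2) (INR n * tau) (INR (S n) * tau) Hstep (Hlt (S n) Hn) v_continuous) as HP.
    cbv beta in HP. rewrite linear_prim_cell in HP by lia.
    assert (Happ : forall eta, INR n * tau <= eta <= INR (S n) * tau ->
      Rabs (v eta - (d n + (INR (j - n) + sigma - / 2) * (d (S n) - d n)
                     + - ((d (S n) - d n) / tau) * (t - eta))) <= 3 * K * tau ^ 2).
    { intros eta Heta. rewrite clamp_id.
      - apply quadratic_cell_error; [lia|exact Heta].
      - pose proof (node_in n ltac:(lia)). pose proof (node_in (S n) ltac:(lia)). lra. }
    specialize (HP Happ).
    rewrite <- (RInt_Chasles _ 0 (INR n * tau) (INR (S n) * tau)).
    2:{ apply integrand_ex_RInt; [|apply Hlt; lia]. pose proof (pos_INR j). nra. }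
    2:{ apply integrand_ex_RInt; apply Hlt; lia. }
    change plus with Rplus.
    change (bsum ?f (S n)) with (bsum f n + f n). rewrite Rmult_plus_distr_l.
    apply Rabs_le_between in IH, HP. apply Rabs_le. cbv beta in *. lra.
Qed.

(** For every upper limit [b] in the last cell the error is at most [3 K tau^2] times the total
    kernel mass, a bound independent of [b] and [j]; it survives the passage to [t]. *)
Lemma improper_integral_error : exists L,
  is_RInt_gen (fun eta => v eta * Rpower (t - eta) (- alpha)) (at_point 0) (at_left t) L /\
  Rabs (L - Rpower tau (1 - alpha) / (1 - alpha) *
            sum_f_R0 (fun s => ccoef alpha sigma j (j - s) * d s) j)
  <= 3 * K * tau ^ 2 * (Rpower T (1 - alpha) / (1 - alpha)).
Proof.
  pose proof t_bounds as Htb. pose proof (pos_INR j) as Hj0.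
  assert (Ht0 : 0 < t) by (apply Rmult_lt_0_compat; lra).
  set (f := fun eta => v eta * Rpower (t - eta) (- alpha)).
  destruct (cont_on_bounded T (g 1%nat) Hc1) as [B [HB HvB]].
  assert (HF : forall a, a < t -> at_left t (fun x => a <= x < t)).
  { intros a Ha. assert (Hp : 0 < t - a) by lra. exists (mkposreal _ Hp).
    intros x Hx Hxt. unfold ball in Hx; simpl in Hx;
    unfold AbsRing_ball, abs, minus, plus, opp in Hx; simpl in Hx.
    apply Rabs_def2 in Hx. lra. }
  assert (Hconv : forall u w x, 0 <= u < t -> 0 <= w < t -> Rmin u w <= x <= Rmax u w ->
    0 <= x < t).
  { intros u w x Hu Hw. unfold Rmin, Rmax. destruct Rle_dec; lra. }
  assert (Hfc : forall x, 0 <= x < t -> continuous f x)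
    by (intros x Hx; apply integrand_continuous; lra).
  destruct (ex_limit_RInt_dominated (at_left t) 0 (fun x => 0 <= x < t) f (HF 0 Ht0)
    ltac:(lra) Hconv Hfc (fun x => B * Rpower (t - x) (- alpha))
    (fun x => B * kernel_prim alpha t x) (B * (- / (1 - alpha) * 0))) as [L HL].
  { intros x Hx. apply (continuous_scal_r B (fun x => Rpower (t - x) (- alpha))).
    apply continuous_Rpower_gap. lra. }
  { intros x Hx. apply is_derive_scal, is_derive_kernel_prim; lra. }
  { intros x Hx. unfold f. rewrite Rabs_mult.
    rewrite (Rabs_pos_eq (Rpower _ _)) by apply Rlt_le, Rpower_gt0.
    apply Rmult_le_compat_r; [apply Rlt_le, Rpower_gt0|]. apply HvB, clamp_in. lra. }
  { apply (filterlim_comp _ _ _ (fun x => Rpower (t - x) (1 - alpha))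
      (fun y => B * (- / (1 - alpha) * y)) _ (locally 0)).
    - apply filterlim_Rpower_gap. lra.
    - apply (continuous_scal_r B (fun y => - / (1 - alpha) * y)).
      apply (continuous_scal_r (- / (1 - alpha)) (fun y : R => y)), continuous_id. }
  exists L. split.
  { exact (is_RInt_gen_of_limit (at_left t) 0 (fun x => 0 <= x < t) f (HF 0 Ht0)
      ltac:(lra) Hconv Hfc L HL). }
  rewrite <- frac_diff_regroup.
  set (S0 := bsum _ j).
  set (A := d j + (sigma - / 2) * tau * g 2%nat (INR j * tau)).
  set (A2 := - g 2%nat (INR j * tau)).
  pose proof (linear_prim_last A A2) as Hlast.
  set (P := Rpower tau (1 - alpha) / (1 - alpha)).
  assert (Hv : A / (1 - alpha) * Rpower (sigma * tau) (1 - alpha)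
      + A2 / (2 - alpha) * Rpower (sigma * tau) (2 - alpha) = P * (acoef alpha sigma 0 * d j))
    by exact (linear_prim_last_value (g 2%nat (INR j * tau)) (d j)).
  rewrite Hv in Hlast.
  rewrite Rmult_plus_distr_l.
  assert (Hlim : filterlim (fun b => RInt f 0 b - P * S0
      - (linear_prim alpha t A A2 b - linear_prim alpha t A A2 (INR j * tau))) (at_left t)
      (locally (L - P * S0 - P * (acoef alpha sigma 0 * d j)))).
  { replace (L - P * S0 - P * (acoef alpha sigma 0 * d j))
      with (1 * (1 * L + -1 * (P * S0)) + -1 * (P * (acoef alpha sigma 0 * d j))) by ring.
    apply filterlim_ext with (fun b => 1 * (1 * RInt f 0 b + -1 * (P * S0))
      + -1 * (linear_prim alpha t A A2 b - linear_prim alpha t A A2 (INR j * tau))).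
    { intros b. ring. }
    apply (filterlim_lin (at_left t)); [|exact Hlast]. apply (filterlim_lin (at_left t)); [exact HL|].
    apply filterlim_const. }
  replace (L - (P * S0 + P * (acoef alpha sigma 0 * d j)))
    with (L - P * S0 - P * (acoef alpha sigma 0 * d j)) by ring.
  apply (filterlim_bound (at_left t) _ _ _ Hlim).
  apply (filter_imp (fun b => INR j * tau <= b < t)); [|apply HF; lra].
  intros b Hb.
  pose proof (partial_integral_error j (Nat.le_refl j)) as H1. fold f P in H1.
  match type of H1 with context [bsum ?F j] => change (bsum F j) with S0 in H1 end.
  pose proof (product_integration_error alpha t Halpha v A A2 (3 * K * tau ^ 2)
    (INR j * tau) b ltac:(lra) ltac:(lra) v_continuous) as H2. fold f in H2.
  specialize (H2 ltac:(intros eta Heta; cbv beta; rewrite clamp_id;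
    [apply linear_cell_error; lra|pose proof (node_in j ltac:(lia)); lra])).
  rewrite <- (RInt_Chasles f 0 (INR j * tau) b).
  2:{ apply integrand_ex_RInt; lra. }
  2:{ apply integrand_ex_RInt; lra. }
  change plus with Rplus.
  assert (Hker : kernel_prim alpha t b - kernel_prim alpha t 0 <= Rpower T (1 - alpha) / (1 - alpha)).
  { unfold kernel_prim. rewrite Rminus_0_r.
    assert (Rpower t (1 - alpha) <= Rpower T (1 - alpha)) by (apply Rpower_incr; lra).
    pose proof (Rpower_gt0 (t - b) (1 - alpha)).
    assert (Hi : 0 < / (1 - alpha)) by (apply Rinv_0_lt_compat; lra).
    unfold Rdiv. nra. }
  assert (HC : 0 <= 3 * K * tau ^ 2).
  { pose proof K_nonneg. pose proof (pow2_ge_0 tau). nra. }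
  pose proof (Rmult_le_compat_l _ _ _ HC Hker).
  apply Rabs_le_between in H1, H2. apply Rabs_le. lra.
Qed.

Lemma caputo_truncation :
  Rabs (/ Gamma (1 - alpha) *
        RInt_gen (fun eta => Derive (g O) eta * Rpower (t - eta) (- alpha))
          (at_point 0) (at_left t)
        - frac_diff alpha sigma tau (fun s => g O (INR s * tau)) j)
  <= 3 * K * Rpower T (1 - alpha) / ((1 - alpha) * Gamma (1 - alpha)) * tau ^ 2.
Proof.
  pose proof t_bounds as Htb. pose proof (pos_INR j) as Hj0.
  assert (Ht0 : 0 < t) by (apply Rmult_lt_0_compat; lra).
  destruct improper_integral_error as [L [HL Herr]].
  destruct (Gamma_recurrence (1 - alpha) ltac:(lra)) as [HGpos HGrec].
  assert (HI : RInt_gen (fun eta => Derive (g O) eta * Rpower (t - eta) (- alpha))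
          (at_point 0) (at_left t) = L).
  (* [Derive] agrees with the within-derivative in the open interval only, which is enough under the
     integral. *)
  { apply is_RInt_gen_unique. eapply is_RInt_gen_ext; [|exact HL].
    apply (Filter_prod _ _ _ (fun x => x = 0) (fun b => 0 < b < t)).
    - reflexivity.
    - exists (mkposreal t Ht0). intros x Hx Hxt. unfold ball in Hx; simpl in Hx;
      unfold AbsRing_ball, abs, minus, plus, opp in Hx; simpl in Hx.
      apply Rabs_def2 in Hx. lra.
    - intros x b -> Hb eta. simpl. rewrite Rmin_left, Rmax_right by lra. intros Heta.
      rewrite clamp_id by lra. f_equal. symmetry. apply is_derive_unique.
      apply (is_derive_of_within 0 T); [apply Hg; lia|lra]. }
  rewrite HI. unfold frac_diff.
  replace (2 - alpha) with (1 - alpha + 1) by ring. rewrite HGrec.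
  set (Sc := sum_f_R0 (fun s => ccoef alpha sigma j (j - s) * d s) j) in Herr.
  change (sum_f_R0 (fun s => ccoef alpha sigma j (j - s) *
            ((g 0%nat (INR (S s) * tau) - g 0%nat (INR s * tau)) / tau)) j) with Sc.
  replace (/ Gamma (1 - alpha) * L - Rpower tau (1 - alpha) / ((1 - alpha) * Gamma (1 - alpha)) * Sc)
    with (/ Gamma (1 - alpha) * (L - Rpower tau (1 - alpha) / (1 - alpha) * Sc)) by (field; lra).
  assert (Hi : 0 < / Gamma (1 - alpha)) by now apply Rinv_0_lt_compat.
  rewrite Rabs_mult, (Rabs_pos_eq (/ _)) by lra.
  eapply Rle_trans; [apply Rmult_le_compat_l; [lra|exact Herr]|].
  right. field. lra.
Qed.

End CaputoTruncation.

(** * Stability of the scheme *)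

Lemma Hh_lin (h a b : R) (v w : nat -> R) (i : nat) :
  Hh h (fun m => a * v m + b * w m) i = a * Hh h v i + b * Hh h w i.
Proof. unfold Hh, dxx, Rdiv. ring. Qed.

Lemma frac_diff_lin (alpha sigma tau a b : R) (v w : nat -> R) (j : nat) :
  frac_diff alpha sigma tau (fun s => a * v s + b * w s) j =
  a * frac_diff alpha sigma tau v j + b * frac_diff alpha sigma tau w j.
Proof.
  unfold frac_diff.
  rewrite (sum_eq _ (fun s => ccoef alpha sigma j (j - s) * ((v (S s) - v s) / tau) * a
                            + ccoef alpha sigma j (j - s) * ((w (S s) - w s) / tau) * b))
    by (intros; unfold Rdiv; ring).
  rewrite sum_plus, <- !scal_sum. ring.
Qed.

Lemma frac_diff_ext (alpha sigma tau : R) (v w : nat -> R) (j : nat) :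
  (forall s, (s <= S j)%nat -> v s = w s) ->
  frac_diff alpha sigma tau v j = frac_diff alpha sigma tau w j.
Proof.
  intros H. unfold frac_diff. f_equal. apply sum_eq. intros s Hs.
  now rewrite (H s ltac:(lia)), (H (S s) ltac:(lia)).
Qed.

Lemma frac_diff_factor (alpha sigma tau : R) (w : nat -> R) (j : nat) : 0 < tau ->
  frac_diff alpha sigma tau w j =
  / (Gamma (2 - alpha) * Rpower tau alpha) *
  sum_f_R0 (fun s => ccoef alpha sigma j (j - s) * (w (S s) - w s)) j.
Proof.
  intros Htau. unfold frac_diff.
  rewrite (sum_eq _ (fun s => ccoef alpha sigma j (j - s) * (w (S s) - w s) * / tau))
    by (intros; unfold Rdiv; ring).
  rewrite <- scal_sum.
  replace (Rpower tau (1 - alpha)) with (tau * / Rpower tau alpha).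
  2:{ rewrite <- Rpower_Ropp. symmetry. apply Rpower_succ; [exact Htau|ring]. }
  set (Sc := sum_f_R0 _ j). pose proof (Rpower_gt0 tau alpha).
  rewrite Rinv_mult. unfold Rdiv. generalize (/ Gamma (2 - alpha)). intros G. field. lra.
Qed.

Section DiscreteStability.

Variables (alpha sigma T c1 Kk R0 P0 h tau : R) (n M : nat).
Variables (z rho psi : nat -> nat -> R) (kk qq : nat -> R).
Hypothesis Halpha : 0 < alpha < 1.
Hypothesis Hsigma : sigma = 1 - alpha / 2.
Hypothesis Hc1 : 0 < c1.
Hypothesis HKk : 0 <= Kk.
Hypothesis Hh0 : 0 < h.
Hypothesis Htau : 0 < tau.
Hypothesis HMT : INR M * tau <= T.
Hypothesis Hz0 : forall j, (j <= M)%nat -> z j O = 0.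
Hypothesis HzN : forall j, (j <= M)%nat -> z j (S n) = 0.
Hypothesis Hinit : forall i, (i <= S n)%nat -> z O i = 0.
Hypothesis Hk : forall j, (j < M)%nat -> c1 <= kk j <= Kk.
Hypothesis Hq : forall j, (j < M)%nat -> 0 <= qq j.
Hypothesis Hrho : forall i j, (i <= n)%nat -> (j < M)%nat ->
  Rabs (rho j (S i) - rho j i) <= R0 * h.
Hypothesis Hpsi : forall i j, (i < n)%nat -> (j < M)%nat -> Rabs (psi j (S i)) <= P0.
Hypothesis Hscheme : forall i j, (i < n)%nat -> (j < M)%nat ->
  frac_diff alpha sigma tau (fun s => Hh h (z s) (S i)) j =
  kk j * dxx h (ysig sigma z j) (S i) + kk j * dxx h (rho j) (S i)
  - qq j * Hh h (ysig sigma z j) (S i) + psi j (S i).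

Local Notation energy := (fun j => bsum (fun i => Hh h (z j) (S i) ^ 2) n).
Local Notation L := (h * INR (S n)).

(** Twice the right-hand side of [scheme_energy], the 2 being that of [2 w^(sigma) Delta^alpha w],
    under nodewise bounds. The [h] in the increments of [rho] cancels the [h ^ 2] below the
    diffusion coefficient; the node count becomes the length [L] through the factor [h] of the
    norm. *)
Definition source_bound : R :=
  2 * INR (S n) * (7 / 6 * Kk * R0 ^ 2 + L ^ 2 / c1 * P0 ^ 2).

Lemma energy_convolution_le (j : nat) : (j < M)%nat ->
  sum_f_R0 (fun s => ccoef alpha sigma j (j - s) * (energy (S s) - energy s)) j <=
  Gamma (2 - alpha) * Rpower tau alpha * source_bound.
Proof.
  intros Hj.
  destruct (Gamma_recurrence (1 - alpha) ltac:(lra)) as [HG1 HG2].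
  replace (1 - alpha + 1) with (2 - alpha) in HG2 by ring.
  assert (HG : 0 < Gamma (2 - alpha) * Rpower tau alpha).
  { apply Rmult_lt_0_compat; [rewrite HG2; apply Rmult_lt_0_compat; lra|apply Rpower_gt0]. }
  set (Q := Gamma (2 - alpha) * Rpower tau alpha) in *.
  set (w := ysig sigma z j).
  assert (Hw0 : w O = 0) by (unfold w, ysig; rewrite !Hz0 by lia; ring).
  assert (HwN : w (S n) = 0) by (unfold w, ysig; rewrite !HzN by lia; ring).
  destruct (Hk j Hj) as [Hk1 Hk2].
  pose proof (scheme_energy n h w Hh0 Hw0 HwN (kk j) (qq j) c1 (rho j) (psi j) Hc1 Hk1 (Hq j Hj))
    as Hen.
  assert (Hsrc : 2 * (7 / 6 * (kk j / h ^ 2) *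
      bsum (fun i => (rho j (S i) - rho j i) ^ 2) (S n)
      + L ^ 2 / c1 * bsum (fun i => psi j (S i) ^ 2) n) <= source_bound).
  { assert (Hr2 : bsum (fun i => (rho j (S i) - rho j i) ^ 2) (S n)
                  <= INR (S n) * (R0 * h) ^ 2).
    { rewrite <- bsum_const. apply bsum_le. intros i Hi. apply pow_maj_Rabs, Hrho; lia. }
    assert (Hp2 : bsum (fun i => psi j (S i) ^ 2) n <= INR (S n) * P0 ^ 2).
    { apply Rle_trans with (INR n * P0 ^ 2).
      - rewrite <- bsum_const. apply bsum_le. intros i Hi. apply pow_maj_Rabs, Hpsi; lia.
      - apply Rmult_le_compat_r; [apply pow2_ge_0|]. apply le_INR. lia. }
    assert (HkR : 7 / 6 * (kk j / h ^ 2) * bsum (fun i => (rho j (S i) - rho j i) ^ 2) (S n)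
                  <= 7 / 6 * Kk * (INR (S n) * R0 ^ 2)).
    { apply Rle_trans with (7 / 6 * (kk j / h ^ 2) * (INR (S n) * (R0 * h) ^ 2)).
      - apply Rmult_le_compat_l; [|exact Hr2].
        apply Rmult_le_pos; [lra|]. apply Rlt_le, Rdiv_lt_0_compat; [lra|apply pow_lt, Hh0].
      - replace (7 / 6 * (kk j / h ^ 2) * (INR (S n) * (R0 * h) ^ 2))
          with (7 / 6 * kk j * (INR (S n) * R0 ^ 2)) by (field; lra).
        apply Rmult_le_compat_r; [|lra].
        apply Rmult_le_pos; [apply pos_INR|apply pow2_ge_0]. }
    assert (HpR : L ^ 2 / c1 * bsum (fun i => psi j (S i) ^ 2) n
                  <= L ^ 2 / c1 * (INR (S n) * P0 ^ 2)).
    { apply Rmult_le_compat_l; [|exact Hp2].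
      apply Rmult_le_pos; [apply pow2_ge_0|apply Rlt_le, Rinv_0_lt_compat, Hc1]. }
    unfold source_bound. nra. }
  apply Rle_trans with (Q * (2 * bsum (fun i => Hh h w (S i) *
     (kk j * dxx h w (S i) + kk j * dxx h (rho j) (S i) - qq j * Hh h w (S i)
      + psi j (S i))) n)).
  2:{ apply Rmult_le_compat_l; [lra|]. lra. }
  rewrite <- !bsum_scal.
  rewrite (sum_eq _ (fun s => bsum (fun i => ccoef alpha sigma j (j - s) *
      (Hh h (z (S s)) (S i) ^ 2 - Hh h (z s) (S i) ^ 2)) n)).
  2:{ intros s _. rewrite bsum_scal. f_equal.
      rewrite (bsum_ext (fun i => Hh h (z (S s)) (S i) ^ 2 - Hh h (z s) (S i) ^ 2)
        (fun i => Hh h (z (S s)) (S i) ^ 2 + -1 * Hh h (z s) (S i) ^ 2)) by (intros; ring).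
      rewrite bsum_plus, bsum_scal. ring. }
  rewrite <- (bsum_sum_swap (fun i s => ccoef alpha sigma j (j - s) *
      (Hh h (z (S s)) (S i) ^ 2 - Hh h (z s) (S i) ^ 2))).
  (* Node by node, the energy inequality is applied to the sequence [Hh h (z s) (S i)] in [s]; its
     [sigma]-average is [Hh h w (S i)] by linearity. *)
  apply bsum_le. intros i Hi. fold w in Hscheme.
  pose proof (Hscheme i j Hi Hj) as Hs. fold w in Hs. rewrite <- Hs.
  rewrite frac_diff_factor by exact Htau. fold Q.
  pose proof (ccoef_convolution_energy alpha sigma Halpha Hsigma j
    (fun s => Hh h (z s) (S i))) as He. cbv beta in He.
  eapply Rle_trans; [exact He|]. right.
  unfold w, ysig. rewrite Hh_lin. field. lra.
Qed.

Lemma discrete_stability (j : nat) : (j <= M)%nat ->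
  h * bsum (fun i => z j (S i) ^ 2) n <=
  8 / 3 * h * (Gamma (2 - alpha) * Rpower T alpha / (1 - alpha) * source_bound).
Proof.
  intros Hj.
  destruct (Gamma_recurrence (1 - alpha) ltac:(lra)) as [HG1 HG2].
  replace (1 - alpha + 1) with (2 - alpha) in HG2 by ring.
  assert (HG : 0 < Gamma (2 - alpha)) by (rewrite HG2; apply Rmult_lt_0_compat; lra).
  assert (HSB : 0 <= source_bound).
  { unfold source_bound. apply Rmult_le_pos; [pose proof (pos_INR (S n)); lra|].
    apply Rplus_le_le_0_compat; apply Rmult_le_pos; try apply pow2_ge_0; [lra|].
    apply Rmult_le_pos; [apply pow2_ge_0|apply Rlt_le, Rinv_0_lt_compat, Hc1]. }
  assert (HE : energy j <= Gamma (2 - alpha) * Rpower T alpha / (1 - alpha) * source_bound).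
  { apply (ccoef_stability alpha sigma Halpha Hsigma M energy); [| | |exact Hj].
    - apply Rmult_le_pos; [|exact HSB]. apply Rlt_le, Rdiv_lt_0_compat; [|lra].
      apply Rmult_lt_0_compat; [exact HG|apply Rpower_gt0].
    - rewrite (bsum_ext _ (fun _ => 0)).
      + rewrite bsum_const. ring.
      + intros i Hi. rewrite Hh_S by lra. rewrite !Hinit by lia. field.
    - intros m Hm. eapply Rle_trans; [apply energy_convolution_le, Hm|].
      pose proof (ccoef_last_ge alpha sigma Halpha Hsigma m) as Hc.
      pose proof (pos_INR m).
      assert (Hms : (INR m + sigma) * tau <= T).
      { eapply Rle_trans; [|exact HMT]. apply Rmult_le_compat_r; [lra|].
        assert (Hm1 : INR (S m) <= INR M) by (apply le_INR; lia). rewrite S_INR in Hm1. lra. }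
      (* Because [(m + sigma) * tau <= T], the last coefficient is at least
         [(1 - alpha) (tau / T)^alpha]. The factor [tau^alpha] of the discrete derivative is thereby
         cancelled and the bound is uniform in [tau]. *)
      assert (Hcc : (1 - alpha) * (Rpower tau alpha * / Rpower T alpha) <= ccoef alpha sigma m m).
      { eapply Rle_trans; [|exact Hc]. apply Rmult_le_compat_l; [lra|].
        apply (Rmult_le_reg_r (Rpower tau (- alpha))); [apply Rpower_gt0|].
        rewrite Rpower_mult_distr by lra. rewrite (Rpower_Ropp tau).
        replace (Rpower tau alpha * / Rpower T alpha * / Rpower tau alpha)
          with (Rpower T (- alpha)).
        - apply Rpower_decr; [lra| |exact Hms]. apply Rmult_lt_0_compat; lra.
        - rewrite Rpower_Ropp. pose proof (Rpower_gt0 tau alpha). pose proof (Rpower_gt0 T alpha).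
          field. lra. }
      apply Rle_trans with ((1 - alpha) * (Rpower tau alpha * / Rpower T alpha) *
        (Gamma (2 - alpha) * Rpower T alpha / (1 - alpha) * source_bound)).
      + right. pose proof (Rpower_gt0 T alpha). field. lra.
      + apply Rmult_le_compat_r; [|exact Hcc].
        apply Rmult_le_pos; [|exact HSB]. apply Rlt_le, Rdiv_lt_0_compat; [|lra].
        apply Rmult_lt_0_compat; [exact HG|apply Rpower_gt0]. }
  pose proof (bsum_sq_le_Hh n h (z j) Hh0 (Hz0 j Hj) (HzN j Hj)) as Hb.
  replace (8 / 3 * h * (Gamma (2 - alpha) * Rpower T alpha / (1 - alpha) * source_bound))
    with (h * (8 / 3 * (Gamma (2 - alpha) * Rpower T alpha / (1 - alpha) * source_bound))) by ring.
  apply Rmult_le_compat_l; [lra|]. lra.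
Qed.

End DiscreteStability.

Lemma norm0_S (n : nat) (h : R) (v : nat -> R) :
  norm0 (S n) h v = sqrt (h * bsum (fun i => v (S i) ^ 2) n).
Proof.
  unfold norm0. f_equal. replace (S n - 1)%nat with n by lia.
  induction n as [|n IH]; [simpl; ring|].
  rewrite tech5, IH. simpl bsum. simpl Nat.eqb. cbv iota. ring.
Qed.

(** * Consistency of the scheme *)

Lemma cont_on_ext (a b : R) (f g : R -> R) :
  (forall x, f x = g x) -> cont_on a b f -> cont_on a b g.
Proof.
  intros Hfg Hf x Hx eps Heps. destruct (Hf x Hx eps Heps) as [d [Hd H]].
  exists d. split; [exact Hd|]. intros y Hy Hyx. rewrite <- !Hfg. now apply H.
Qed.

Lemma cont_on_frac_diff (a b alpha sigma tau : R) (w : nat -> R -> R) (j : nat) :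
  (forall s, (s <= S j)%nat -> cont_on a b (w s)) ->
  cont_on a b (fun x => frac_diff alpha sigma tau (fun s => w s x) j).
Proof.
  intros Hw. unfold frac_diff.
  set (P := Rpower tau (1 - alpha) / Gamma (2 - alpha)).
  apply cont_on_ext with (fun x => P * sum_f_R0 (fun s => ccoef alpha sigma j (j - s) / tau
      * w (S s) x + - (ccoef alpha sigma j (j - s) / tau) * w s x) j + 0 * 0).
  - intros x. rewrite Rmult_0_l, Rplus_0_r. f_equal. apply sum_eq. intros s _. unfold Rdiv. ring.
  - apply cont_on_lin; [|apply cont_on_const].
    apply (cont_on_sum a b (fun s x => ccoef alpha sigma j (j - s) / tau
      * w (S s) x + - (ccoef alpha sigma j (j - s) / tau) * w s x)).
    intros s Hs. apply cont_on_lin; apply Hw; lia.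
Qed.

Lemma frac_diff_Hh (alpha sigma tau h : R) (U : nat -> nat -> R) (i j : nat) : h <> 0 ->
  frac_diff alpha sigma tau (fun s => Hh h (U s) (S i)) j =
  Hh h (fun m => frac_diff alpha sigma tau (fun s => U s m) j) (S i).
Proof.
  intros Hh0. rewrite Hh_S by exact Hh0.
  rewrite (frac_diff_ext _ _ _ _
    (fun s => 1 * (/ 12 * U s i + 10 / 12 * U s (S i)) + / 12 * U s (S (S i)))).
  2:{ intros s _. rewrite Hh_S by exact Hh0. field. }
  rewrite frac_diff_lin, frac_diff_lin. field.
Qed.

Lemma Hh_bound (h B : R) (v : nat -> R) (i : nat) : h <> 0 ->
  Rabs (v i) <= B -> Rabs (v (S i)) <= B -> Rabs (v (S (S i))) <= B ->
  Rabs (Hh h v (S i)) <= B.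
Proof.
  intros Hh0 H0 H1 H2. rewrite Hh_S by exact Hh0.
  apply Rabs_le_between in H0, H1, H2. apply Rabs_le. lra.
Qed.

Lemma Derive_n_2_within (l : R) (g g1 g2 : R -> R) (x : R) :
  has_deriv_within 0 l g g1 -> has_deriv_within 0 l g1 g2 -> 0 < x < l ->
  Derive_n g 2 x = g2 x.
Proof.
  intros H1 H2 Hx. simpl. rewrite (Derive_ext_loc _ g1).
  - apply is_derive_unique. now apply (is_derive_of_within 0 l).
  - assert (Hm : 0 < Rmin x (l - x)) by (apply Rmin_pos; lra).
    exists (mkposreal _ Hm). intros y Hy. unfold ball in Hy; simpl in Hy;
    unfold AbsRing_ball, abs, minus, plus, opp in Hy; simpl in Hy.
    pose proof (Rmin_l x (l - x)). pose proof (Rmin_r x (l - x)).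
    apply Rabs_def2 in Hy. apply is_derive_unique. apply (is_derive_of_within 0 l); [exact H1|lra].
Qed.

Section Consistency.

Variables (alpha l T K Kk Kq : R) (k q : R -> R) (f : R -> R -> R) (Dx Dt : nat -> R -> R -> R).
Hypothesis Halpha : 0 < alpha < 1.
Hypothesis Hl : 0 < l.
Hypothesis HT : 0 < T.
Hypothesis HK : 0 < K.
Hypothesis HDxt : Dx O = Dt O.
Hypothesis HDx : forall k, (k < 6)%nat -> forall t, 0 <= t <= T ->
  has_deriv_within 0 l (fun x => Dx k x t) (fun x => Dx (S k) x t).
Hypothesis HDt : forall k, (k < 3)%nat -> forall x, 0 <= x <= l ->
  has_deriv_within 0 T (fun t => Dt k x t) (fun t => Dt (S k) x t).
Hypothesis HKx6 : forall x t, 0 <= x <= l -> 0 <= t <= T -> Rabs (Dx 6 x t) <= K.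
Hypothesis HKt2 : forall x t, 0 <= x <= l -> 0 <= t <= T -> Rabs (Dt 2 x t) <= K.
Hypothesis HKt3 : forall x t, 0 <= x <= l -> 0 <= t <= T -> Rabs (Dt 3 x t) <= K.
Hypothesis Hc0 : cont_rect l T (Dt 0).
Hypothesis Hc1 : cont_rect l T (Dt 1).
Hypothesis Hc2 : cont_rect l T (Dx 2).
Hypothesis Hcf : cont_rect l T f.
Hypothesis Hkb : forall t, 0 <= t <= T -> Rabs (k t) <= Kk.
Hypothesis Hqb : forall t, 0 <= t <= T -> Rabs (q t) <= Kq.
Hypothesis Hpde : forall x t, 0 < x < l -> 0 < t <= T ->
  caputo alpha (Dt 0) x t = k t * Dx 2 x t - q t * Dt 0 x t + f x t.

Variables (tau : R) (j : nat).
Hypothesis Htau : 0 < tau.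
Hypothesis Hj : (INR j + 1) * tau <= T.

Local Notation sigma := (1 - alpha / 2).
Local Notation t := ((INR j + sigma) * tau).
Local Notation Ct := (3 * K * Rpower T (1 - alpha) / ((1 - alpha) * Gamma (1 - alpha))).

Definition residual (x : R) : R :=
  frac_diff alpha sigma tau (fun s => Dt 0 x (INR s * tau)) j
  - (k t * Dx 2 x t - q t * Dt 0 x t + f x t).

(* The equation is only available in the open interval, but the discrete residual is
   continuous in [x], so its bound extends to the boundary nodes used by [Hh]. *)
Lemma residual_bound (x : R) : 0 <= x <= l -> Rabs (residual x) <= Ct * tau ^ 2.
Proof.
  pose proof (t_bounds alpha T Halpha tau j Htau Hj) as Htb. pose proof (pos_INR j) as Hj0.
  assert (Ht : 0 < t < T) by (split; [apply Rmult_lt_0_compat; lra|lra]).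
  apply cont_on_closure_bound with (a := 0) (b := l); [exact Hl| |].
  - apply cont_on_ext with (fun x =>
      1 * (1 * (1 * frac_diff alpha sigma tau (fun s => Dt 0 x (INR s * tau)) j
      + - k t * Dx 2 x t) + q t * Dt 0 x t) + -1 * f x t).
    { intros y. unfold residual. ring. }
    apply cont_on_lin; [|apply cont_rect_slice_x with T; [exact Hcf|lra]].
    apply cont_on_lin; [|apply cont_rect_slice_x with T; [exact Hc0|lra]].
    apply cont_on_lin; [|apply cont_rect_slice_x with T; [exact Hc2|lra]].
    apply (cont_on_frac_diff 0 l alpha sigma tau (fun s y => Dt 0%nat y (INR s * tau))).
    intros s Hs. apply cont_rect_slice_x with T; [exact Hc0|].
    apply (node_in T tau j Htau Hj s Hs).
  - intros y Hy. unfold residual. rewrite <- Hpde by lra.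
    rewrite Rabs_minus_sym.
    exact (caputo_truncation alpha T K (fun m s => Dt m y s) Halpha HT
      (fun m Hm => HDt m Hm y ltac:(lra)) (fun s Hs => HKt3 y s ltac:(lra) Hs)
      (cont_rect_slice_t l T y (Dt 1%nat) Hc1 ltac:(lra)) tau j Htau Hj).
Qed.

Variables (h : R) (n : nat).
Hypothesis Hh0 : 0 < h.
Hypothesis HhN : h * INR (S n) = l.

Local Notation U := (fun s i : nat => Dt 0%nat (INR i * h) (INR s * tau)).

(** The negative of the defect [r], with the sign in which it is added to [ysig] to give the
    solution at [t_(j+sigma)]. *)
Definition step_defect (i : nat) : R := Dt 0%nat (INR i * h) t - ysig sigma U j i.

Lemma grid_in (i : nat) : (i <= S n)%nat -> 0 <= INR i * h <= l.
Proof.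
  intros Hi. apply le_INR in Hi. pose proof (pos_INR i). split; [nra|].
  rewrite <- HhN, Rmult_comm. apply Rmult_le_compat_l; lra.
Qed.

Lemma step_defect_eq (i : nat) :
  step_defect i = - interp_defect Dx sigma 0 (INR j * tau) tau (INR i * h).
Proof.
  unfold step_defect, interp_defect, ysig. rewrite HDxt, S_INR.
  replace (INR j * tau + tau) with ((INR j + 1) * tau) by ring.
  replace (INR j * tau + sigma * tau) with t by ring. ring.
Qed.

Lemma step_window : 0 <= INR j * tau /\ INR j * tau + tau <= T.
Proof. pose proof (pos_INR j). split; [apply Rmult_le_pos; lra|lra]. Qed.

Lemma step_defect_bound (i : nat) : (i <= S n)%nat ->
  Rabs (step_defect i) <= (K + 2 * K * T) * tau ^ 2.
Proof.
  intros Hi. rewrite step_defect_eq, Rabs_Ropp. destruct step_window as [H1 H2].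
  pose proof (grid_in i Hi) as Hx.
  eapply Rle_trans; [apply (interp_defect_bound l T Dx Dt K); (assumption || lra)|].
  apply Rmult_le_compat_r; [apply pow2_ge_0|]. apply Rplus_le_compat_r.
  apply HKt2; [exact Hx|lra].
Qed.

Lemma step_defect_increment (A : R) (i : nat) : (i <= n)%nat ->
  (forall x, 0 <= x <= l -> Rabs (interp_defect Dx sigma 1 (INR j * tau) tau x) <= A) ->
  Rabs (step_defect (S i) - step_defect i) <= A * h.
Proof.
  intros Hi HA. destruct step_window as [H1 H2].
  pose proof (grid_in i ltac:(lia)) as Hx. pose proof (grid_in (S i) ltac:(lia)) as Hy.
  destruct (mean_value_within 0 l (INR i * h) (INR (S i) * h) _ _
    (interp_defect_deriv l T Dx HDx sigma ltac:(lra) 0 (INR j * tau) tau ltac:(lia) Htau H1 H2)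
    Hx Hy) as [c [Hc Hm]].
  rewrite !step_defect_eq.
  match goal with |- Rabs ?e <= _ => replace e with
    (- (interp_defect Dx sigma 0 (INR j * tau) tau (INR (S i) * h)
        - interp_defect Dx sigma 0 (INR j * tau) tau (INR i * h))) by ring end.
  rewrite Rabs_Ropp, Hm, Rabs_mult.
  replace (INR (S i) * h - INR i * h) with h by (rewrite S_INR; ring).
  rewrite (Rabs_pos_eq h) by lra. apply Rmult_le_compat_r; [lra|]. apply HA.
  assert (INR i * h <= INR (S i) * h) by (rewrite S_INR; lra).
  rewrite Rmin_left, Rmax_right in Hc by assumption. lra.
Qed.

(** The term [k t * dxx h step_defect i] is taken out: it need not be [O(tau^2)] and is passed to
    the stability estimate as [rho], whose first differences alone are measured. *)
Definition consistency_error (i : nat) : R :=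
  frac_diff alpha sigma tau (fun s => Hh h (U s) i) j
  - (k t * dxx h (ysig sigma U j) i + k t * dxx h step_defect i
     - q t * Hh h (ysig sigma U j) i + Hh h (fun m => f (INR m * h) t) i).

(** Three contributions: the time residual averaged by [Hh], the Numerov error times [k], and the
    reaction term, where the step defect occurs without any x-difference and is directly
    [O(tau^2)]. *)
Lemma consistency_error_bound (i : nat) : (i < n)%nat ->
  Rabs (consistency_error (S i)) <=
  (Ct + Kq * (K + 2 * K * T)) * tau ^ 2 + Kk * (3 * K) * h ^ 4.
Proof.
  intros Hi.
  pose proof (t_bounds alpha T Halpha tau j Htau Hj) as Htb. pose proof (pos_INR j) as Hj0.
  assert (Ht : 0 < t < T) by (split; [apply Rmult_lt_0_compat; lra|lra]).
  set (x := INR (S i) * h).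
  assert (Hxm : INR i * h = x - h) by (unfold x; rewrite S_INR; ring).
  assert (Hxp : INR (S (S i)) * h = x + h) by (unfold x; rewrite !S_INR; ring).
  pose proof (grid_in i ltac:(lia)) as Hgm. pose proof (grid_in (S (S i)) ltac:(lia)) as Hgp.
  pose proof (numerov_error l T Dx K HK HDx HKx6 x h t Hh0 ltac:(lra) ltac:(lra) ltac:(lra)) as HN.
  set (nu := _ - _) in HN.
  assert (Hdec : consistency_error (S i) =
    Hh h (fun m => residual (INR m * h)) (S i) + k t * nu - q t * Hh h step_defect (S i)).
  { unfold consistency_error. rewrite frac_diff_Hh by lra.
    unfold nu, residual. rewrite HDxt. rewrite !Hh_S by lra. unfold dxx.
    replace (S i - 1)%nat with i by lia. unfold step_defect.
    rewrite Hxm, Hxp. fold x. field. lra. }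
  rewrite Hdec.
  assert (HR : Rabs (Hh h (fun m => residual (INR m * h)) (S i)) <= Ct * tau ^ 2).
  { apply Hh_bound; [lra| | |]; apply residual_bound, grid_in; lia. }
  assert (HS : Rabs (Hh h step_defect (S i)) <= (K + 2 * K * T) * tau ^ 2).
  { apply Hh_bound; [lra| | |]; apply step_defect_bound; lia. }
  assert (Hkn : Rabs (k t * nu) <= Kk * (3 * K * h ^ 4)).
  { rewrite Rabs_mult. apply Rmult_le_compat; try apply Rabs_pos; [|exact HN].
    apply Hkb. lra. }
  assert (Hqn : Rabs (q t * Hh h step_defect (S i)) <= Kq * ((K + 2 * K * T) * tau ^ 2)).
  { rewrite Rabs_mult. apply Rmult_le_compat; try apply Rabs_pos; [|exact HS].
    apply Hqb. lra. }
  apply Rabs_le_between in HR, Hkn, Hqn. apply Rabs_le. lra.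
Qed.

End Consistency.

(** * Convergence of the scheme *)

Theorem theorem5
  (alpha l T c1 : R) (k q : R -> R) (f u : R -> R -> R) (u0 : R -> R)
  (Halpha : 0 < alpha < 1) (Hl : 0 < l) (HT : 0 < T) (Hc1 : 0 < c1)
  (Hk : forall t, 0 <= t <= T -> c1 <= k t)
  (Hq : forall t, 0 <= t <= T -> 0 <= q t)
  (Hkc : cont_on 0 T k) (Hqc : cont_on 0 T q) (Hfc : cont_rect l T f)
  (Hu : smooth_xt 6 3 l T u)
  (Heq : forall x t, 0 < x < l -> 0 < t <= T ->
     caputo alpha u x t =
       k t * Derive_n (fun z => u z t) 2 x - q t * u x t + f x t)
  (Hbc : forall t, 0 <= t <= T -> u 0 t = 0 /\ u l t = 0)
  (Hinit : forall x, 0 <= x <= l -> u x 0 = u0 x) :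
  exists CR, 0 < CR /\
    forall (N M : nat), (0 < N)%nat -> (0 < M)%nat ->
    let sigma := 1 - alpha / 2 in
    let h := l / INR N in
    let tau := T / INR M in
    forall y : nat -> nat -> R,
      (forall i j, (1 <= i <= N - 1)%nat -> (j <= M - 1)%nat ->
         let tjs := (INR j + sigma) * tau in
         frac_diff alpha sigma tau (fun s => Hh h (y s) i) j =
           k tjs * dxx h (ysig sigma y j) i
           - q tjs * Hh h (ysig sigma y j) i
           + Hh h (fun i' => f (INR i' * h) tjs) i) ->
      (forall j, (j <= M)%nat -> y j O = 0 /\ y j N = 0) ->
      (forall i, (1 <= i <= N - 1)%nat -> y O i = u0 (INR i * h)) ->
      forall j, (1 <= j <= M)%nat ->
        norm0 N h (fun i => u (INR i * h) (INR j * tau) - y j i)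
          <= CR * (tau ^ 2 + h ^ 4).
Proof.
  destruct Hu as [[Dx [HD0 [HDx HcDx]]] [Dt [HE0 [HDt HcDt]]]].
  assert (HDxt : Dx O = Dt O) by congruence. rewrite <- HE0 in *. clear HD0 HE0 u.
  destruct (cont_rect_bounded l T (Dx 1%nat) (HcDx 1%nat ltac:(lia))) as [B1 [HB1 Hb1]].
  destruct (cont_rect_bounded l T (Dx 6%nat) (HcDx 6%nat ltac:(lia))) as [B2 [HB2 Hb2]].
  destruct (cont_rect_bounded l T (Dt 2%nat) (HcDt 2%nat ltac:(lia))) as [B3 [HB3 Hb3]].
  destruct (cont_rect_bounded l T (Dt 3%nat) (HcDt 3%nat ltac:(lia))) as [B4 [HB4 Hb4]].
  destruct (cont_on_bounded T k Hkc) as [Kk [HKk Hkb]].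
  destruct (cont_on_bounded T q Hqc) as [Kq [HKq Hqb]].
  set (K := B1 + B2 + B3 + B4). assert (HK : 0 < K) by (unfold K; lra).
  assert (Hlift : forall (B : R) (g : R -> R -> R), B <= K ->
    (forall x t, 0 <= x <= l -> 0 <= t <= T -> Rabs (g x t) <= B) ->
    forall x t, 0 <= x <= l -> 0 <= t <= T -> Rabs (g x t) <= K).
  { intros B g HBK Hg x t Hx Ht. specialize (Hg x t Hx Ht). lra. }
  pose proof (Hlift B1 (Dx 1%nat) ltac:(unfold K; lra) Hb1) as HKx1.
  pose proof (Hlift B2 (Dx 6%nat) ltac:(unfold K; lra) Hb2) as HKx6.
  pose proof (Hlift B3 (Dt 2%nat) ltac:(unfold K; lra) Hb3) as HKt2.
  pose proof (Hlift B4 (Dt 3%nat) ltac:(unfold K; lra) Hb4) as HKt3.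
  clearbody K. clear Hlift B1 HB1 Hb1 B2 HB2 Hb2 B3 HB3 Hb3 B4 HB4 Hb4.
  destruct (interp_defect_dx_bound l T Dx Dt K Hl HT HK HDxt HDx HDt HKx1 HKx6 HKt3
    (1 - alpha / 2) ltac:(lra)) as [A [HA HAb]].
  destruct (Gamma_recurrence (1 - alpha) ltac:(lra)) as [HG1 HG2].
  replace (1 - alpha + 1) with (2 - alpha) in HG2 by ring.
  assert (HG : 0 < Gamma (2 - alpha)) by (rewrite HG2; apply Rmult_lt_0_compat; lra).
  set (Ct := 3 * K * Rpower T (1 - alpha) / ((1 - alpha) * Gamma (1 - alpha))).
  assert (HCt : 0 < Ct).
  { apply Rdiv_lt_0_compat; apply Rmult_lt_0_compat; try lra. apply Rpower_gt0. }
  set (Cp := Ct + Kq * (K + 2 * K * T) + Kk * (3 * K)).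
  assert (Hq1 : 0 < Kq * (K + 2 * K * T)) by (apply Rmult_lt_0_compat; nra).
  assert (Hk1 : 0 < Kk * (3 * K)) by (apply Rmult_lt_0_compat; lra).
  set (C4 := 8 / 3 * l * (Gamma (2 - alpha) * Rpower T alpha / (1 - alpha)
              * (2 * (7 / 6 * Kk * A ^ 2 + l ^ 2 / c1 * Cp ^ 2)))).
  assert (HC4 : 0 < C4).
  { apply Rmult_lt_0_compat; [lra|]. apply Rmult_lt_0_compat.
    - apply Rdiv_lt_0_compat; [|lra]. apply Rmult_lt_0_compat; [exact HG|apply Rpower_gt0].
    - apply Rmult_lt_0_compat; [lra|]. apply Rplus_lt_le_0_compat.
      + apply Rmult_lt_0_compat; [lra|]. now apply pow_lt.
      + apply Rmult_le_pos; [|apply pow2_ge_0].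
        apply Rmult_le_pos; [apply pow2_ge_0|apply Rlt_le, Rinv_0_lt_compat, Hc1]. }
  (* [C4] bounds the squared norm; [C4 <= (1 + C4) ^ 2] avoids its square root. *)
  exists (1 + C4). split; [lra|].
  intros N M HN HM sigma h tau y Hsch Hbd Hin j Hj.
  destruct N as [|n]; [lia|].
  assert (HNr : 0 < INR (S n)) by (apply lt_0_INR; lia).
  assert (HMr : 0 < INR M) by now apply lt_0_INR.
  assert (Hh0 : 0 < h) by now apply Rdiv_lt_0_compat.
  assert (Htau : 0 < tau) by now apply Rdiv_lt_0_compat.
  assert (HhN : h * INR (S n) = l) by (unfold h; field; lra).
  assert (HMT : INR M * tau = T) by (unfold tau; field; lra).
  assert (Hwin : forall m, (m < M)%nat -> (INR m + 1) * tau <= T).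
  { intros m Hm. rewrite <- HMT, <- S_INR. apply Rmult_le_compat_r; [lra|]. apply le_INR. lia. }
  assert (Htime : forall m, (m <= M)%nat -> 0 <= INR m * tau <= T).
  { intros m Hm. pose proof (pos_INR m). split; [apply Rmult_le_pos; lra|].
    rewrite <- HMT. apply Rmult_le_compat_r; [lra|]. now apply le_INR. }
  assert (Hmid : forall m, (m < M)%nat -> 0 <= (INR m + sigma) * tau <= T).
  { intros m Hm. pose proof (t_bounds alpha T Halpha tau m Htau (Hwin m Hm)) as Hb.
    fold sigma in Hb. pose proof (Htime m ltac:(lia)). lra. }
  pose proof (grid_in l h n Hh0 HhN) as Hgrid.
  set (theta := tau ^ 2 + h ^ 4).
  assert (Ht2 : 0 <= tau ^ 2) by apply pow2_ge_0.
  assert (Hh4 : 0 <= h ^ 4) by (apply pow_le; lra).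
  set (z := fun s i => Dt O (INR i * h) (INR s * tau) - y s i).
  assert (Hstab : h * bsum (fun i => z j (S i) ^ 2) n <=
    8 / 3 * h * (Gamma (2 - alpha) * Rpower T alpha / (1 - alpha) *
                 source_bound c1 Kk (A * theta) (Cp * theta) h n)).
  (* The error solves the scheme with [step_defect] as [rho] and [consistency_error] as [psi]. *)
  { apply (discrete_stability alpha sigma T c1 Kk (A * theta) (Cp * theta) h tau n M z
      (fun m => step_defect alpha Dt tau m h)
      (fun m => consistency_error alpha k q f Dt tau m h)
      (fun m => k ((INR m + sigma) * tau)) (fun m => q ((INR m + sigma) * tau)));
      try assumption; try reflexivity; try lra.
    - intros m Hm. unfold z. destruct (Hbd m Hm) as [H0 _]. rewrite H0.
      replace (INR 0 * h) with 0 by (simpl; ring).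
      rewrite (proj1 (Hbc _ (Htime m Hm))). ring.
    - intros m Hm. unfold z. destruct (Hbd m Hm) as [_ H0]. rewrite H0.
      rewrite (Rmult_comm _ h), HhN. rewrite (proj2 (Hbc _ (Htime m Hm))). ring.
    (* The initial data of the scheme are prescribed at interior nodes; at the two end nodes the
       error vanishes by the boundary conditions. *)
    - intros i Hi. unfold z. replace (INR 0 * tau) with 0 by (simpl; ring).
      destruct (Nat.eq_dec i 0) as [->|Hi0].
      { destruct (Hbd O ltac:(lia)) as [H0 _]. rewrite H0.
        replace (INR 0 * h) with 0 by (simpl; ring). rewrite (proj1 (Hbc 0 ltac:(lra))). ring. }
      destruct (Nat.eq_dec i (S n)) as [->|HiN].
      { destruct (Hbd O ltac:(lia)) as [_ H0]. rewrite H0.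
        rewrite (Rmult_comm _ h), HhN, (proj2 (Hbc 0 ltac:(lra))). ring. }
      rewrite Hin by lia. rewrite Hinit by now apply Hgrid. ring.
    - intros m Hm. split; [now apply Hk, Hmid|].
      eapply Rle_trans; [apply Rle_abs|]. now apply Hkb, Hmid.
    - intros m Hm. now apply Hq, Hmid.
    - intros i m Hi Hm.
      apply (step_defect_increment alpha l T Dx Dt Halpha HDxt HDx tau m Htau (Hwin m Hm)
        h n Hh0 HhN); [exact Hi|].
      intros x Hx.
      destruct (step_window T tau m Htau (Hwin m Hm)) as [Hw1 Hw2].
      eapply Rle_trans; [apply HAb; assumption|].
      apply Rmult_le_compat_l; [lra|]. unfold theta. lra.
    - intros i m Hi Hm.
      eapply Rle_trans; [apply (consistency_error_bound alpha l T K Kk Kq k q f Dx Dt)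
        with (n := n); try assumption|].
      + apply HcDt. lia.
      + apply HcDt. lia.
      + apply HcDx. lia.
      + intros x t Hx Ht. rewrite (Heq x t Hx Ht).
        rewrite (Derive_n_2_within l _ (fun x => Dx 1%nat x t) (fun x => Dx 2%nat x t));
          [reflexivity| | |exact Hx].
        * rewrite <- HDxt. apply HDx; [lia|lra].
        * apply HDx; [lia|lra].
      + now apply Hwin.
      + fold Ct. unfold Cp, theta. nra.
    - intros i m Hi Hm. unfold consistency_error. fold sigma.
      set (U := fun s i => Dt O (INR i * h) (INR s * tau)).
      rewrite (frac_diff_ext _ _ _ (fun s => Hh h (z s) (S i))
        (fun s => 1 * Hh h (U s) (S i) + -1 * Hh h (y s) (S i))).
      2:{ intros s _. rewrite <- Hh_lin. unfold z, U, Hh, dxx, Rdiv. ring. }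
      rewrite frac_diff_lin, (Hsch (S i) m) by lia.
      replace (Hh h (ysig sigma z m) (S i))
        with (Hh h (ysig sigma U m) (S i) - Hh h (ysig sigma y m) (S i))
        by (unfold z, U, Hh, ysig, dxx, Rdiv; ring).
      replace (dxx h (ysig sigma z m) (S i))
        with (dxx h (ysig sigma U m) (S i) - dxx h (ysig sigma y m) (S i))
        by (unfold z, U, ysig, dxx, Rdiv; ring).
      change (frac_diff alpha sigma tau
        (fun s => Hh h (fun i0 => Dt 0%nat (INR i0 * h) (INR s * tau)) (S i)) m)
        with (frac_diff alpha sigma tau (fun s => Hh h (U s) (S i)) m).
      ring.
    - lia. }
  rewrite norm0_S. fold theta.
  assert (Hth : 0 <= theta) by (unfold theta; lra).
  rewrite <- (sqrt_pow2 ((1 + C4) * theta)) by (apply Rmult_le_pos; lra).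
  apply sqrt_le_1_alt. eapply Rle_trans; [exact Hstab|].
  apply Rle_trans with (C4 * theta ^ 2).
  - right. unfold source_bound. rewrite HhN. unfold C4.
    replace (8 / 3 * l) with (8 / 3 * (h * INR (S n))) by (rewrite HhN; reflexivity).
    unfold Rdiv. ring.
  - rewrite Rpow_mult_distr. apply Rmult_le_compat_r; [apply pow2_ge_0|]. nra.
Qed.
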